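(* Let $n\ge2$. Let $R(z,\xi)$ be a linear operator on $V\otimes V$ and $K(z,\xi)$, $\underline K(z,\xi)$ linear operators on $V$, all depending meromorphically on $(z,\xi)\in\mathbb{C}^2$. Suppose that $R(z,\xi)$ satisfies the ice-rule $[R(z,\xi),\Delta(h)]=0$. The following two statements are equivalent. (1) The operators $$M^{s_0}(\mathbf{z})=T_{-\kappa h_1}\underline K_1(\tfrac12-z_1,\cdot)T_{\kappa h_1},$$ $$M^{s_i}(\mathbf{z})=P_{i,i+1}R_{i,i+1}\bigl(z_i-z_{i+1},2\xi-2\kappa(h_1+\cdots+h_{i-1})\bigr)\quad(1\le i<n),$$ $$M^{s_n}(\mathbf{z})=K_n\bigl(z_n,\xi-\kappa(h_1+\cdots+h_{n-1})\bigr)$$ (the last two acting as multiplication operators in $\xi$) are part of a (necessarily unique) set $\{M^v(\mathbf{z})\}_{v\in W}$ of $\mathrm{End}_{\mathbb{C}}(V^{\otimes n})$-valued meromorphic difference operators $M^v(\mathbf{z})$ in $\xi$, depending meromorphically on $\mathbf{z}\in\mathbb{C}^n$, satisfying the cocycle conditions $M^e(\mathbf{z})=\mathrm{Id}$ and $M^{uv}(\mathbf{z})=M^u(\mathbf{z})M^v(u^{-1}\mathbf{z})$ for all $u,v\in W$. (2) $R(z,\xi)$ is a unitary dynamical $R$-matrix, and $\underline K(z,\xi)$ and $K(z,\xi)$ are associated unitary left and right dynamical $K$-matrices respectively.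
   Context: $\kappa\in\mathbb{C}$ is fixed. $W_0=S_n\ltimes(\pm1)^n$ acts on $\mathbb{C}^n$ with simple reflections $s_i$ ($1\le i<n$) interchanging $z_i,z_{i+1}$ and $s_n:z_n\mapsto-z_n$; $W=W_0\ltimes\mathbb{Z}^n$ ($\mathbb{Z}^n$ acting by translations) is a Coxeter group with neutral element $e$ and simple reflections $s_0,s_1,\dots,s_n$, where $s_0\mathbf{z}=(1-z_1,z_2,\dots,z_n)$. $V$ is a finite dimensional complex vector space, $h:V\to V$ a semisimple linear operator, $h_i$ denotes $h$ acting on the $i$th leg of a tensor power of $V$, $\Delta(h)=h_1+h_2$. Subscripts on operators denote the tensor legs on which they act; $P$ is the permutation operator of $V\otimes V$; $R_{21}=PRP$. For operators $S(\xi)$ on $V^{\otimes n}$ depending meromorphically on $\xi$, $S(\xi+\sum_i\alpha_ih_i)v:=S(\xi+\sum_i\alpha_i\mu_i)v$ if $h_iv=\mu_iv$ for all $i$. For a meromorphic $V^{\otimes n}$-valued function $f(\xi)=\sum_{\underline\mu}f_{\underline\mu}(\xi)$ with $h_if_{\underline\mu}=\mu_if_{\underline\mu}$ for all $i$, $(T_{\alpha h_i}f)(\xi)=\sum_{\underline\mu}f_{\underline\mu}(\xi+\alpha\mu_i)$. $R$ is a dynamical $R$-matrix if $R_{12}(z_1-z_2,\xi-2\kappa h_3)R_{13}(z_1-z_3,\xi)R_{23}(z_2-z_3,\xi-2\kappa h_1)=R_{23}(z_2-z_3,\xi)R_{13}(z_1-z_3,\xi-2\kappa h_2)R_{12}(z_1-z_2,\xi)$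 on $V^{\otimes 3}$; it is unitary if $R_{21}(z,\xi)R(-z,\xi)=\mathrm{Id}$. $K$ is a right dynamical $K$-matrix associated to $R$ if $$R_{21}(z_1-z_2,2\xi)K_1(z_1,\xi-\kappa h_2)R_{12}(z_1+z_2,2\xi)K_2(z_2,\xi-\kappa h_1)=K_2(z_2,\xi-\kappa h_1)R_{21}(z_1+z_2,2\xi)K_1(z_1,\xi-\kappa h_2)R_{12}(z_1-z_2,2\xi).$$ $\underline K$ is a left dynamical $K$-matrix associated to $R$ if $$R(z_1-z_2,2\xi+2\kappa\Delta(h))\underline K_1(z_1,\xi+\kappa h_2)R_{21}(z_1+z_2,2\xi+2\kappa\Delta(h))\underline K_2(z_2,\xi+\kappa h_1)$$ $$=\underline K_2(z_2,\xi+\kappa h_1)R(z_1+z_2,2\xi+2\kappa\Delta(h))\underline K_1(z_1,\xi+\kappa h_2)R_{21}(z_1-z_2,2\xi+2\kappa\Delta(h)).$$ They are unitary if $K(z,\xi)K(-z,\xi)=\mathrm{Id}_V$, resp. $\underline K(z,\xi)\underline K(-z,\xi)=\mathrm{Id}_V$.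
   Formalization: For n=2 the dynamical Yang–Baxter equation is dropped from statement (2), because (1) does not imply it there (a constant unitary R on C^2⊗C^2 with h=0 and K, K̲ the identity is a counterexample); for n≥3 the equivalence is as stated. *)

(* Defs.v *)
From HB Require Import structures.
From mathcomp Require Import all_boot all_order all_fingroup all_algebra.
From mathcomp Require Import complex.
From mathcomp Require Import boolp classical_sets reals topology normedtype.
From mathcomp Require Import derive.

Set Implicit Arguments.
Unset Strict Implicit.
Unset Printing Implicit Defensive.
Import Order.TTheory GRing.Theory Num.Theory numFieldNormedType.Exports.
Local Open Scope ring_scope.
Local Open Scope complex_scope.
Local Open Scope classical_set_scope.

(* The element w = (s, e, t) is the affine transformation of C^n
     (w z)_i = (-1)^(e i) z_(s i) + t i      (see [affW_act]);
   the permutation part of w, as a map e_j |-> e_(p j), is thus p = s^-1. *)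
Record affW (n : nat) := AffW {
  affW_perm : {perm 'I_n};
  affW_sign : {ffun 'I_n -> bool};
  affW_trans : {ffun 'I_n -> int} }.

Section AffineWeylGroup.
Variable n : nat.
Implicit Types u v w : affW n.

Definition affW_tuple w := (affW_perm w, affW_sign w, affW_trans w).
Definition tuple_affW
    (p : {perm 'I_n} * {ffun 'I_n -> bool} * {ffun 'I_n -> int}) :=
  AffW p.1.1 p.1.2 p.2.
Lemma affW_tupleK : cancel affW_tuple tuple_affW. Proof. by case. Qed.
HB.instance Definition _ := Choice.copy (affW n) (can_type affW_tupleK).

Definition affW_one : affW n := AffW 1%g [ffun=> false] [ffun=> 0].

Definition affW_mul u v : affW n :=
  AffW (affW_perm u * affW_perm v)%g
    [ffun i => affW_sign u i (+) affW_sign v (affW_perm u i)]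
    [ffun i => (-1) ^+ affW_sign u i * affW_trans v (affW_perm u i)
               + affW_trans u i].

Definition affW_inv u : affW n :=
  let s := (affW_perm u)^-1%g in
  AffW s [ffun i => affW_sign u (s i)]
    [ffun i => - ((-1) ^+ affW_sign u (s i) * affW_trans u (s i))].

Lemma affW_ext u v :
  affW_perm u = affW_perm v -> affW_sign u =1 affW_sign v ->
  affW_trans u =1 affW_trans v -> u = v.
Proof.
by case: u v => [s e t] [s' e' t'] /= -> /ffunP -> /ffunP ->.
Qed.

Lemma affW_mulA : associative affW_mul.
Proof.
move=> u v w; apply: affW_ext => [|i|i] /=; first by rewrite mulgA.
- by rewrite !ffunE permM addbA.
- by rewrite !ffunE permM signr_addb mulrDr mulrA addrA.
Qed.

Lemma affW_mul1 : left_id affW_one affW_mul.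
Proof.
move=> u; apply: affW_ext => [|i|i] /=; first by rewrite mul1g.
- by rewrite !ffunE perm1.
- by rewrite !ffunE perm1 expr0 mul1r addr0.
Qed.

Lemma affW_mulr1 : right_id affW_one affW_mul.
Proof.
move=> u; apply: affW_ext => [|i|i] /=; first by rewrite mulg1.
- by rewrite !ffunE addbF.
- by rewrite !ffunE mulr0 add0r.
Qed.

Lemma affW_mulV : left_inverse affW_one affW_inv affW_mul.
Proof.
move=> u; apply: affW_ext => [|i|i] /=; first by rewrite mulVg.
- by rewrite !ffunE addbb.
- by rewrite !ffunE subrr.
Qed.

Lemma affW_mulrV : right_inverse affW_one affW_inv affW_mul.
Proof.
move=> u; apply: affW_ext => [|i|i] /=; first by rewrite mulgV.
- by rewrite !ffunE permK addbb.
- by rewrite !ffunE permK mulrN mulrA -signr_addb addbb mul1r addNr.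
Qed.

HB.instance Definition _ := isGroup.Build (affW n)
  affW_mulA affW_mul1 affW_mulr1 affW_mulV affW_mulrV.

Definition affW_act (F : pzRingType) w (z : 'rV[F]_n) : 'rV[F]_n :=
  \row_i ((-1) ^+ affW_sign w i * z 0 (affW_perm w i) + (affW_trans w i)%:~R).

Lemma affW_act1 (F : pzRingType) (z : 'rV[F]_n) : affW_act 1%g z = z.
Proof. by apply/rowP => i; rewrite !mxE /= !ffunE perm1 mul1r addr0. Qed.

Lemma affW_actM (F : pzRingType) u v (z : 'rV[F]_n) :
  affW_act (u * v)%g z = affW_act u (affW_act v z).
Proof.
apply/rowP => i; rewrite !mxE /= !ffunE permM signr_addb mulrDr mulrA.
by rewrite rmorphD rmorphM rmorph_sign addrA.
Qed.

(* The legs and coordinates are indexed by 'I_n, hence start at 0: in terms of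
   the following elements, s_0 = affine_reflection i for i = 0,
   s_n = sign_reflection i for i = n - 1, and
   s_(i+1) = swap_reflection i j for j = i + 1. *)
Definition affine_reflection (i : 'I_n) : affW n :=
  AffW 1%g [ffun j => j == i] [ffun j => (j == i)%:Z].
Definition swap_reflection (i j : 'I_n) : affW n :=
  AffW (tperm i j) [ffun=> false] [ffun=> 0].
Definition sign_reflection (i : 'I_n) : affW n :=
  AffW 1%g [ffun j => j == i] [ffun=> 0].

Lemma affine_reflectionE (F : pzRingType) i (z : 'rV[F]_n) j :
  affW_act (affine_reflection i) z 0 j = if j == i then 1 - z 0 i else z 0 j.
Proof.
rewrite !mxE /= !ffunE perm1; case: eqP => [->|_] /=.
  by rewrite mulN1r addrC.
by rewrite mul1r addr0.
Qed.

Lemma swap_reflectionE (F : pzRingType) i j (z : 'rV[F]_n) k :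
  affW_act (swap_reflection i j) z 0 k = z 0 (tperm i j k).
Proof. by rewrite !mxE /= !ffunE mul1r addr0. Qed.

Lemma sign_reflectionE (F : pzRingType) i (z : 'rV[F]_n) j :
  affW_act (sign_reflection i) z 0 j = if j == i then - z 0 i else z 0 j.
Proof.
rewrite !mxE /= !ffunE perm1 addr0; case: eqP => [->|_] /=.
  by rewrite mulN1r.
by rewrite mul1r.
Qed.

End AffineWeylGroup.

Section Meromorphic.
Variable RR : realType.
Notation C := RR[i].

(* A meromorphic function is represented by a total function; its values at
   the zeros of the local denominators are irrelevant, and equality of
   meromorphic functions is equality on a dense open set. *)
Definition generically (X : topologicalType) (P : X -> Prop) : Prop :=
  dense [set x | P x]°.

Definition holomorphic_on (X : normedModType C) (U : set X) (f : X -> C) :=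
  forall x, U x -> differentiable (f : X -> C^o) x.

(* The denominator b must not vanish identically on any nonempty open
   subset of U. *)
Definition meromorphic (X : normedModType C) (f : X -> C) : Prop :=
  forall x : X, exists (U : set X) (a b : X -> C),
    [/\ open U /\ U x, holomorphic_on U a, holomorphic_on U b,
        U `<=` closure [set y | b y != 0] &
        forall y, U y -> b y != 0 -> f y = a y / b y].

Definition meromorphic_mx (X : normedModType C) (p q : nat)
    (f : X -> 'M[C]_(p, q)) : Prop :=
  forall i j, meromorphic (fun x => f x i j).

End Meromorphic.

Section Tensor.
Variables (RR : realType) (d : nat).
Notation C := RR[i].

(* V^{⊗n} has the basis e_(a 0) ⊗ ... ⊗ e_(a (n-1)), with a : tidx n. Linear
   operators are matrices acting on column vectors. *)
Definition tidx (n : nat) : finType := {ffun 'I_n -> 'I_d}.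
Definition tvec (n : nat) : Type := 'cV[C]_#|tidx n|.
Definition tend (n : nat) : Type := 'M[C]_#|tidx n|.

Definition idx_of (n : nat) (a : 'I_#|tidx n|) : {ffun 'I_n -> 'I_d} :=
  enum_val a.

Definition tensor_op (n : nat) (A : 'I_n -> 'M[C]_d) : tend n :=
  \matrix_(a < #|tidx n|, b < #|tidx n|) \prod_i A i (idx_of a i) (idx_of b i).

Definition leg1 (n : nat) (A : 'M[C]_d) (i : 'I_n) : tend n :=
  tensor_op (fun j => if j == i then A else 1%:M).

Definition pair_idx (i j : 'I_d) : tidx 2 :=
  [ffun k : 'I_2 => if k == 0 then i else j].

(* B acting on the i-th and j-th tensor legs, in this order (i != j) *)
Definition leg2 (n : nat) (B : tend 2) (i j : 'I_n) : tend n :=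
  \matrix_(a < #|tidx n|, b < #|tidx n|)
    (let a' := idx_of a in let b' := idx_of b in
     B (enum_rank (pair_idx (a' i) (a' j))) (enum_rank (pair_idx (b' i) (b' j)))
     * [forall k, (k != i) && (k != j) ==> (a' k == b' k)]%:R).

Definition flip : tend 2 :=
  \matrix_(a < #|tidx 2|, b < #|tidx 2|)
    (let a' := idx_of a in let b' := idx_of b in
     (a' == pair_idx (b' 1) (b' 0))%:R).

Definition op21 (B : tend 2) : tend 2 := flip *m B *m flip.

Variable h : 'M[C]_d.

Definition spectrum : seq C :=
  undup (sval (closed_field_poly_normal (char_poly h))).

(* For diagonalizable h this is the projection onto the mu-eigenspace of h
   along the other eigenspaces (Lagrange interpolation). *)
Definition eigenproj (mu : C) : 'M[C]_d :=
  \big[mulmx/1%:M]_(nu <- spectrum | nu != mu) ((mu - nu)^-1 *: (h - nu%:M)).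

(* The n-tuples of eigenvalues of h; the component (v)_mu with
   h_i v_mu = mu_i v_mu is [weight_proj mu *m v]. *)
Definition weight (n : nat) : finType := {ffun 'I_n -> seq_sub spectrum}.

Definition weight_proj (n : nat) (mu : weight n) : tend n :=
  tensor_op (fun i => eigenproj (val (mu i))).

(* S(xi + \sum_i alpha_i h_i) *)
Definition dyn_shift (n : nat) (S : C -> tend n) (alpha : 'I_n -> C)
    (xi : C) : tend n :=
  \sum_(mu : weight n)
    S (xi + \sum_i alpha i * val (mu i)) *m weight_proj mu.

(* T_(alpha h_i) *)
Definition shift_op (n : nat) (alpha : C) (i : 'I_n) (f : C -> tvec n) :
    C -> tvec n :=
  fun xi => \sum_(mu : weight n)
    weight_proj mu *m f (xi + alpha * val (mu i)).

Definition mult_op (n : nat) (S : C -> tend n) (f : C -> tvec n) :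
    C -> tvec n :=
  fun xi => S xi *m f xi.

Definition op_family (n : nat) : Type :=
  'rV[C]_n -> (C -> tvec n) -> (C -> tvec n).

(* M(z) = \sum_j A_j(z, xi) T_(beta_j) with (T_beta f)(xi) = f(xi + beta), a
   finite sum with coefficients A_j meromorphic in (z, xi) *)
Definition meromorphic_difference_op (n : nat) (M : op_family n) : Prop :=
  exists (m : nat) (beta : 'I_m -> C) (A : 'I_m -> 'rV[C]_n -> C -> tend n),
    (forall j, meromorphic_mx (fun p : 'rV[C^o]_n * C^o => A j p.1 p.2)) /\
    (forall z f xi, M z f xi = \sum_(j < m) A j z xi *m f (xi + beta j)).

(* equality of operators on V^{⊗n}-valued meromorphic functions of xi,
   depending meromorphically on z *)
Definition op_family_eq (n : nat) (M M' : op_family n) : Prop :=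
  forall f : C -> tvec n, meromorphic_mx (f : C^o -> tvec n) ->
    generically (fun p : 'rV[C^o]_n * C^o => M p.1 f p.2 = M' p.1 f p.2).

End Tensor.

Section Dynamical.
Variables (RR : realType) (d : nat).
Notation C := RR[i].
Notation tend := (tend RR d).
Variables (kappa : C) (h : 'M[C]_d).
Variables (R : C -> C -> tend 2) (K Kl : C -> C -> 'M[C]_d).

Definition Delta_h : tend 2 := leg1 h (0 : 'I_2) + leg1 h (1 : 'I_2).

Definition ice_rule : Prop :=
  generically (fun p : C^o * C^o =>
    R p.1 p.2 *m Delta_h = Delta_h *m R p.1 p.2).

Definition single_shift (n : nat) (c : C) (i : 'I_n) : 'I_n -> C :=
  fun k => if k == i then c else 0.

Definition dynamical_R_matrix : Prop :=
  generically (fun p : C^o * C^o * C^o * C^o =>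
    let z1 := p.1.1.1 in let z2 := p.1.1.2 in let z3 := p.1.2 in
    let xi := p.2 in
    let R_ (i j : 'I_3) z : C -> tend 3 := fun eta => leg2 (R z eta) i j in
    let sh (k : 'I_3) := single_shift (- (2 * kappa)) k in
    dyn_shift h (R_ 0 1 (z1 - z2)) (sh 2) xi *m R_ 0 2 (z1 - z3) xi
      *m dyn_shift h (R_ 1 2 (z2 - z3)) (sh 0) xi
    = R_ 1 2 (z2 - z3) xi *m dyn_shift h (R_ 0 2 (z1 - z3)) (sh 1) xi
      *m R_ 0 1 (z1 - z2) xi).

Definition unitary_R : Prop :=
  generically (fun p : C^o * C^o =>
    op21 (R p.1 p.2) *m R (- p.1) p.2 = 1%:M).

Definition unitary_K (K' : C -> C -> 'M[C]_d) : Prop :=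
  generically (fun p : C^o * C^o => K' p.1 p.2 *m K' (- p.1) p.2 = 1%:M).

Definition right_dynamical_K_matrix : Prop :=
  generically (fun p : C^o * C^o * C^o =>
    let z1 := p.1.1 in let z2 := p.1.2 in let xi := p.2 in
    let K1 := dyn_shift h (fun eta => leg1 (K z1 eta) (0 : 'I_2))
                (single_shift (- kappa) 1) xi in
    let K2 := dyn_shift h (fun eta => leg1 (K z2 eta) (1 : 'I_2))
                (single_shift (- kappa) 0) xi in
    let R12 z := R z (2 * xi) in
    let R21 z := op21 (R z (2 * xi)) in
    R21 (z1 - z2) *m K1 *m R12 (z1 + z2) *m K2
    = K2 *m R21 (z1 + z2) *m K1 *m R12 (z1 - z2)).

Definition left_dynamical_K_matrix : Prop :=
  generically (fun p : C^o * C^o * C^o =>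
    let z1 := p.1.1 in let z2 := p.1.2 in let xi := p.2 in
    let K1 := dyn_shift h (fun eta => leg1 (Kl z1 eta) (0 : 'I_2))
                (single_shift kappa 1) xi in
    let K2 := dyn_shift h (fun eta => leg1 (Kl z2 eta) (1 : 'I_2))
                (single_shift kappa 0) xi in
    let R12 z := dyn_shift h (R z) (fun=> 2 * kappa) (2 * xi) in
    let R21 z := dyn_shift h (fun eta => op21 (R z eta)) (fun=> 2 * kappa)
                   (2 * xi) in
    R12 (z1 - z2) *m K1 *m R21 (z1 + z2) *m K2
    = K2 *m R12 (z1 + z2) *m K1 *m R21 (z1 - z2)).

(* c (h_0 + ... + h_(i-1)) *)
Definition initial_shift (n : nat) (c : C) (i : 'I_n) : 'I_n -> C :=
  fun k => if (k < i)%N then c else 0.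

Section Cocycle.
Variable n : nat.

(* M^{s_0}, when i = 0 *)
Definition op_affine (i : 'I_n) : op_family RR d n := fun z f =>
  shift_op h (- kappa) i
    (mult_op (fun xi => leg1 (Kl (2^-1 - z 0 i) xi) i)
      (shift_op h kappa i f)).

(* M^{s_(i+1)}, when j = i + 1 *)
Definition op_swap (i j : 'I_n) : op_family RR d n := fun z =>
  mult_op (fun xi => leg2 (flip RR d) i j *m
    dyn_shift h (fun eta => leg2 (R (z 0 i - z 0 j) eta) i j)
      (initial_shift (- (2 * kappa)) i) (2 * xi)).

(* M^{s_n}, when i = n - 1 *)
Definition op_sign (i : 'I_n) : op_family RR d n := fun z =>
  mult_op (fun xi =>
    dyn_shift h (fun eta => leg1 (K (z 0 i) eta) i)
      (initial_shift (- kappa) i) xi).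

Definition initial_values (M : affW n -> op_family RR d n) : Prop :=
  [/\ forall i : 'I_n, i = 0%N :> nat ->
        op_family_eq (M (affine_reflection i)) (op_affine i),
      forall i j : 'I_n, j = i.+1 :> nat ->
        op_family_eq (M (swap_reflection i j)) (op_swap i j) &
      forall i : 'I_n, i.+1 = n ->
        op_family_eq (M (sign_reflection i)) (op_sign i)].

Definition cocycle (M : affW n -> op_family RR d n) : Prop :=
  op_family_eq (M 1%g) (fun=> id) /\
  forall u v : affW n,
    op_family_eq (M (u * v)%g)
      (fun z f => M u z (M v (affW_act u^-1%g z) f)).

Definition cocycle_extension (M : affW n -> op_family RR d n) : Prop :=
  [/\ forall v, meromorphic_difference_op (M v), initial_values M & cocycle M].

End Cocycle.
End Dynamical.

(* Main.v *)
Require Import Defs.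
From mathcomp Require Import all_boot all_order all_fingroup all_algebra.
From mathcomp Require Import zify ring lra.
From mathcomp Require Import complex.
From mathcomp Require Import boolp classical_sets reals topology normedtype.
From mathcomp Require Import derive.
Set Implicit Arguments.
Unset Strict Implicit.
Unset Printing Implicit Defensive.
Import Order.TTheory GRing.Theory Num.Theory numFieldNormedType.Exports.
Local Open Scope ring_scope.
Local Open Scope complex_scope.

(** The prescribed operators combine with the action of W on z to a candidate for
    an action of W on functions F(z, xi): an element v should send F to the
    function with values (M^v(z) F(v^-1 z, .))(xi). The cocycle conditions say
    exactly that this is an action. Hence a cocycle is determined by its values at
    the simple reflections, and it exists if and only if the operators g_k given by
    the initial values satisfy the Coxeter relations of W.

    The Coxeter presentation of W is proved in the form [word_act_wordW]. The group
    acts freely on the orbit of a point x0 of the fundamental alcove. A generator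
    whose wall separates v x0 from x0 is a descent of v, and reflecting in its wall
    decreases the distance to x0. If v has two descents, the whole alternating word
    of their dihedral group can be split off, and the Coxeter relation identifies
    its two forms; by induction on the distance, all ways of folding v x0 back to x0
    give the same operator.

    Meromorphic functions are represented by total functions, which matter only on
    dense open sets, so the operators act on the quotient [genfun] of all functions
    by generic equality. Generic identities can be transported back and forth along
    submersive maps ([generically_submersive]); this relates identities in the
    variables z, xi of the cocycle to those in the few variables of the Yang-Baxter
    and reflection equations. An equality of difference operators, which is tested
    on meromorphic functions of xi alone, holds for all functions of (z, xi), by
    polynomial interpolation ([op_family_eqP]).

    The dynamical shifts are conjugations: if a multiplication operator S commutes
    with the combination c.h of the h_i, and T_c is the shift of xi by c.h, then
    T_c S T_c^-1 is multiplication by S(xi + c.h) ([shiftQ_mulQ]). So each g_k is a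
    conjugate, by a product of T's, of P R or of a K-matrix without shifts, followed
    by a reflection of z. In the Coxeter relations most of the T's cancel. The
    relations between distant generators hold by the ice rule ([far_commute]), and
    the others are equivalent, one by one, to the required equations once the flips
    are moved to one side: the quadratic relations to unitarity ([swap_unitary],
    [sign_unitary], [affine_unitary]), the braid relations of length three to the
    dynamical Yang-Baxter equation ([braid_dynamical_R]), and the two relations of
    length four to the reflection equations ([right_dynamical_K],
    [left_dynamical_K]). *)

(** * The simple reflections *)

Section Reflections.
Variable n : nat.
Implicit Types i j k : 'I_n.

Lemma affine_reflectionK i : (affine_reflection i * affine_reflection i = 1)%g.
Proof.
apply: affW_ext => [|k|k] /=; rewrite ?mul1g // !ffunE ?perm1 ?addbb //.
by case: eqP => _ /=; rewrite ?mul0r ?mul1r.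
Qed.

Lemma swap_reflectionK i j : (swap_reflection i j * swap_reflection i j = 1)%g.
Proof. by apply: affW_ext => [|k|k] /=; rewrite ?tperm2 // !ffunE. Qed.

Lemma sign_reflectionK i : (sign_reflection i * sign_reflection i = 1)%g.
Proof.
apply: affW_ext => [|k|k] /=; rewrite ?mul1g // !ffunE ?perm1 ?addbb //.
by rewrite mulr0.
Qed.

Lemma involution_invg (w : affW n) : (w * w = 1)%g -> (w^-1 = w)%g.
Proof. by move=> ww; rewrite -[RHS]mul1g -(mulVg w) -mulgA ww mulg1. Qed.

Lemma affine_actV (F : pzRingType) i (z : 'rV[F]_n) k :
  affW_act (affine_reflection i)^-1%g z 0 k = if k == i then 1 - z 0 i else z 0 k.
Proof. by rewrite involution_invg ?affine_reflectionK // affine_reflectionE. Qed.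

Lemma swap_actV (F : pzRingType) i j (z : 'rV[F]_n) k :
  affW_act (swap_reflection i j)^-1%g z 0 k = z 0 (tperm i j k).
Proof. by rewrite involution_invg ?swap_reflectionK // swap_reflectionE. Qed.

Lemma sign_actV (F : pzRingType) i (z : 'rV[F]_n) k :
  affW_act (sign_reflection i)^-1%g z 0 k = if k == i then - z 0 i else z 0 k.
Proof. by rewrite involution_invg ?sign_reflectionK // sign_reflectionE. Qed.

End Reflections.

(** * A Coxeter presentation of the affine Weyl group *)

Section Coxeter.
Variable m : nat.
Notation n := m.+2.

(** The simple reflection s_k; values k > n are sent to s_n, so that words are
    plain sequences of numbers. *)
Definition gen (k : nat) : affW n :=
  if k == 0%N then affine_reflection ord0
  else if (k < n)%N then swap_reflection (inord k.-1) (inord k)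
  else sign_reflection ord_max.

Definition wordW (w : seq nat) : affW n := foldr (fun k v => gen k * v)%g 1%g w.

(** Coordinates of v x0, scaled by 2 (n + 1) to be integral, for the point
    x0 = (n, n - 1, ..., 1) / (2 (n + 1)) of the fundamental alcove
    1/2 > z_0 > ... > z_(n-1) > 0. The orbit of x0 is free and avoids all walls,
    so v can be read off from this point. *)
Definition alcove_pt (v : affW n) (i : nat) : int :=
  (-1) ^+ affW_sign v (inord i) * (n%:Z - (affW_perm v (inord i))%:Z)
  + (2 * n.+1)%:Z * affW_trans v (inord i).

Lemma alcove_pt_affine v i : (i < n)%N -> alcove_pt (gen 0 * v)%g i =
  if i == 0%N then (2 * n.+1)%:Z - alcove_pt v 0 else alcove_pt v i.
Proof.
move=> lin; have E : (inord i == ord0 :> 'I_n) = (i == 0%N).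
  by rewrite -val_eqE /= inordK.
rewrite /alcove_pt /gen /= !ffunE perm1 mul1g E.
case: eqP => [->|_] /=; last by rewrite mul1r addr0.
rewrite signrN mulN1r; ring.
Qed.

Lemma alcove_pt_sign v i : (i < n)%N -> alcove_pt (gen n * v)%g i =
  if i == m.+1 then - alcove_pt v i else alcove_pt v i.
Proof.
move=> lin; have E : (inord i == ord_max :> 'I_n) = (i == m.+1).
  by rewrite -val_eqE /= inordK.
rewrite /alcove_pt /gen /= ltnn !ffunE perm1 mul1g E.
case: eqP => [_|_] /=; last by rewrite mul1r addr0.
rewrite signrN mulN1r; ring.
Qed.

Lemma alcove_pt_swap v k i : (0 < k < n)%N -> (i < n)%N ->
  alcove_pt (gen k * v)%g i =
  if i == k.-1 then alcove_pt v k
  else if i == k then alcove_pt v k.-1 else alcove_pt v i.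
Proof.
case: k => // k /= lk lin.
rewrite /alcove_pt /gen /= lk /= !ffunE permM mul1r addr0 /=.
have E j : (j < n)%N -> (inord i == inord j :> 'I_n) = (i == j).
  by move=> lj; rewrite -val_eqE /= !inordK.
case: eqP => [->|/eqP nk]; first by rewrite tpermL.
case: eqP => [->|/eqP nk1]; first by rewrite tpermR.
by rewrite tpermD // eq_sym E //; lia.
Qed.

Lemma gen_mulK k v : (k <= n)%N -> (gen k * (gen k * v) = v)%g.
Proof.
move=> lk; rewrite mulgA.
suff -> : (gen k * gen k = 1)%g by rewrite mul1g.
rewrite /gen; case: eqP => _; first exact: affine_reflectionK.
by case: ltnP => _; [exact: swap_reflectionK | exact: sign_reflectionK].
Qed.

(** The k-th simple affine root, positive on the fundamental alcove, evaluated at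
    v x0. *)
Definition simple_root (v : affW n) (k : nat) : int :=
  if k == 0%N then n.+1%:Z - alcove_pt v 0
  else if (k < n)%N then alcove_pt v k.-1 - alcove_pt v k
  else alcove_pt v m.+1.

Definition adjacent (j k : nat) := (j == k.+1) || (k == j.+1).

Ltac node_cases k :=
  destruct k as [|k]; [|have [?|?] := ltnP k.+1 n;
    [|(have ? : k = m.+1 by lia); subst k]].

Lemma alcove_ptE v k i : (k <= n)%N -> (i < n)%N -> alcove_pt (gen k * v)%g i =
  if k == 0%N then (if i == 0%N then (2 * n.+1)%:Z - alcove_pt v 0 else alcove_pt v i)
  else if (k < n)%N then (if i == k.-1 then alcove_pt v k
  else if i == k then alcove_pt v k.-1 else alcove_pt v i)
  else if i == m.+1 then - alcove_pt v m.+1 else alcove_pt v i.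
Proof.
move=> lk li; case: eqP => [->|k0]; first exact: alcove_pt_affine.
case: ltnP => kn; first by apply: alcove_pt_swap => //; lia.
have -> : k = n by lia.
by rewrite alcove_pt_sign //; case: eqP => // ->.
Qed.

Definition cartan (j k : nat) : int :=
  if j == k then 2%Z else if adjacent j k then
    - (if (k == 0%N) || (k == n) then 2%Z else 1) else 0.

(** All relations between the simple reflections are consequences of this rule:
    an element is determined by its root values, see [root_inj]. *)
Lemma root_gen v j k : (j <= n)%N -> (k <= n)%N ->
  simple_root (gen k * v)%g j = simple_root v j - cartan j k * simple_root v k.
Proof.
move=> lj lk; rewrite /simple_root /cartan /adjacent.
node_cases j; node_cases k; rewrite ?eqxx ?alcove_ptE //=; try lia.
all: repeat (first [case: eqP => ? //= | case: ltnP => ? //=]; subst; try lia).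
- have ? : j = m by lia.
  by subst j; lia.
- have ? : k = m by lia.
  by subst k; lia.
Qed.

(** A scaled coordinate is a residue of absolute value between 1 and n plus a
    multiple of 2 (n + 1); the residue carries the permutation and the sign. *)
Lemma alcove_ptP v i : (i < n)%N -> exists a t : int,
  [/\ alcove_pt v i = a + (2 * n.+1)%:Z * t, `|a| = n%:Z - (affW_perm v (inord i))%:Z,
      t = affW_trans v (inord i) & (0 < a -> affW_sign v (inord i) = false)].
Proof.
move=> lin; have lp := ltn_ord (affW_perm v (inord i)).
exists ((-1) ^+ affW_sign v (inord i) * (n%:Z - (affW_perm v (inord i))%:Z)).
exists (affW_trans v (inord i)); split=> //.
  by rewrite normrM normr_sign mul1r ger0_norm //; lia.
by case: (affW_sign _ _) => //; rewrite expr1 mulN1r; lia.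
Qed.

Lemma multiple_small (q a N : int) : `|a| < N -> a = N * q -> q = 0.
Proof.
move=> aN aE; have [q0|q0|//] := ltrgt0P q.
  have : N * 1 <= N * q by apply: ler_wpM2l; lia.
  lia.
have : N * 1 <= N * - q by apply: ler_wpM2l; lia.
lia.
Qed.

(** No point of the orbit lies on a wall, because two scaled coordinates are
    never congruent up to sign modulo 2 (n + 1), and none is congruent to 0 or to
    n + 1. *)
Lemma root_neq0 v k : (k <= n)%N -> simple_root v k <> 0.
Proof.
move=> lk; rewrite /simple_root; node_cases k; rewrite ?ltnn /=.
- have [a [t [-> aE _ _]]] := @alcove_ptP v 0 isT.
  have lp := ltn_ord (affW_perm v (inord 0)).
  move=> E; have := @multiple_small (1 - 2 * t) a n.+1%:Z; lia.
- have lk1 : (k.+1 < n)%N by [].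
  have [a [t [-> aE _ _]]] := @alcove_ptP v k lk.
  have [b [u [-> bE _ _]]] := @alcove_ptP v k.+1 lk1.
  have la := ltn_ord (affW_perm v (inord k)).
  have lb := ltn_ord (affW_perm v (inord k.+1)).
  move=> E; have q0 : u - t = 0.
    by apply: (@multiple_small _ (a - b) (2 * n.+1)%:Z); lia.
  have ab : a = b by lia.
  have : affW_perm v (inord k) = affW_perm v (inord k.+1).
    by apply: val_inj => /=; lia.
  move/perm_inj/(congr1 (@nat_of_ord _)); rewrite !inordK; lia.
- have [a [t [-> aE _ _]]] := @alcove_ptP v m.+1 (ltnSn _).
  have lp := ltn_ord (affW_perm v (inord m.+1)).
  move=> E; have := @multiple_small (- t) a (2 * n.+1)%:Z; lia.
Qed.

(** A dominant point has scaled coordinates n >= Y_0 > ... > Y_(n-1) >= 1, which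
    leaves no choice but Y_i = n - i. *)
Lemma dominant_eq1 v : (forall k, (k <= n)%N -> 0 <= simple_root v k) -> v = 1%g.
Proof.
move=> dom.
have pos k : (k <= n)%N -> 0 < simple_root v k.
  by move=> lk; have := dom k lk; have := @root_neq0 v k lk; lia.
have up i : (i < n)%N -> alcove_pt v i <= n%:Z - i%:Z.
  elim: i => [|i IH] li; first by have := pos 0%N isT; rewrite /simple_root /=; lia.
  have := pos i.+1 (ltnW li); rewrite /simple_root /= li; have := IH (ltnW li); lia.
have lo j : (j < n)%N -> j.+1%:Z <= alcove_pt v (m.+1 - j).
  elim: j => [|j IH] lj.
    by have := pos n (leqnn _); rewrite /simple_root /= ltnn subn0; lia.
  have := pos (m.+1 - j)%N; rewrite /simple_root.
  rewrite ifF; last lia.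
  rewrite ifT; last lia.
  have -> : (m.+1 - j).-1 = (m.+1 - j.+1)%N by lia.
  have := IH (ltnW lj); lia.
have yE i : (i < n)%N -> alcove_pt v i = n%:Z - i%:Z.
  move=> li; have := up i li; have := lo (m.+1 - i)%N.
  have -> : (m.+1 - (m.+1 - i))%N = i by lia.
  lia.
have main i : [/\ affW_perm v i = i, affW_sign v i = false & affW_trans v i = 0].
  have [a [t [E aE tE sE]]] := @alcove_ptP v i (ltn_ord i).
  rewrite inord_val in aE tE sE; rewrite yE // in E.
  have lp := ltn_ord (affW_perm v i); have li := ltn_ord i.
  have t0 : - t = 0.
    by apply: (@multiple_small _ (a - (n%:Z - i%:Z)) (2 * n.+1)%:Z); lia.
  split; [apply: val_inj => /=; lia | apply: sE; lia | lia].
apply: affW_ext => [|i|i] /=; rewrite ?ffunE;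
  [| by have [] := main i | by have [] := main i].
by apply/permP => i; rewrite perm1; have [] := main i.
Qed.

Definition dist2 v : int := \sum_(i < n) (alcove_pt v i - (n%:Z - i%:Z)) ^+ 2.

Lemma dist2_ge0 v : 0 <= dist2 v.
Proof. by apply: sumr_ge0 => i _; rewrite sqr_ge0. Qed.

(** Reflecting in a wall that separates v x0 from x0 brings it closer to x0. *)
Lemma dist2_descent v k : (k <= n)%N -> simple_root v k < 0 ->
  dist2 (gen k * v)%g < dist2 v.
Proof.
move=> lk; rewrite /simple_root /dist2; node_cases k; rewrite ?ltnn /=.
- move=> neg; rewrite [X in X < _]big_ord_recl [X in _ < X]big_ord_recl.
  rewrite ltr_leD //.
    rewrite alcove_ptE //=; nia.
  apply: ler_sum => i _.
  by rewrite alcove_ptE //= /bump /=; have := ltn_ord i; lia.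
- move=> neg; have lk1 : (k.+1 < n)%N by [].
  pose i : 'I_n := Ordinal lk; pose j : 'I_n := Ordinal lk1.
  have ji : j != i by rewrite -val_eqE /=; lia.
  rewrite [X in X < _](bigD1 i) // [X in _ + X < _](bigD1 j) //=.
  rewrite [X in _ < X](bigD1 i) // [X in _ < _ + X](bigD1 j) //=.
  rewrite !addrA ltr_leD //.
    rewrite !alcove_ptE //= lk1 eqxx ifF ?eqxx; last lia.
    nia.
  apply: ler_sum => l /andP[li lj]; have ll := ltn_ord l.
  rewrite alcove_ptE //= lk1.
  have -> : (l == k :> nat) = false by apply: negbTE; rewrite -val_eqE /= in li.
  by have -> : (l == k.+1 :> nat) = false
    by apply: negbTE; rewrite -val_eqE /= in lj.
- move=> neg; rewrite [X in X < _]big_ord_recr [X in _ < X]big_ord_recr /=.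
  rewrite ler_ltD //; last first.
    rewrite alcove_ptE //= ?ltnn ?eqxx. nia.
  apply: ler_sum => i _.
  have li := ltn_ord i.
  rewrite alcove_ptE /= ?ltnn ?ifF //; lia.
Qed.

Definition letters (w : seq nat) := all (fun k => k <= n)%N w.

(** Words that fold v x0 back to x0, each letter being a reflection in a wall that
    separates the current point from x0; they play the role of reduced words. *)
Fixpoint descending (v : affW n) (w : seq nat) : Prop :=
  if w is k :: w' then
    [/\ (k <= n)%N, simple_root v k < 0 & descending (gen k * v)%g w']
  else v = 1%g.

Lemma dist2_ind (P : affW n -> Prop) :
  (forall v, (forall k, (k <= n)%N -> simple_root v k < 0 -> P (gen k * v)%g) -> P v) ->
  forall v, P v.
Proof.
move=> IH v; have [N] := ubnP `|dist2 v|%N; elim: N v => // N IHN v lN.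
apply: IH => k lk neg; apply: IHN.
have := dist2_descent lk neg; have := dist2_ge0 v.
have := dist2_ge0 (gen k * v)%g; lia.
Qed.

Lemma descending_exists v : exists w, descending v w.
Proof.
elim/dist2_ind: v => v IH.
have [[k [lk neg]]|no] := pselect (exists k, (k <= n)%N /\ simple_root v k < 0).
  by have [w dw] := IH k lk neg; exists (k :: w).
exists [::]; apply: dominant_eq1 => k lk.
by case: leP => // neg; case: no; exists k.
Qed.

Lemma descending_wordW v w : descending v w -> letters w /\ wordW w = v.
Proof.
elim: w v => [|k w IH] v /=; first by move=> ->.
by case=> lk _ /IH[lw ->]; rewrite lk gen_mulK.
Qed.

(** Folding v x0 back into the fundamental alcove writes v as a product of simple
    reflections. *)
Lemma generation v : exists2 w, letters w & wordW w = v.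
Proof.
by have [w /descending_wordW[lw wE]] := descending_exists v; exists w.
Qed.

Lemma root1_ge0 k : (k <= n)%N -> 0 <= simple_root 1%g k.
Proof.
move=> lk.
have y1 i : (i < n)%N -> alcove_pt 1%g i = n%:Z - i%:Z.
  move=> li; rewrite /alcove_pt /= !ffunE perm1 inordK // mul1r; lia.
rewrite /simple_root; node_cases k; rewrite ?ltnn ?y1 //=; try lia.
Qed.

(** A descending word of u is also one of v, as descents only depend on the root
    values. *)
Lemma root_inj u v : (forall k, (k <= n)%N -> simple_root u k = simple_root v k) -> u = v.
Proof.
have [w dw] := descending_exists u; elim: w u v dw => [|k w IH] u v /=.
  move=> -> E; apply/esym/dominant_eq1 => k lk.
  by rewrite -E // root1_ge0.
case=> lk _ dw E; rewrite -[u](gen_mulK _ lk) -[v](gen_mulK _ lk).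
congr (_ * _)%g; apply: IH => // j lj.
by rewrite !root_gen // !E.
Qed.

Lemma cartan_far j k : j != k -> ~~ adjacent j k -> cartan j k = 0.
Proof. by rewrite /cartan => /negPf -> /negPf ->. Qed.

Lemma cartanE k : cartan k k = 2%Z.
Proof. by rewrite /cartan eqxx. Qed.

Lemma cartan_inner j k : adjacent j k -> (0 < k < n)%N -> cartan j k = -1.
Proof.
by rewrite /cartan => jk kn; rewrite jk ifF ?ifF //; move: jk; rewrite /adjacent; lia.
Qed.

Lemma cartan_end j k : adjacent j k -> (k == 0%N) || (k == n) ->
  cartan j k = - 2%Z.
Proof.
by rewrite /cartan => jk ->; rewrite jk ifF //; move: jk; rewrite /adjacent; lia.
Qed.

Lemma adjacentC j k : adjacent j k = adjacent k j.
Proof. by rewrite /adjacent orbC. Qed.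

Lemma gen_far j k v : (j <= n)%N -> (k <= n)%N -> j != k -> ~~ adjacent j k ->
  (gen j * (gen k * v) = gen k * (gen j * v))%g.
Proof.
move=> lj lk jk njk; apply: root_inj => i li; rewrite !root_gen //.
rewrite (@cartan_far j k) // (@cartan_far k j) ?[k == j]eq_sym 1?adjacentC //.
ring.
Qed.

Lemma gen_braid3 k v : (0 < k)%N -> (k.+1 < n)%N ->
  (gen k * (gen k.+1 * (gen k * v)) = gen k.+1 * (gen k * (gen k.+1 * v)))%g.
Proof.
move=> k0 kn; have kn' := ltnW kn; have kn'' := ltnW kn'.
apply: root_inj => i li; rewrite !root_gen // !cartanE.
rewrite (@cartan_inner k.+1 k) ?(@cartan_inner k k.+1) ?/adjacent ?eqxx ?orbT //; try lia.

Qed.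

Lemma gen_braid4l v :
  (gen 0 * (gen 1 * (gen 0 * (gen 1 * v))) =
   gen 1 * (gen 0 * (gen 1 * (gen 0 * v))))%g.
Proof.
apply: root_inj => i li; rewrite !root_gen // !cartanE.
rewrite (@cartan_end 1 0) // (@cartan_inner 0 1) //; ring.
Qed.

Lemma gen_braid4r v :
  (gen m.+1 * (gen n * (gen m.+1 * (gen n * v))) =
   gen n * (gen m.+1 * (gen n * (gen m.+1 * v))))%g.
Proof.
apply: root_inj => i li; rewrite !root_gen ?leqnn ?leqnSn // !cartanE.
have -> : cartan n m.+1 = -1.
  by rewrite cartan_inner ?/adjacent ?eqxx ?orbT //; lia.
have -> : cartan m.+1 n = - 2%Z.
  by rewrite cartan_end ?/adjacent ?eqxx ?orbT //; lia.
ring.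
Qed.

Section Words.
Variables (T : Type) (g : nat -> T -> T).

Definition word_act (w : seq nat) (x : T) : T := foldr g x w.

Hypothesis gK : forall k x, (k <= n)%N -> g k (g k x) = x.
Hypothesis g_far : forall j k x, (j <= n)%N -> (k <= n)%N -> j != k ->
  ~~ adjacent j k -> g j (g k x) = g k (g j x).
Hypothesis g_braid3 : forall k x, (0 < k)%N -> (k.+1 < n)%N ->
  g k (g k.+1 (g k x)) = g k.+1 (g k (g k.+1 x)).
Hypothesis g_braid4l : forall x,
  g 0 (g 1 (g 0 (g 1 x))) = g 1 (g 0 (g 1 (g 0 x))).
Hypothesis g_braid4r : forall x,
  g m.+1 (g n (g m.+1 (g n x))) = g n (g m.+1 (g n (g m.+1 x))).

(** If v has the two descents j and k, then by the Cartan matrix every letter of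
    the alternating words in j and k is again a descent. So v has
    descending words that start with these two alternating words and agree
    afterwards; they act in the same way by the relation between j and k, and the
    induction hypothesis compares them with the given words. *)
Lemma word_act_unique v : forall w w', descending v w -> descending v w' ->
  word_act w =1 word_act w'.
Proof.
elim/dist2_ind: v => v IH [|j w] [|k w'] //=.
- by move=> -> [lk + _]; have := root1_ge0 lk; lia.
- by move=> [lk + _] v1; rewrite v1; have := root1_ge0 lk; lia.
wlog : j k w w' / (j <= k)%N.
  move=> W dw dw' x; have [jk|/ltnW kj] := leqP j k; first exact: W.
  by apply/esym/W.
rewrite leq_eqVlt => /orP[/eqP <-|jk] [lj nj dw] [lk nk dw'] x.
  by congr (g j _); apply: (IH j).
(* It suffices to exhibit two descending words of v, starting with j and with k,
   that are exchanged by a Coxeter relation. *)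
suff [p [q [dp dq pq]]] : exists p q,
    [/\ descending v (j :: p), descending v (k :: q) &
        forall y, g j (word_act p y) = g k (word_act q y)].
  case: dp => _ _ dp; case: dq => _ _ dq.
  by rewrite /= -/(word_act w x) -/(word_act w' x) (IH j lj nj _ _ dw dp) pq (IH k lk nk _ _ dw' dq).
have rg a b u := @root_gen u a b.
have [adj|far] := boolP (k == j.+1); last first.
  have njk : ~~ adjacent j k by rewrite /adjacent; lia.
  have nkj : ~~ adjacent k j by rewrite adjacentC.
  have [u du] := descending_exists (gen k * (gen j * v))%g.
  exists (k :: u), (j :: u); split=> /=.
  - by split=> //; split=> //; rewrite rg // cartan_far //; lia.
  - split=> //; split=> //; first by rewrite rg // cartan_far //; lia.
    by rewrite gen_far //; lia.
  - by move=> y; rewrite g_far //; lia.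
have {adj} kE : k = j.+1 by apply/eqP.
subst k; have [j0|j0] := posnP j; last have [lt_jn|ge_jn] := ltnP j.+1 n.
- subst j; have [u du] := descending_exists
    (gen 0 * (gen 1 * (gen 0 * (gen 1 * v))))%g.
  exists [:: 1, 0, 1 & u]%N, [:: 0, 1, 0 & u]%N; split=> /=.
  + do !split=> //; rewrite ?rg // ?cartanE ?(@cartan_end 1 0) ?(@cartan_inner 0 1) //=; try lia.
    by rewrite -gen_braid4l.
  + do !split=> //; rewrite ?rg // ?cartanE ?(@cartan_end 1 0) ?(@cartan_inner 0 1) //=; lia.
  + by move=> y; rewrite g_braid4l.
- have [u du] := descending_exists (gen j * (gen j.+1 * (gen j * v)))%g.
  have c1 : cartan j j.+1 = -1.
    by rewrite cartan_inner ?/adjacent ?eqxx ?orbT //; lia.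
  have c2 : cartan j.+1 j = -1.
    by rewrite cartan_inner ?/adjacent ?eqxx ?orbT //; lia.
  exists [:: j.+1, j & u]%N, [:: j, j.+1 & u]%N; split=> /=.
  + do !split=> //; rewrite ?rg // ?cartanE ?c1 ?c2; lia.
  + do !split=> //; rewrite ?rg // ?cartanE ?c1 ?c2 -?gen_braid3 //; lia.
  + by move=> y; rewrite g_braid3.
- have ? : j = m.+1 by lia.
  subst j; have [u du] := descending_exists
    (gen m.+1 * (gen n * (gen m.+1 * (gen n * v))))%g.
  have c1 : cartan n m.+1 = -1.
    by rewrite cartan_inner ?/adjacent ?eqxx ?orbT //; lia.
  have c2 : cartan m.+1 n = - 2%Z.
    by rewrite cartan_end ?/adjacent ?eqxx ?orbT //; lia.
  exists [:: n, m.+1, n & u]%N, [:: m.+1, n, m.+1 & u]%N; split=> /=.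
  + do !split=> //; rewrite ?rg // ?cartanE ?c1 ?c2; try lia.
    by rewrite -gen_braid4r.
  + do !split=> //; rewrite ?rg // ?cartanE ?c1 ?c2; lia.
  + by move=> y; rewrite g_braid4r.
Qed.

(** Multiplying by a generator that is not a descent lengthens a descending word;
    multiplying by a descent is undone by a descending word starting with it. *)
Lemma descending_reduce v w k : (k <= n)%N -> descending v w ->
  exists2 w', descending (gen k * v)%g w' & word_act w' =1 word_act (k :: w).
Proof.
move=> lk dw; have := @root_neq0 v k lk; have [neg _|pos _|-> //] := ltgtP (simple_root v k) 0.
- have [u du] := descending_exists (gen k * v)%g; exists u => // x /=.
  by rewrite (@word_act_unique v w (k :: u)) //= gK.
- exists (k :: w) => //=; split=> //; last by rewrite gen_mulK.
  by rewrite root_gen // cartanE; lia.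
Qed.

(** Operators that satisfy the Coxeter relations define an action of W: this is
    the presentation of W, in the form in which it is used. *)
Theorem word_act_wordW w w' : letters w -> letters w' -> wordW w = wordW w' ->
  word_act w =1 word_act w'.
Proof.
have red u : letters u ->
    exists2 u', descending (wordW u) u' & word_act u' =1 word_act u.
  elim: u => [|k u IH] /=; first by exists [::].
  case/andP=> lk /IH[u' du' uE].
  have [r dr rE] := descending_reduce lk du'.
  by exists r => // x; rewrite rE /= -/(word_act _ _) uE.
move=> /red[u du uE] /red[u' du' uE'] E x.
by rewrite -uE -uE'; apply: (word_act_unique du); rewrite E.
Qed.

End Words.
End Coxeter.

(** * Projections onto the eigenspaces of h *)

Section Eigenprojections.
Variables (RR : realType) (d : nat) (h : 'M[RR[i]]_d).
Hypothesis hss : diagonalizable h.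
Notation C := RR[i].

Lemma root_spectrum (x : C) : (x \in spectrum h) = root (char_poly h) x.
Proof.
rewrite /spectrum mem_undup; case: closed_field_poly_normal => r /= rE.
rewrite [in RHS]rE rootZ ?lead_coef_eq0 ?monic_neq0 ?char_poly_monic //.
by rewrite root_prod_XsubC.
Qed.

(** In an eigenbasis the Lagrange polynomial at mu becomes the indicator of mu. *)
Lemma eigenproj_diag : exists (P : 'M[C]_d) (D : 'rV[C]_d),
  [/\ P \in unitmx, h = invmx P *m diag_mx D *m P,
      forall i, D 0 i \in spectrum h &
      forall mu, mu \in spectrum h -> eigenproj h mu =
        invmx P *m diag_mx (\row_i (D 0 i == mu)%:R) *m P].
Proof.
case: hss => P Pu /(diagonalizable_forLR Pu)[D].
rewrite mxpoly.conjVmx // => hE; exists P, D.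
have PV : P *m invmx P = 1%:M by rewrite mulmxV.
have Dspec i : D 0 i \in spectrum h.
  rewrite root_spectrum -eigenvalue_root_char; apply/eigenvalueP.
  exists (row i P).
    rewrite hE !mulmxA -row_mul PV row1 rowE.
    by rewrite -rowE row_diag_mx -scalemxAl -rowE.
  apply: contraTneq Pu => ri0.
  apply/negP => Pu; have : row i (P *m invmx P) = 0 by rewrite row_mul ri0 mul0mx.
  rewrite PV row1 => /rowP/(_ i); rewrite !mxE !eqxx => /eqP.
  by rewrite oner_eq0.
split; [exact: Pu | exact: hE | exact: Dspec | move=> mu muS; rewrite /eigenproj].
have conjM (A B : 'M[C]_d) :
    invmx P *m A *m P *m (invmx P *m B *m P) = invmx P *m (A *m B) *m P.
  by rewrite !mulmxA -[_ *m P *m invmx P]mulmxA PV mulmx1.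
have factor nu : (mu - nu)^-1 *: (h - nu%:M) =
    invmx P *m diag_mx (\row_i ((mu - nu)^-1 * (D 0 i - nu))) *m P.
  have -> : diag_mx (\row_i ((mu - nu)^-1 * (D 0 i - nu))) =
      (mu - nu)^-1 *: (diag_mx D - nu%:M).
    apply/matrixP => i j; rewrite !mxE.
    by case: eqP => [->|_]; rewrite ?mulr1n ?mulr0n ?subrr ?mulr0.
  rewrite -scalemxAr -scalemxAl hE mulmxBr mulmxBl; congr (_ *: (_ - _)).
  by rewrite mul_mx_scalar -scalemxAl mulVmx // scalemx1.
have prodE s : \big[mulmx/1%:M]_(nu <- s | nu != mu)
      ((mu - nu)^-1 *: (h - nu%:M)) =
    invmx P *m diag_mx (\row_i \prod_(nu <- s | nu != mu)
      ((mu - nu)^-1 * (D 0 i - nu))) *m P.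
  elim: s => [|nu s IH].
    rewrite big_nil.
    have -> : diag_mx (\row_i \prod_(nu <- [::] | nu != mu)
        ((mu - nu)^-1 * (D 0 i - nu))) = 1%:M.
      apply/matrixP => i j; rewrite !mxE big_nil //.
    by rewrite mulmx1 mulVmx.
  rewrite big_cons; case: ifP => nm.
    rewrite IH factor conjM mulmx_diag; congr (_ *m diag_mx _ *m _).
    by apply/rowP => i; rewrite !mxE big_cons nm.
  rewrite IH; congr (_ *m diag_mx _ *m _).
  by apply/rowP => i; rewrite !mxE big_cons nm.
rewrite prodE; congr (_ *m diag_mx _ *m _); apply/rowP => i; rewrite !mxE.
case: eqP => [->|/eqP Dmu].
  rewrite big1_seq // => nu /andP[nm _].
  by rewrite mulVf // subr_eq0 eq_sym.
apply/eqP; rewrite prodf_seq_eq0; apply/hasP; exists (D 0 i) => //.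
by rewrite Dmu subrr mulr0 eqxx.
Qed.

Lemma eigenproj_mul (mu nu : C) : mu \in spectrum h -> nu \in spectrum h ->
  eigenproj h mu *m eigenproj h nu = if mu == nu then eigenproj h mu else 0.
Proof.
have [P [D [Pu hE DS prE]]] := eigenproj_diag; move=> muS nuS; rewrite !prE //.
rewrite !mulmxA -[_ *m P *m invmx P]mulmxA mulmxV // mulmx1.
rewrite -[_ *m _ *m diag_mx _]mulmxA mulmx_diag.
case: eqP => [<-|mn].
  congr (_ *m diag_mx _ *m _); apply/rowP => i; rewrite !mxE.
  by case: eqP; rewrite ?mulr1 ?mulr0.
suff -> : (\row_i ((\row_i (D 0 i == mu)%:R) 0 i *
    (\row_i (D 0 i == nu)%:R) 0 i)) = 0 :> 'rV[C]_d.
  by rewrite raddf0 mulmx0 mul0mx.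
apply/rowP => i; rewrite !mxE; case: eqP => [->|_]; last by rewrite mul0r.
by case: eqP => [//|_]; rewrite mulr0.
Qed.

Lemma eigenproj_sum : \sum_(mu : seq_sub (spectrum h)) eigenproj h (val mu) = 1%:M.
Proof.
have [P [D [Pu hE DS prE]]] := eigenproj_diag.
under eq_bigr => mu _ do rewrite prE ?(valP mu) //.
rewrite -mulmx_suml -mulmx_sumr -(raddf_sum (@diag_mx _ _)).
have -> : \sum_(mu : seq_sub (spectrum h)) \row_i (D 0 i == val mu)%:R =
    const_mx 1 :> 'rV[C]_d.
  apply/rowP => i; rewrite summxE !mxE (bigD1 (SeqSub (DS i))) //= !mxE eqxx.
  rewrite big1 ?addr0 // => mu; rewrite -val_eqE /= => ne.
  by rewrite mxE eq_sym (negPf ne).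
by rewrite /= diag_const_mx mulmx1 mulVmx.
Qed.

Lemma mul_eigenproj (mu : C) : mu \in spectrum h ->
  h *m eigenproj h mu = mu *: eigenproj h mu.
Proof.
have [P [D [Pu hE DS prE]]] := eigenproj_diag; move=> muS; rewrite !prE // {1}hE.
rewrite !mulmxA -[_ *m P *m invmx P]mulmxA mulmxV // mulmx1.
rewrite -[_ *m _ *m diag_mx _]mulmxA mulmx_diag scalemxAl scalemxAr.
congr (_ *m _ *m _); apply/matrixP => i j; rewrite !mxE.
case: (i == j); rewrite ?mulr1n ?mulr0n ?mulr0 //.
by case: eqP => [->|_]; rewrite ?mulr0.
Qed.

Lemma eigenproj_mulr (mu : C) : mu \in spectrum h ->
  eigenproj h mu *m h = mu *: eigenproj h mu.
Proof.
have [P [D [Pu hE DS prE]]] := eigenproj_diag; move=> muS; rewrite !prE // {1}hE.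
rewrite !mulmxA -[_ *m P *m invmx P]mulmxA mulmxV // mulmx1.
rewrite -[_ *m _ *m diag_mx _]mulmxA mulmx_diag scalemxAl scalemxAr.
congr (_ *m _ *m _); apply/matrixP => i j; rewrite !mxE.
case: (i == j); rewrite ?mulr1n ?mulr0n ?mulr0 //.
by case: eqP => [->|_]; rewrite ?mulr1 ?mul1r ?mul0r ?mulr0.
Qed.

End Eigenprojections.

(** * Tensor operators and their embeddings *)

Section TensorLegs.
Variables (RR : realType) (d : nat).
Notation C := RR[i].
Notation tend := (tend RR d).
Notation idx n := {ffun 'I_n -> 'I_d}.

(** Matrix coefficients with respect to the basis of tensors of basis vectors,
    free of the enumeration of that basis. *)
Definition ent n (A : tend n) (a b : idx n) : C :=
  A (enum_rank (a : tidx d n)) (enum_rank (b : tidx d n)).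

Lemma ent_inj n (A B : tend n) : (forall a b, ent A a b = ent B a b) -> A = B.
Proof.
move=> E; apply/matrixP => i j.
by rewrite -(enum_valK i) -(enum_valK j); apply: E.
Qed.

Lemma ent_mul n (A B : tend n) a b :
  ent (A *m B) a b = \sum_c ent A a c * ent B c b.
Proof.
rewrite /ent mxE (reindex (@enum_rank (tidx d n))) //=.
by exists (@enum_val (tidx d n) predT) => i _; rewrite ?enum_rankK ?enum_valK.
Qed.

Lemma ent1 n a b : ent (1%:M : tend n) a b = (a == b)%:R.
Proof. by rewrite /ent mxE (inj_eq enum_rank_inj). Qed.

Lemma ent_tensor n A (a b : idx n) :
  ent (tensor_op A) a b = \prod_i A i (a i) (b i).
Proof. by rewrite /ent mxE /idx_of !enum_rankK. Qed.

Lemma tensor_opM n (A B : 'I_n -> 'M[C]_d) :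
  tensor_op A *m tensor_op B = tensor_op (fun i => A i *m B i).
Proof.
apply: ent_inj => a b; rewrite ent_mul ent_tensor.
under [LHS]eq_bigr => c _ do rewrite !ent_tensor -big_split /=.
by under [RHS]eq_bigr => i _ do rewrite mxE; rewrite bigA_distr_bigA.
Qed.

Lemma tensor_op1 n : tensor_op (fun=> 1%:M) = 1%:M :> tend n.
Proof.
apply: ent_inj => a b; rewrite ent_tensor ent1.
case: eqP => [->|/eqP ab]; first by rewrite big1 // => i _; rewrite mxE eqxx.
have [i ne] : exists i, a i != b i.
  apply/existsP; rewrite -negb_forall; apply: contra ab => /forallP E.
  by apply/eqP/ffunP => i; apply/eqP.
by rewrite (bigD1 i) //= mxE (negPf ne) mul0r.
Qed.

Lemma eq_tensor_op n (A B : 'I_n -> 'M[C]_d) :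
  A =1 B -> tensor_op A = tensor_op B :> tend n.
Proof. by move=> E; congr tensor_op; apply/funext. Qed.

Lemma tensor_op_eq0 n (A : 'I_n -> 'M[C]_d) i : A i = 0 ->
  tensor_op A = 0 :> tend n.
Proof.
move=> Ai; apply: ent_inj => a b.
by rewrite ent_tensor (bigD1 i) //= Ai /ent !mxE mul0r.
Qed.

Definition restr m n (phi : 'I_m -> 'I_n) (a : idx n) : idx m :=
  [ffun i => a (phi i)].

Definition off m n (phi : 'I_m -> 'I_n) (a b : idx n) : bool :=
  [forall k, (k \notin codom phi) ==> (a k == b k)].

(** For injective phi, B acting on the legs phi 0, ..., phi (m - 1); the factor
    says that it is the identity on the other legs. *)
Definition emb m n (phi : 'I_m -> 'I_n) (B : tend m) : tend n :=
  \matrix_(i, j) (ent B (restr phi (idx_of i)) (restr phi (idx_of j))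
                  * (off phi (idx_of i) (idx_of j))%:R).

Lemma ent_emb m n (phi : 'I_m -> 'I_n) B a b :
  ent (emb phi B) a b = ent B (restr phi a) (restr phi b) * (off phi a b)%:R.
Proof. by rewrite [LHS]mxE /idx_of !enum_rankK. Qed.

Lemma off_refl m n (phi : 'I_m -> 'I_n) a : off phi a a.
Proof. by apply/forallP => k; rewrite eqxx implybT. Qed.

Lemma off_trans m n (phi : 'I_m -> 'I_n) a b c : off phi a b ->
  off phi a c = off phi b c.
Proof.
move=> /forallP ab; apply/forallP/forallP => H k; move: (ab k) (H k);
  case: (k \notin _) => //= /eqP ->; by [].
Qed.

Lemma restr_off m n (phi : 'I_m -> 'I_n) a b :
  (restr phi a == restr phi b) && off phi a b = (a == b).
Proof.
apply/andP/eqP => [[/eqP/ffunP r /forallP o]|->]; last by rewrite off_refl.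
apply/ffunP => k; move: (o k); case: codomP => [[i ->] _|_ /= /eqP //].
by have := r i; rewrite !ffunE.
Qed.

Section Injective.
Variables (m n : nat) (phi : 'I_m -> 'I_n).
Hypothesis phi_inj : injective phi.

Definition glue (a : idx n) (e : idx m) : idx n :=
  [ffun k => if [pick i | phi i == k] is Some i then e i else a k].

Lemma glue_phi a e i : glue a e (phi i) = e i.
Proof.
rewrite ffunE; case: pickP => [j /eqP/phi_inj -> //|/(_ i)].
by rewrite eqxx.
Qed.

Lemma restr_glue a e : restr phi (glue a e) = e.
Proof. by apply/ffunP => i; rewrite ffunE glue_phi. Qed.

Lemma glue_off a e : off phi a (glue a e).
Proof.
apply/forallP => k; apply/implyP => nk; rewrite ffunE.
by case: pickP => // i /eqP ki; rewrite -ki codom_f in nk.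
Qed.

Lemma glue_restr a b : off phi a b -> glue a (restr phi b) = b.
Proof.
move=> ab; apply/eqP; rewrite -(restr_off phi) restr_glue eqxx /=.
by rewrite -(off_trans b (glue_off a _)).
Qed.

(** An index that agrees with a off the image of phi is the same as its
    restriction along phi, so the intermediate sums agree. *)
Lemma emb_mul (A B : tend m) : emb phi (A *m B) = emb phi A *m emb phi B.
Proof.
apply: ent_inj => a b; rewrite ent_emb !ent_mul mulr_suml.
under [RHS]eq_bigr => c _ do rewrite !ent_emb.
rewrite (bigID (off phi a)) /= [X in _ + X]big1 ?addr0; last first.
  by move=> c /negPf ->; rewrite mulr0 mul0r.
rewrite (reindex_onto (glue a) (restr phi)) /=; last first.
  by move=> c ac; apply: glue_restr.
apply: eq_big => [e|e _]; first by rewrite glue_off restr_glue eqxx.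
by rewrite restr_glue glue_off mulr1 mulrA (off_trans b (glue_off a e)).
Qed.

Lemma emb1 : emb phi 1%:M = 1%:M.
Proof.
apply: ent_inj => a b; rewrite ent_emb !ent1 -natrM mulnb.
by rewrite restr_off.
Qed.

Lemma emb_inj (i0 : 'I_m) : injective (emb phi).
Proof.
move=> A B E; apply: ent_inj => e f.
pose a := glue [ffun=> e i0] e; pose b := glue [ffun=> e i0] f.
have := congr1 (fun X => ent X a b) E; rewrite !ent_emb !restr_glue.
by rewrite -(off_trans b (glue_off [ffun=> e i0] e)) glue_off !mulr1.
Qed.

Lemma emb_comp l (psi : 'I_l -> 'I_m) (B : tend l) :
  emb phi (emb psi B) = emb (phi \o psi) B.
Proof.
apply: ent_inj => a b; rewrite !ent_emb.
have r c : restr psi (restr phi c) = restr (phi \o psi) c.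
  by apply/ffunP => i; rewrite !ffunE.
rewrite !r -mulrA -natrM mulnb; congr (_ * (_ : bool)%:R).
apply/andP/forallP => [[/forallP o1 /forallP o2] k|o].
  apply/implyP => nk; have [/codomP[i kE]|k_off] := boolP (k \in codom phi); last first.
    by move/implyP: (o2 k); apply.
  rewrite {}kE in nk *.
  have := o1 i; rewrite !ffunE => /implyP; apply.
  apply: contra nk => /codomP[j ->]; exact: (codom_f (phi \o psi)).
split; apply/forallP => k; apply/implyP => nk.
  have := o (phi k); rewrite !ffunE => /implyP; apply.
  apply: contra nk => /codomP[j /= /phi_inj ->]; exact: codom_f.
move/implyP: (o k); apply; apply: contra nk => /codomP[j ->] /=; exact: codom_f.
Qed.

Definition extend (A : 'I_m -> 'M[C]_d) (k : 'I_n) : 'M[C]_d :=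
  if [pick i | phi i == k] is Some i then A i else 1%:M.

Lemma extend_phi A i : extend A (phi i) = A i.
Proof.
rewrite /extend; case: pickP => [j /eqP/phi_inj -> //|/(_ i)].
by rewrite eqxx.
Qed.

Lemma emb_tensor (A : 'I_m -> 'M[C]_d) :
  emb phi (tensor_op A) = tensor_op (extend A).
Proof.
apply: ent_inj => a b; rewrite ent_emb !ent_tensor.
rewrite [RHS](bigID (mem (codom phi))) /=; congr (_ * _).
  rewrite (reindex_omap phi (fun k => [pick i | phi i == k])) /=; last first.
    move=> k /codomP[i ->]; case: pickP => [j /eqP/= -> //|/(_ i)].
    by rewrite eqxx.
  apply: eq_big => i.
    rewrite codom_f /=; case: pickP => [j /eqP/phi_inj -> |/(_ i)].
      by rewrite eqxx.
    by rewrite eqxx.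
  by rewrite extend_phi !ffunE.
have [o|no] := boolP (off phi a b).
  rewrite big1 // => k nk; rewrite /extend.
  case: pickP => [i /eqP ki|_]; first by rewrite -ki codom_f in nk.
  by move/forallP/(_ k): o; rewrite nk /= => /eqP ->; rewrite mxE eqxx.
have [k] : exists k, ~~ ((k \notin codom phi) ==> (a k == b k)).
  by apply/existsP; rewrite -negb_forall.
rewrite negb_imply => /andP[nk ab].
rewrite (bigD1 k) //= /extend; case: pickP => [i /eqP ki|_].
  by rewrite -ki codom_f in nk.
by rewrite mxE (negPf ab) mul0r.
Qed.

End Injective.
End TensorLegs.

(** * Operators on one and on two legs *)

Section Legs.
Variables (RR : realType) (d : nat).
Notation C := RR[i].
Notation tend := (tend RR d).
Notation idx n := {ffun 'I_n -> 'I_d}.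

Definition pair_leg n (i j : 'I_n) (k : 'I_2) : 'I_n := if k == 0 then i else j.

Lemma pair_leg_inj n (i j : 'I_n) : i != j -> injective (pair_leg i j).
Proof.
move=> ij [[|[|//]] ?] [[|[|//]] ?] //=; rewrite /pair_leg /= => E;
  by [apply: val_inj | move: ij; rewrite E eqxx].
Qed.

Lemma codom_pair n (i j k : 'I_n) :
  (k \notin codom (pair_leg i j)) = (k != i) && (k != j).
Proof.
rewrite -negb_or; congr (~~ _); apply/codomP/orP.
  by move=> [l ->]; rewrite /pair_leg; case: ifP => _; rewrite eqxx; [left|right].
by case=> /eqP ->; [exists 0|exists 1].
Qed.

Lemma leg2E n (B : tend 2) (i j : 'I_n) : leg2 B i j = emb (pair_leg i j) B.
Proof.
apply: ent_inj => a b; rewrite ent_emb [LHS]mxE /idx_of !enum_rankK /ent.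
have r (c : idx n) : pair_idx (c i) (c j) = restr (pair_leg i j) c.
  by apply/ffunP => k; rewrite !ffunE /pair_leg; case: ifP.
rewrite !r; congr (_ * (_ : bool)%:R); apply: eq_forallb => k.
by rewrite codom_pair.
Qed.

Lemma leg2_mul n (A B : tend 2) (i j : 'I_n) : i != j ->
  leg2 (A *m B) i j = leg2 A i j *m leg2 B i j.
Proof. by move=> ij; rewrite !leg2E emb_mul //; apply: pair_leg_inj. Qed.

Lemma leg2_1 n (i j : 'I_n) : i != j -> leg2 (1%:M : tend 2) i j = 1%:M.
Proof. by move=> ij; rewrite leg2E emb1. Qed.

Lemma leg2_inj n (i j : 'I_n) : i != j ->
  injective (fun B : tend 2 => leg2 B i j).
Proof.
move=> ij A B; rewrite !leg2E.
exact: (emb_inj (pair_leg_inj ij) (ord0 : 'I_2)).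
Qed.

Lemma emb_leg2 m n (phi : 'I_m -> 'I_n) (B : tend 2) i j : injective phi ->
  emb phi (leg2 B i j) = leg2 B (phi i) (phi j).
Proof.
move=> phi_inj; rewrite !leg2E emb_comp //; congr (emb _ _).
by apply/funext => k; rewrite /pair_leg /=; case: ifP.
Qed.

Lemma emb_leg1 m n (phi : 'I_m -> 'I_n) (A : 'M[C]_d) i : injective phi ->
  emb phi (leg1 A i) = leg1 A (phi i).
Proof.
move=> phi_inj; rewrite /leg1 emb_tensor //; apply: eq_tensor_op => k.
rewrite /extend; case: pickP => [j /eqP <-|nk].
  by rewrite (inj_eq phi_inj).
by rewrite ifF //; apply/negbTE; rewrite eq_sym nk.
Qed.

Lemma leg1E n (A : 'M[C]_d) (i : 'I_n) :
  leg1 A i = emb (fun _ : 'I_1 => i) (leg1 A ord0).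
Proof. by rewrite emb_leg1 // => x y _; rewrite !ord1. Qed.

Lemma leg1_mul n (A B : 'M[C]_d) (i : 'I_n) :
  leg1 (A *m B) i = leg1 A i *m leg1 B i.
Proof.
rewrite /leg1 tensor_opM; apply: eq_tensor_op => k.
by case: ifP => // _; rewrite mulmx1.
Qed.

Lemma leg1_1 n (i : 'I_n) : leg1 1%:M i = 1%:M :> tend n.
Proof. by rewrite -tensor_op1; apply: eq_tensor_op => k; rewrite if_same. Qed.

Lemma leg1_inj n (i : 'I_n) : injective (fun A : 'M[C]_d => leg1 A i : tend n).
Proof.
move=> A B E; apply/matrixP => x y.
have := congr1 (fun X => ent X [ffun=> x] [ffun k => if k == i then y else x]) E.
rewrite /= /leg1 !ent_tensor (bigD1 i) //= [RHS](bigD1 i) //= !ffunE !eqxx.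
rewrite !big1 ?mulr1 // => k ki;
  by rewrite (negPf ki) !ffunE (negPf ki) mxE eqxx.
Qed.

Lemma ent_flip (a b : idx 2) : ent (flip RR d) a b = (a == pair_idx (b 1) (b 0))%:R.
Proof. by rewrite /ent mxE /idx_of !enum_rankK. Qed.

Lemma ent_leg2_flip n (i j : 'I_n) (a b : idx n) : i != j ->
  ent (leg2 (flip RR d) i j) a b = (a == restr (tperm i j) b)%:R.
Proof.
move=> ij; rewrite leg2E ent_emb ent_flip -natrM mulnb; congr (_ : bool)%:R.
apply/andP/eqP => [[/eqP/ffunP r /forallP o]|->].
  have ri := r 0; have rj := r 1; rewrite !ffunE /= in ri rj.
  apply/ffunP => k; rewrite ffunE; case: tpermP => [->|->|/eqP ki /eqP kj].
  - by rewrite /pair_leg /= in ri.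
  - by rewrite /pair_leg /= in rj.
  - by move: (o k); rewrite codom_pair ki kj => /eqP.
split.
  apply/eqP/ffunP => k; rewrite !ffunE /pair_leg.
  by case: (k == 0); rewrite /= ?tpermL ?tpermR.
apply/forallP => k; rewrite codom_pair; apply/implyP => /andP[ki kj].
by rewrite ffunE tpermD // eq_sym.
Qed.

Lemma restr_tpermK n (i j : 'I_n) : involutive (restr (d := d) (tperm i j)).
Proof. by move=> a; apply/ffunP => k; rewrite !ffunE tpermK. Qed.

Lemma restr_tperm_eq n (i j : 'I_n) (a c : idx n) :
  (a == restr (tperm i j) c) = (c == restr (tperm i j) a).
Proof. by apply/eqP/eqP => ->; rewrite restr_tpermK. Qed.

(** Stated for arbitrary embedded operators, so that it relocates one-leg,
    two-leg and, with phi the identity, all operators. *)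
Lemma leg2_flip_conj m n (phi : 'I_m -> 'I_n) (B : tend m) i j : i != j ->
  leg2 (flip RR d) i j *m emb phi B =
  emb (tperm i j \o phi) B *m leg2 (flip RR d) i j.
Proof.
move=> ij; apply: ent_inj => a b; rewrite !ent_mul.
rewrite (bigD1 (restr (tperm i j) a)) //= [X in _ + X]big1 ?addr0; last first.
  by move=> c ca; rewrite ent_leg2_flip // restr_tperm_eq (negPf ca) mul0r.
rewrite [RHS](bigD1 (restr (tperm i j) b)) //= [X in _ = _ + X]big1 ?addr0; last first.
  by move=> c cb; rewrite [X in _ * X]ent_leg2_flip // (negPf cb) mulr0.
rewrite !ent_leg2_flip // !restr_tpermK !eqxx mul1r mulr1 !ent_emb.
congr (ent _ _ _ * (_ : bool)%:R); try by apply/ffunP => k; rewrite !ffunE /= ?tpermK.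
have cod k : (tperm i j k \in codom phi) = (k \in codom (tperm i j \o phi)).
  apply/codomP/codomP => -[l E]; exists l => /=; first by rewrite -E tpermK.
  by rewrite E tpermK.
apply/forallP/forallP => o k; move: (o (tperm i j k)).
  by rewrite cod !ffunE !tpermK.
by rewrite -cod !ffunE !tpermK.
Qed.

Lemma leg2_flipK n (i j : 'I_n) : i != j ->
  leg2 (flip RR d) i j *m leg2 (flip RR d) i j = 1%:M.
Proof.
move=> ij; apply: ent_inj => a b; rewrite ent_mul ent1.
rewrite (bigD1 (restr (tperm i j) b)) //= [X in _ + X]big1 ?addr0; last first.
  by move=> c cb; rewrite [X in _ * X]ent_leg2_flip // (negPf cb) mulr0.
by rewrite !ent_leg2_flip // restr_tpermK eqxx mulr1.
Qed.

Lemma flipE : flip RR d = leg2 (flip RR d) (0 : 'I_2) (1 : 'I_2).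
Proof.
apply: ent_inj => a b; rewrite ent_leg2_flip // ent_flip; congr (_ == _)%:R.
by apply/ffunP => k; rewrite !ffunE; case: k => -[|[|//]] ?; rewrite /=;
  [congr (b _); rewrite [in RHS](_ : Ordinal _ = 0) ?tpermL //; apply: val_inj
  |congr (b _); rewrite [in RHS](_ : Ordinal _ = 1) ?tpermR //; apply: val_inj].
Qed.

Lemma leg2_id (B : tend 2) : leg2 B (0 : 'I_2) (1 : 'I_2) = B.
Proof.
apply: ent_inj => a b; rewrite leg2E ent_emb.
have r (c : idx 2) : restr (pair_leg 0 1) c = c.
  apply/ffunP => k; rewrite ffunE /pair_leg; congr (c _).
  by case: k => -[|[|//]] ?; apply: val_inj.
rewrite !r (_ : off _ _ _) ?mulr1 //.
apply/forallP => k; rewrite codom_pair.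
by case: k => -[|[|//]] ?; rewrite -!val_eqE.
Qed.

(** The operator R_21 is R with its two legs exchanged. *)
Lemma op21E (B : tend 2) n (i j : 'I_n) : i != j ->
  leg2 (op21 B) i j = leg2 B j i.
Proof.
move=> ij; rewrite /op21 !leg2_mul // [leg2 B i j]leg2E leg2_flip_conj //.
rewrite -mulmxA leg2_flipK // mulmx1 leg2E; congr (emb _ _).
by apply/funext => k; rewrite /pair_leg /=; case: ifP; rewrite ?tpermL ?tpermR.
Qed.

(** Only one intermediate index contributes to the product: it is forced on the
    legs of phi by b and on all other legs by a. *)
Lemma ent_emb_disjoint m l n (phi : 'I_m -> 'I_n) (psi : 'I_l -> 'I_n)
    (A : tend m) (B : tend l) a b :
  injective phi -> (forall i j, phi i != psi j) ->
  ent (emb phi A *m emb psi B) a b =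
  ent A (restr phi a) (restr phi b) * ent B (restr psi a) (restr psi b) *
  [forall k, (k \notin codom phi) ==> (k \notin codom psi) ==> (a k == b k)]%:R.
Proof.
move=> phi_inj dis; rewrite ent_mul.
have npsi k : k \in codom phi -> k \notin codom psi.
  by move=> /codomP[i ->]; apply/negP => /codomP[j]; apply/eqP/dis.
pose c0 := glue phi a (restr phi b).
have c0psi : restr psi c0 = restr psi a.
  apply/ffunP => j; rewrite !ffunE; case: pickP => // i.
  by rewrite (negPf (dis i j)).
rewrite (bigD1 c0) //= [X in _ + X]big1 ?addr0.
  rewrite !ent_emb restr_glue // glue_off // mulr1 c0psi -mulrA.
  congr (_ * (_ * (_ : bool)%:R)); apply: eq_forallb => k.
  have [kphi|nk] := boolP (k \in codom phi).
    rewrite npsi //=; case/codomP: kphi => i ->.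
    by rewrite glue_phi // ffunE eqxx.
  rewrite /= ffunE; case: pickP => // i /eqP ki.
  by rewrite -ki codom_f in nk.
move=> c cc0; rewrite !ent_emb.
have [ac|_] := boolP (off phi a c); last by rewrite mulr0 mul0r.
have [cb|_] := boolP (off psi c b); last by rewrite !mulr0.
case/eqP: cc0; rewrite -(glue_restr phi_inj ac); congr (glue _ _ _).
apply/ffunP => i; rewrite !ffunE; apply/eqP.
by move/forallP/(_ (phi i)): cb; rewrite npsi ?codom_f.
Qed.

Lemma emb_comm_disjoint m l n (phi : 'I_m -> 'I_n) (psi : 'I_l -> 'I_n)
    (A : tend m) (B : tend l) :
  injective phi -> injective psi -> (forall i j, phi i != psi j) ->
  emb phi A *m emb psi B = emb psi B *m emb phi A :> tend n.
Proof.
move=> phi_inj psi_inj dis; apply: ent_inj => a b.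
rewrite !ent_emb_disjoint // => [|i j]; last by rewrite eq_sym.
rewrite [ent B _ _ * _]mulrC; congr (_ * (_ : bool)%:R).
by apply: eq_forallb => k; rewrite !implyNb orbCA.
Qed.

Lemma leg1_leg2_comm n (A : 'M[C]_d) (B : tend 2) (i j k : 'I_n) :
  j != k -> i != j -> i != k ->
  leg1 A i *m leg2 B j k = leg2 B j k *m leg1 A i.
Proof.
move=> jk ij ik; rewrite leg1E leg2E; apply: emb_comm_disjoint.
- by move=> x y _; rewrite !ord1.
- exact: pair_leg_inj.
- by move=> _ y; rewrite /pair_leg; case: ifP.
Qed.

Lemma leg2_leg2_comm n (A B : tend 2) (i j k l : 'I_n) :
  i != j -> k != l -> i != k -> i != l -> j != k -> j != l ->
  leg2 A i j *m leg2 B k l = leg2 B k l *m leg2 A i j.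
Proof.
move=> ij kl ik il jk jl; rewrite !leg2E; apply: emb_comm_disjoint.
- exact: pair_leg_inj.
- exact: pair_leg_inj.
- by move=> x y; rewrite /pair_leg; case: ifP; case: ifP.
Qed.

Lemma leg1_leg1_comm n (A B : 'M[C]_d) (i j : 'I_n) : i != j ->
  leg1 A i *m leg1 B j = leg1 B j *m leg1 A i.
Proof.
move=> ij; rewrite /leg1 !tensor_opM; apply: eq_tensor_op => k.
by case: eqP => [->|_]; rewrite ?(negPf ij) ?mulmx1 ?mul1mx.
Qed.

End Legs.

(** * Weights and dynamical shifts *)

Section Weights.
Variables (RR : realType) (d : nat) (h : 'M[RR[i]]_d).
Hypothesis hss : diagonalizable h.
Notation C := RR[i].
Notation tend := (tend RR d).
Notation weight := (weight h).
Notation wp := (weight_proj).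

(** The eigenvalue of c_0 h_0 + c_1 h_1 + ... on the weight space of mu. *)
Definition wt n (c : 'I_n -> C) (mu : weight n) : C := \sum_i c i * val (mu i).

Lemma val_spectrum (mu : seq_sub (spectrum h)) : val mu \in spectrum h.
Proof. exact: valP. Qed.
#[local] Hint Resolve val_spectrum : core.

Lemma entD n (A B : tend n) a b : ent (A + B) a b = ent A a b + ent B a b.
Proof. by rewrite /ent mxE. Qed.

Lemma ent_sum n (I : finType) (F : I -> tend n) a b :
  ent (\sum_i F i) a b = \sum_i ent (F i) a b.
Proof. by rewrite /ent summxE. Qed.

Lemma weight_proj_sum n : \sum_(mu : weight n) wp mu = 1%:M :> tend n.
Proof.
apply: ent_inj => a b; rewrite -tensor_op1 ent_tensor -(eigenproj_sum hss).
rewrite ent_sum; under [LHS]eq_bigr => mu _ do rewrite ent_tensor.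
under [RHS]eq_bigr => i _ do rewrite summxE.
by rewrite bigA_distr_bigA.
Qed.

Lemma weight_proj_mul n (mu nu : weight n) :
  wp mu *m wp nu = if mu == nu then wp mu else 0.
Proof.
rewrite /wp tensor_opM; case: eqP => [<-|/eqP ne].
  by apply: eq_tensor_op => i; rewrite eigenproj_mul // eqxx.
have [i ni] : exists i, mu i != nu i.
  apply/existsP; rewrite -negb_forall; apply: contra ne => /forallP E.
  by apply/eqP/ffunP => i; apply/eqP.
by apply: (tensor_op_eq0 (i := i)); rewrite eigenproj_mul // val_eqE (negPf ni).
Qed.

Lemma tensor_op_scale n (A : 'I_n -> 'M[C]_d) i x :
  tensor_op (fun j => if j == i then x *: A j else A j) = x *: tensor_op A :> tend n.
Proof.
apply: ent_inj => a b; rewrite ent_tensor /ent mxE -/(ent (tensor_op A) a b).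
rewrite ent_tensor (bigD1 i) //= eqxx mxE -mulrA; congr (_ * _).
rewrite [RHS](bigD1 i) //=; congr (_ * _).
by apply: eq_bigr => j /negPf ->.
Qed.

Lemma leg1_weight_proj n i (mu : weight n) : leg1 h i *m wp mu = val (mu i) *: wp mu.
Proof.
rewrite /leg1 /wp tensor_opM -(tensor_op_scale _ i); apply: eq_tensor_op => j.
by case: eqP => [->|_]; rewrite ?mul_eigenproj ?mul1mx.
Qed.

Lemma weight_proj_leg1 n i (mu : weight n) : wp mu *m leg1 h i = val (mu i) *: wp mu.
Proof.
rewrite /leg1 /wp tensor_opM -(tensor_op_scale _ i); apply: eq_tensor_op => j.
by case: eqP => [->|_]; rewrite ?eigenproj_mulr ?mulmx1.
Qed.

Definition total_h n (c : 'I_n -> C) : tend n := \sum_i c i *: leg1 h i.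

Lemma total_h_proj n c (mu : weight n) : total_h c *m wp mu = wt c mu *: wp mu.
Proof.
rewrite mulmx_suml scaler_suml; apply: eq_bigr => i _.
by rewrite -scalemxAl leg1_weight_proj scalerA.
Qed.

Lemma proj_total_h n c (mu : weight n) : wp mu *m total_h c = wt c mu *: wp mu.
Proof.
rewrite mulmx_sumr scaler_suml; apply: eq_bigr => i _.
by rewrite -scalemxAr weight_proj_leg1 scalerA.
Qed.

(** This is the condition under which a dynamical shift along c passes through A;
    in terms of blocks see [preserves_block]. *)
Definition preserves n (c : 'I_n -> C) (A : tend n) : Prop :=
  A *m total_h c = total_h c *m A.

Lemma preserves_block n c (A : tend n) mu nu : preserves c A ->
  wt c mu <> wt c nu -> wp mu *m A *m wp nu = 0.
Proof.
move=> pA ne; have : wt c mu *: (wp mu *m A *m wp nu) =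
    wt c nu *: (wp mu *m A *m wp nu).
  transitivity (wp mu *m total_h c *m A *m wp nu).
    by rewrite proj_total_h -!scalemxAl.
  rewrite -[wp mu *m _ *m A]mulmxA -pA -!mulmxA total_h_proj.
  by rewrite -!scalemxAr.
move/eqP; rewrite -subr_eq0 -scalerBl scaler_eq0 subr_eq0 => /orP[/eqP //|/eqP //].
Qed.

(** The weights on the two sides of a nonzero block of A have the same value
    under c, so that either of them may be used as the argument of X. *)
Lemma sum_blocks n c (A : tend n) (X : C -> tend n) nu : preserves c A ->
  \sum_(mu : weight n) X (wt c mu) *m (wp mu *m A *m wp nu) = X (wt c nu) *m A *m wp nu.
Proof.
move=> pA; transitivity (\sum_(mu : weight n) X (wt c nu) *m (wp mu *m A *m wp nu)).
  apply: eq_bigr => mu _; have [-> //|ne] := pselect (wt c mu = wt c nu).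
  by rewrite (preserves_block pA ne) !mulmx0.
rewrite -mulmx_sumr -!mulmx_suml weight_proj_sum mul1mx mulmxA //.
Qed.

Lemma eq_on_weights n p (A B : 'M[C]_(p, #|tidx d n|)) :
  (forall nu : weight n, A *m wp nu = B *m wp nu) -> A = B.
Proof.
move=> E; rewrite -[A]mulmx1 -[B]mulmx1 -weight_proj_sum !mulmx_sumr.
exact: eq_bigr.
Qed.

Lemma dyn_shift_proj n (S : C -> tend n) c xi nu :
  dyn_shift h S c xi *m wp nu = S (xi + wt c nu) *m wp nu.
Proof.
rewrite /dyn_shift mulmx_suml (bigD1 nu) //= -mulmxA weight_proj_mul eqxx.
rewrite [X in _ + X]big1 ?addr0 // => mu ne.
by rewrite -mulmxA weight_proj_mul (negPf ne) mulmx0.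
Qed.

(** Although S(xi + c.h) involves h on the legs of A, it is only through a
    combination that commutes with A. *)
Lemma dyn_shift_comm n (A : tend n) (S : C -> tend n) c xi : preserves c A ->
  (forall eta, A *m S eta = S eta *m A) ->
  A *m dyn_shift h S c xi = dyn_shift h S c xi *m A.
Proof.
move=> pA cA; apply: eq_on_weights => nu.
rewrite -mulmxA dyn_shift_proj mulmxA cA -(sum_blocks (fun w => S (xi + w)) _ pA).
rewrite /dyn_shift !mulmx_suml; apply: eq_bigr => mu _.
by rewrite !mulmxA.
Qed.

Lemma dyn_shift_mul n (A B : C -> tend n) c xi :
  (forall eta, preserves c (B eta)) ->
  dyn_shift h (fun eta => A eta *m B eta) c xi =
  dyn_shift h A c xi *m dyn_shift h B c xi.
Proof.
move=> pB; apply: eq_on_weights => nu.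
rewrite -[RHS]mulmxA !dyn_shift_proj -(sum_blocks (fun w => A (xi + w)) _ (pB _)).
rewrite /dyn_shift mulmx_suml; apply: eq_bigr => mu _.
by rewrite !mulmxA.
Qed.

Lemma dyn_shift_const n (A : tend n) c xi : dyn_shift h (fun=> A) c xi = A.
Proof. by apply: eq_on_weights => nu; rewrite dyn_shift_proj. Qed.

Lemma eq_dyn_shift n (S S' : C -> tend n) c c' xi : S =1 S' -> c =1 c' ->
  dyn_shift h S c xi = dyn_shift h S' c' xi.
Proof.
move=> ES Ec; rewrite /dyn_shift; apply: eq_bigr => mu _; rewrite ES.
by under eq_bigr => i _ do rewrite Ec.
Qed.

Lemma wt_scale n x (c : 'I_n -> C) mu : wt (fun i => x * c i) mu = x * wt c mu.
Proof. by rewrite /wt mulr_sumr; apply: eq_bigr => i _; rewrite mulrA. Qed.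

Lemma wtD n (c c' : 'I_n -> C) mu : wt (fun i => c i + c' i) mu = wt c mu + wt c' mu.
Proof. by rewrite /wt -big_split; apply: eq_bigr => i _; rewrite mulrDl. Qed.

Lemma wt0 n (mu : weight n) : wt (fun=> 0) mu = 0.
Proof. by rewrite /wt big1 // => i _; rewrite mul0r. Qed.

Lemma dyn_shift_scale n (S : C -> tend n) x c xi :
  dyn_shift h (fun eta => S (x * eta)) c xi =
  dyn_shift h S (fun i => x * c i) (x * xi).
Proof.
by apply: eq_on_weights => nu; rewrite !dyn_shift_proj wt_scale mulrDr.
Qed.

Section Embedding.
Variables (m n : nat) (phi : 'I_m -> 'I_n).
Hypothesis phi_inj : injective phi.

Definition extend_coef (c : 'I_m -> C) (k : 'I_n) : C :=
  if [pick i | phi i == k] is Some i then c i else 0.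

Definition restr_weight (nu : weight n) : weight m := [ffun i => nu (phi i)].

Lemma wt_extend c nu : wt (extend_coef c) nu = wt c (restr_weight nu).
Proof.
rewrite /wt (bigID (mem (codom phi))) /= [X in _ + X]big1 ?addr0; last first.
  move=> k nk; rewrite /extend_coef; case: pickP => [i /eqP ki|_].
    by rewrite -ki codom_f in nk.
  by rewrite mul0r.
rewrite (reindex_omap phi (fun k => [pick i | phi i == k])) /=; last first.
  move=> k /codomP[i ->]; case: pickP => [j /eqP/= -> //|/(_ i)].
  by rewrite eqxx.
have pk i : [pick j | phi j == phi i] = Some i.
  by case: pickP => [j /eqP/phi_inj -> //|/(_ i)]; rewrite eqxx.
apply: eq_big => i; first by rewrite codom_f pk eqxx.
by rewrite /extend_coef pk ffunE.
Qed.

Lemma emb_weight_proj (mu : weight m) (nu : weight n) :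
  emb phi (wp mu) *m wp nu = if mu == restr_weight nu then wp nu else 0.
Proof.
rewrite /wp emb_tensor // tensor_opM; case: eqP => [->|/eqP ne].
  apply: eq_tensor_op => k; rewrite /extend; case: pickP => [i /eqP <-|_].
    by rewrite ffunE eigenproj_mul // eqxx.
  by rewrite mul1mx.
have [i ni] : exists i, mu i != nu (phi i).
  apply/existsP; rewrite -negb_forall; apply: contra ne => /forallP E.
  by apply/eqP/ffunP => i; rewrite ffunE; apply/eqP.
by apply: (tensor_op_eq0 (i := phi i)); rewrite extend_phi //
  eigenproj_mul // val_eqE (negPf ni).
Qed.

Lemma emb_sum (I : finType) (F : I -> tend m) :
  emb phi (\sum_i F i) = \sum_i emb phi (F i).
Proof.
apply: ent_inj => a b; rewrite ent_emb !ent_sum mulr_suml.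
by apply: eq_bigr => i _; rewrite ent_emb.
Qed.

(** The weight projections of the larger tensor power refine the embedded ones of
    the smaller, so it is enough to compare both sides on them. *)
Lemma emb_dyn_shift (S : C -> tend m) c xi :
  emb phi (dyn_shift h S c xi) =
  dyn_shift h (fun eta => emb phi (S eta)) (extend_coef c) xi.
Proof.
apply: eq_on_weights => nu; rewrite dyn_shift_proj wt_extend.
rewrite /dyn_shift emb_sum mulmx_suml (bigD1 (restr_weight nu)) //=.
rewrite [X in _ + X]big1 ?addr0 => [|mu ne].
  by rewrite emb_mul // -mulmxA emb_weight_proj eqxx.
by rewrite emb_mul // -mulmxA emb_weight_proj (negPf ne) mulmx0.
Qed.

End Embedding.

Lemma preserves_leg1 n c (A : 'M[C]_d) (i : 'I_n) : c i = 0 ->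
  preserves c (leg1 A i).
Proof.
move=> ci; rewrite /preserves mulmx_sumr mulmx_suml; apply: eq_bigr => k _.
have [<-|ik] := eqVneq i k; first by rewrite ci !scale0r mulmx0 mul0mx.
by rewrite -scalemxAr -scalemxAl leg1_leg1_comm // eq_sym.
Qed.

Lemma Delta_hE n (i j : 'I_n) : i != j ->
  leg2 (Delta_h h) i j = leg1 h i + leg1 h j :> tend n.
Proof.
move=> ij; have phi_inj := pair_leg_inj ij.
have -> : leg1 h i = emb (pair_leg i j) (leg1 h 0) by rewrite emb_leg1.
have -> : leg1 h j = emb (pair_leg i j) (leg1 h 1) by rewrite emb_leg1.
by apply: ent_inj => a b; rewrite leg2E ent_emb /Delta_h !entD !ent_emb mulrDl.
Qed.

(** The ice rule enters the proof here: R on the legs i and j commutes with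
    h_i + h_j. *)
Lemma preserves_leg2 n c (B : tend 2) (i j : 'I_n) : i != j -> c i = c j ->
  c i = 0 \/ B *m Delta_h h = Delta_h h *m B -> preserves c (leg2 B i j).
Proof.
move=> ij cij cB; rewrite /preserves /total_h (bigD1 i) //= (bigD1 j) 1?eq_sym //=.
rewrite addrA -cij -scalerDr -Delta_hE // mulmxDr mulmxDl; congr (_ + _).
  rewrite -scalemxAr -scalemxAl; case: cB => [->|cB]; first by rewrite !scale0r.
  by rewrite -!leg2_mul // cB.
rewrite mulmx_sumr mulmx_suml; apply: eq_bigr => k /andP[ki kj].
by rewrite -scalemxAr -scalemxAl leg1_leg2_comm.
Qed.

Lemma preserves_mul n c (A B : tend n) : preserves c A -> preserves c B ->
  preserves c (A *m B).
Proof. by rewrite /preserves => pA pB; rewrite -mulmxA pB !mulmxA pA. Qed.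

Lemma flip_Delta_h : flip RR d *m Delta_h h = Delta_h h *m flip RR d.
Proof.
rewrite flipE /Delta_h mulmxDr mulmxDl addrC.
have E i : leg2 (flip RR d) 0 1 *m leg1 h (i : 'I_2) =
    leg1 h (tperm 0 1 i) *m leg2 (flip RR d) 0 1.
  rewrite {1}leg1E leg2_flip_conj // [in RHS]leg1E //.
by rewrite !E tpermL tpermR.
Qed.

End Weights.
Local Open Scope classical_set_scope.

(** * Generic properties and submersive maps *)

Section Generic.
Implicit Types X Y : topologicalType.

Lemma genericallyI X (P Q : X -> Prop) : generically P -> generically Q ->
  generically (fun x => P x /\ Q x).
Proof.
move=> gP gQ; rewrite /generically.
have -> : [set x | P x /\ Q x] = [set x | P x] `&` [set x | Q x] by [].
by rewrite interiorI; apply: denseI => //; apply: open_interior.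
Qed.

Lemma generically_mono X (P Q : X -> Prop) : (forall x, P x -> Q x) ->
  generically P -> generically Q.
Proof.
move=> PQ gP O O0 oO; have [x [Ox Px]] := gP O O0 oO; exists x; split=> //.
exact: (interiorS (PQ : [set x | P x] `<=` [set x | Q x]) Px).
Qed.

Lemma generically_all X (P : X -> Prop) : (forall x, P x) -> generically P.
Proof.
move=> allP O [x Ox] _; exists x; split=> //.
rewrite (_ : [set y | P y] = setT) ?interiorT //.
by apply/seteqP; split=> // y _; apply: allP.
Qed.

Lemma generically_forall X (I : finType) (P : I -> X -> Prop) :
  (forall i, generically (P i)) -> generically (fun x => forall i, P i x).
Proof.
move=> gP; suff H (s : seq I) : generically (fun x => forall i, i \in s -> P i x).
  by apply: generically_mono (H (enum I)) => x Hx i; apply: Hx; rewrite mem_enum.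
elim: s => [|i s IH]; first by apply: generically_all.
apply: generically_mono (genericallyI (gP i) IH) => x [Pi Ps] j.
by rewrite in_cons => /orP[/eqP ->//|]; apply: Ps.
Qed.

(** Continuous maps with a continuous section through every point. Such maps are
    open and pull dense open sets back to dense open sets, so that generic
    properties can be transported in both directions. *)
Definition submersive X Y (g : X -> Y) : Prop :=
  continuous g /\ forall x, exists s : Y -> X,
    [/\ continuous s, s (g x) = x & forall y, g (s y) = y].

Lemma submersive_open X Y (g : X -> Y) U : submersive g -> open U -> open (g @` U).
Proof.
move=> [_ sec] oU; rewrite openE => _ [x Ux <-].
have [s [cs sx gs]] := sec x.
have : nbhs (g x) (s @^-1` U).
  by apply: cs; rewrite sx; apply: open_nbhs_nbhs.
by apply: filterS => y Uy; exists (s y).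
Qed.

(** From right to left, the image under g of the open set of good points is open,
    and dense because the preimage of a nonempty open set is one. *)
Lemma generically_submersive X Y (g : X -> Y) (P : Y -> Prop) (x0 : X) :
  submersive g -> generically P <-> generically (fun x => P (g x)).
Proof.
move=> sg; split=> gP O [x Ox] oO.
  have [_ [[y Oy <-] Py]] := gP (g @` O) (ex_intro _ _ (imageP g Ox))
    (submersive_open sg oO).
  exists y; split=> //; exact: (proj1 sg y).
have [s [cs sx gs]] := (proj2 sg) x0.
have oP : open (g @^-1` O) by apply: open_comp => // z _; apply: (proj1 sg).
have nP : g @^-1` O !=set0 by exists (s x); rewrite /= gs.
have [y [Oy Py]] := gP _ nP oP; exists (g y); split=> //.
apply: filterS (open_nbhs_nbhs (conj (submersive_open sg (open_interior [set x | P (g x)])) (imageP g Py))).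
by move=> _ [z /interior_subset Pz <-].
Qed.

End Generic.

(** * Closure properties of meromorphic functions *)

Section MeromorphicClosure.
Variable RR : realType.
Notation C := RR[i].
Implicit Types X Y : normedModType C.

Lemma meromorphic_holomorphic X (f : X -> C) :
  holomorphic_on setT f -> meromorphic f.
Proof.
move=> df x; exists setT, f, (fun=> 1); split=> //.
- by split => //; apply: openT.
- by move=> y _ B By; exists y; split; [rewrite /= oner_neq0 | apply: nbhs_singleton].
- by move=> y _ _; rewrite divr1.
Qed.

Lemma meromorphic_cst X (c : C) : meromorphic (fun _ : X => c).
Proof. by apply: meromorphic_holomorphic => x _; exact: (@differentiable_cst _ _ C^o (c : C^o) x). Qed.

(** Near a zero of b c one first moves to a nearby point with b <> 0, and from
    there, staying in the open set where b <> 0, to one with c <> 0. *)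
Lemma neq0_dense_mul X (U V : set X) (b c : X -> C) : open U -> open V ->
  holomorphic_on U b ->
  U `<=` closure [set y | b y != 0] -> V `<=` closure [set y | c y != 0] ->
  U `&` V `<=` closure [set y | b y * c y != 0].
Proof.
move=> oU oV hb cb cc x [Ux Vx] B Bx.
have BUV : nbhs x (B `&` (U `&` V)).
  by apply: filterI => //; apply: filterI; apply: open_nbhs_nbhs.
have [O [[oO Ox] OB]] : exists O, open_nbhs x O /\ O `<=` B `&` (U `&` V).
  by move: BUV; rewrite nbhsE => -[O [? ?] ?]; exists O.
have [y [by0 Oy]] := cb x Ux O (open_nbhs_nbhs (conj oO Ox)).
have [By [Uy Vy]] := OB y Oy.
have nb : nbhs y [set z | b z != 0].
  exact: (cvgr_neq0 _ (differentiable_continuous (hb y Uy)) by0).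
have [z [cz [bz Oz]]] := cc y Vy _ (filterI nb (open_nbhs_nbhs (conj oO Oy))).
exists z; split; first by rewrite /= mulf_neq0.
by have [] := OB z Oz.
Qed.

Lemma meromorphicM X (f g : X -> C) : meromorphic f -> meromorphic g ->
  meromorphic (fun x => f x * g x).
Proof.
move=> mf mg x.
have [U [a [b [[oU Ux] ha hb cb fE]]]] := mf x.
have [V [a' [b' [[oV Vx] ha' hb' cb' gE]]]] := mg x.
exists (U `&` V), (fun x => a x * a' x), (fun x => b x * b' x); split.
- by split; [apply: openI|].
- move=> y [Uy Vy]; exact: (@differentiableM _ _ a a' y (ha y Uy) (ha' y Vy)).
- move=> y [Uy Vy]; exact: (@differentiableM _ _ b b' y (hb y Uy) (hb' y Vy)).
- exact: neq0_dense_mul.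
- move=> y [Uy Vy]; rewrite mulf_eq0 negb_or => /andP[by0 by0'].
  by rewrite fE // gE // mulf_div.
Qed.

Lemma meromorphicD X (f g : X -> C) : meromorphic f -> meromorphic g ->
  meromorphic (fun x => f x + g x).
Proof.
move=> mf mg x.
have [U [a [b [[oU Ux] ha hb cb fE]]]] := mf x.
have [V [a' [b' [[oV Vx] ha' hb' cb' gE]]]] := mg x.
exists (U `&` V), (fun x => a x * b' x + a' x * b x), (fun x => b x * b' x); split.
- by split; [apply: openI|].
- move=> y [Uy Vy].
  exact: (@differentiableD _ _ C^o _ _ y
    (@differentiableM _ _ a b' y (ha y Uy) (hb' y Vy))
    (@differentiableM _ _ a' b y (ha' y Vy) (hb y Uy))).
- move=> y [Uy Vy]; exact: (@differentiableM _ _ b b' y (hb y Uy) (hb' y Vy)).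
- exact: neq0_dense_mul.
- move=> y [Uy Vy]; rewrite mulf_eq0 negb_or => /andP[by0 by0'].
  by rewrite fE // gE // addf_div.
Qed.

(** Openness of g keeps the pulled back denominator from vanishing on an open
    set. *)
Lemma meromorphic_comp X Y (g : X -> Y) (f : Y -> C) :
  submersive g -> (forall x, differentiable g x) -> meromorphic f ->
  meromorphic (fun x => f (g x)).
Proof.
move=> sg dg mf x.
have [U [a [b [[oU Ux] ha hb cb fE]]]] := mf (g x).
exists (g @^-1` U), (a \o g), (b \o g); split.
- by split=> //; apply: open_comp => // z _; apply: (proj1 sg).
- by move=> y Uy; apply: (@differentiable_comp _ _ _ C^o) => //; apply: ha.
- by move=> y Uy; apply: (@differentiable_comp _ _ _ C^o) => //; apply: hb.
- move=> y Uy B By; move: By; rewrite nbhsE => -[O [oO Oy] OB].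
  have nO : nbhs (g y) (g @` O).
    by apply: open_nbhs_nbhs; split; [apply: submersive_open | exists y].
  have [w [bw [z Oz zE]]] := cb _ Uy _ nO.
  by exists z; split; [rewrite /= zE | apply: OB].
- by move=> y Uy by0; apply: fE.
Qed.

Lemma eq_meromorphic X (f g : X -> C) : f =1 g -> meromorphic f -> meromorphic g.
Proof. by move=> /funext ->. Qed.

Lemma meromorphic_sum X (I : Type) (s : seq I) (P : pred I) (F : I -> X -> C) :
  (forall i, meromorphic (F i)) -> meromorphic (fun x => \sum_(i <- s | P i) F i x).
Proof.
move=> mF; elim: s => [|i s IH].
  by apply: eq_meromorphic (meromorphic_cst 0) => x; rewrite big_nil.
apply: (@eq_meromorphic _ (fun x =>
  (if P i then F i x else 0) + \sum_(j <- s | P j) F j x)).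
  by move=> x; rewrite big_cons; case: ifP; rewrite ?add0r.
apply: meromorphicD => //; case: (P i) => //; exact: meromorphic_cst.
Qed.

Lemma meromorphic_mx_mul X p q r (A : X -> 'M[C]_(p, q)) (B : X -> 'M[C]_(q, r)) :
  meromorphic_mx A -> meromorphic_mx B -> meromorphic_mx (fun x => A x *m B x).
Proof.
move=> mA mB i j; apply: (@eq_meromorphic _ (fun x => \sum_k A x i k * B x k j)).
  by move=> x; rewrite mxE.
by apply: meromorphic_sum => k; apply: meromorphicM.
Qed.

Lemma meromorphic_mx_sum X p q (I : finType) (F : I -> X -> 'M[C]_(p, q)) :
  (forall i, meromorphic_mx (F i)) -> meromorphic_mx (fun x => \sum_i F i x).
Proof.
move=> mF i j; apply: (@eq_meromorphic _ (fun x => \sum_k F k x i j)).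
  by move=> x; rewrite summxE.
by apply: meromorphic_sum => k; apply: mF.
Qed.

Lemma meromorphic_mx_cst X p q (A : 'M[C]_(p, q)) : meromorphic_mx (fun _ : X => A).
Proof. by move=> i j; apply: meromorphic_cst. Qed.

Lemma meromorphic_mx_comp X Y p q (g : X -> Y) (A : Y -> 'M[C]_(p, q)) :
  submersive g -> (forall x, differentiable g x) -> meromorphic_mx A ->
  meromorphic_mx (fun x => A (g x)).
Proof. by move=> sg dg mA i j; apply: (meromorphic_comp sg dg (mA i j)). Qed.

End MeromorphicClosure.

(** * Changes of variables *)

Section Submersions.
Variables (RR : realType) (n : nat).
Notation C := RR[i].
Notation X := ('rV[C^o]_n * C^o)%type.

Definition smooth (Y Z : normedModType C) (g : Y -> Z) :=
  forall y, differentiable g y.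

Lemma smooth_cont (Y Z : normedModType C) (g : Y -> Z) : smooth g -> continuous g.
Proof. by move=> sg y; apply/differentiable_continuous/sg. Qed.

Lemma smooth_cst (Y Z : normedModType C) (c : Z) : smooth (fun _ : Y => c).
Proof. by move=> y; apply: differentiable_cst. Qed.

Lemma smooth_id (Y : normedModType C) : smooth (fun y : Y => y).
Proof. by move=> y; have : differentiable (id : Y -> Y) y by []. Qed.

Lemma smoothD (Y Z : normedModType C) (f g : Y -> Z) : smooth f -> smooth g ->
  smooth (fun y => f y + g y).
Proof. by move=> sf sg y; apply: differentiableD. Qed.

Lemma smoothN (Y Z : normedModType C) (f : Y -> Z) : smooth f ->
  smooth (fun y => - f y).
Proof. by move=> sf y; apply: differentiableN. Qed.

Lemma smoothM (Y : normedModType C) (f g : Y -> C^o) : smooth f -> smooth g ->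
  smooth (fun y => f y * g y : C^o).
Proof. by move=> sf sg y; exact: (@differentiableM _ _ f g y (sf y) (sg y)). Qed.

Lemma smoothZ (Y Z : normedModType C) (f : Y -> C^o) (v : Z) : smooth f ->
  smooth (fun y => (f y : C) *: v).
Proof. by move=> sf y; exact: (@differentiableZl _ _ _ f v y (sf y)). Qed.

Lemma smooth_comp (U Y Z : normedModType C) (f : U -> Y) (g : Y -> Z) :
  smooth f -> smooth g -> smooth (fun x => g (f x)).
Proof. by move=> sf sg y; apply: (@differentiable_comp _ _ _ _ f g). Qed.

Lemma smooth_pair (U Y Z : normedModType C) (f : U -> Y) (g : U -> Z) :
  smooth f -> smooth g -> smooth (fun x => (f x, g x)).
Proof. by move=> sf sg y; apply: differentiable_pair. Qed.

Lemma smooth_fst (Y Z : normedModType C) : smooth (fun p : Y * Z => p.1).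
Proof.
move=> p; apply: (@linear_differentiable _ _ _ (@fst Y Z)) => q; exact: cvg_fst.
Qed.

Lemma smooth_snd (Y Z : normedModType C) : smooth (fun p : Y * Z => p.2).
Proof.
move=> p; apply: (@linear_differentiable _ _ _ (@snd Y Z)) => q; exact: cvg_snd.
Qed.

Lemma smooth_coord i : smooth (fun z : 'rV[C^o]_n => z 0 i : C^o).
Proof. move=> z; exact: (@differentiable_coord _ 1 n z 0 i). Qed.

Lemma smooth_sum (Y Z : normedModType C) (I : Type) (s : seq I) (F : I -> Y -> Z) :
  (forall i, smooth (F i)) -> smooth (fun y => \sum_(i <- s) F i y).
Proof.
move=> sF; elim: s => [|i s IH].
  have -> : (fun y => \sum_(i <- [::]) F i y) = fun=> 0.
    by apply/funext => y; rewrite big_nil.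
  exact: smooth_cst.
have -> : (fun y => \sum_(j <- i :: s) F j y) =
    fun y => F i y + \sum_(j <- s) F j y.
  by apply/funext => y; rewrite big_cons.
exact: smoothD.
Qed.

Lemma smooth_affW_act (w : affW n) : smooth (affW_act w : 'rV[C^o]_n -> 'rV[C^o]_n).
Proof.
have -> : (affW_act w : 'rV[C^o]_n -> 'rV[C^o]_n) = fun z =>
    \sum_i (((-1) ^+ affW_sign w i : C^o) * z 0 (affW_perm w i)
      + ((affW_trans w i)%:~R : C)) *: (delta_mx 0 i : 'rV[C^o]_n).
  apply/funext => z; rewrite [LHS]row_sum_delta.
  by apply: eq_bigr => i _; rewrite mxE.
apply: smooth_sum => i; apply: smoothZ; apply: smoothD; last exact: smooth_cst.
apply: smoothM; first exact: smooth_cst.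
exact: smooth_coord.
Qed.

Lemma submersive_affW (w : affW n) (c : C) :
  submersive (fun p : X => (affW_act w p.1, p.2 + c) : X).
Proof.
have sm (v : affW n) (x : C) : smooth (fun p : X => (affW_act v p.1, p.2 + x) : X).
  apply: smooth_pair.
    exact: (smooth_comp (@smooth_fst _ _) (smooth_affW_act v)).
  by apply: smoothD; [apply: smooth_snd | apply: smooth_cst].
split; first exact/smooth_cont/sm.
move=> x; exists (fun p : X => (affW_act w^-1%g p.1, p.2 + - c) : X); split.
- exact/smooth_cont/sm.
- by case: x => z xi /=; rewrite -affW_actM mulVg affW_act1 addrK.
- by case=> z xi /=; rewrite -affW_actM mulgV affW_act1 subrK.
Qed.

Lemma smooth_affW (w : affW n) (c : C) :
  smooth (fun p : X => (affW_act w p.1, p.2 + c) : X).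
Proof.
apply: smooth_pair.
  exact: (smooth_comp (@smooth_fst _ _) (smooth_affW_act w)).
by apply: smoothD; [apply: smooth_snd | apply: smooth_cst].
Qed.

Section Coordinates.
Variables (a c : C).
Hypothesis a0 : a != 0.

Let last_coord (p : X) : C^o := a * p.2 + c.

Let smooth_last : smooth last_coord.
Proof.
by apply: smoothD; [apply: smoothM; [apply: smooth_cst|apply: smooth_snd]
  | apply: smooth_cst].
Qed.

Let smooth_affine (Y : normedModType C) (l : Y -> C^o) : smooth l ->
  smooth (fun y => (l y - c) / a : C^o).
Proof.
move=> sl; apply: smoothM; last exact: smooth_cst.
by apply: smoothD => //; exact: smooth_cst.
Qed.

Let smooth_line (Y : normedModType C) (l : Y -> C^o) (x : C) (e : 'rV[C^o]_n) :
  smooth l -> smooth (fun y => ((l y - x) : C) *: e).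
Proof.
by move=> sl; apply: smoothZ; apply: smoothD => //; exact: smooth_cst.
Qed.

Lemma smooth_coords1 (u : 'rV[C^o]_n -> C^o) : smooth u ->
  smooth (fun p : X => (u p.1, last_coord p) : C^o * C^o).
Proof.
move=> su; apply: smooth_pair => //.
exact: (smooth_comp (@smooth_fst _ _) su).
Qed.

(** Moving z along e changes u by a given amount and xi adjusts the last
    coordinate; this gives a section through every point. The next two lemmas are
    the same with more coordinates. *)
Lemma submersive_coords1 (u : 'rV[C^o]_n -> C^o) e : smooth u ->
  (forall z t, u (z + t *: e) = u z + t) ->
  submersive (fun p : X => (u p.1, last_coord p) : C^o * C^o).
Proof.
move=> su uE; split; first exact/smooth_cont/smooth_coords1.
case=> z xi; exists (fun y : C^o * C^o =>
  (z + ((y.1 - u z) : C) *: e, (y.2 - c) / a) : X); split.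
- apply: smooth_cont; apply: smooth_pair.
    apply: smoothD; first exact: smooth_cst.
    by apply: smooth_line; apply: smooth_fst.
  by apply: smooth_affine; apply: smooth_snd.
- by rewrite /last_coord /= subrr scale0r addr0 addrK mulrAC divff // mul1r.
- case=> y eta /=; rewrite /last_coord /= uE addrC subrK.
  by rewrite mulrCA divff // mulr1 subrK.
Qed.

Lemma submersive_coords2 (u v : 'rV[C^o]_n -> C^o) e f : smooth u -> smooth v ->
  (forall z t r, u (z + t *: e + r *: f) = u z + t) ->
  (forall z t r, v (z + t *: e + r *: f) = v z + r) ->
  submersive (fun p : X => (u p.1, v p.1, last_coord p) : C^o * C^o * C^o).
Proof.
move=> su sv uE vE; split.
  apply: smooth_cont; apply: smooth_pair => //; apply: smooth_pair.
    exact: (smooth_comp (@smooth_fst _ _) su).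
  exact: (smooth_comp (@smooth_fst _ _) sv).
case=> z xi; exists (fun y : C^o * C^o * C^o =>
  (z + ((y.1.1 - u z) : C) *: e + ((y.1.2 - v z) : C) *: f, (y.2 - c) / a) : X).
split.
- apply: smooth_cont; apply: smooth_pair.
    apply: smoothD.
      apply: smoothD; first exact: smooth_cst.
      apply: smooth_line.
      exact: (smooth_comp (@smooth_fst _ _) (@smooth_fst _ _)).
    apply: smooth_line; exact: (smooth_comp (@smooth_fst _ _) (@smooth_snd _ _)).
  by apply: smooth_affine; apply: smooth_snd.
- rewrite /last_coord /= !subrr !scale0r !addr0 addrK mulrAC divff //.
  by rewrite mul1r.
- case=> [[y1 y2] eta] /=; rewrite /last_coord /= uE vE ![_ + (_ - _)]addrC !subrK.
  by rewrite mulrCA divff // mulr1 subrK.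
Qed.

Lemma submersive_coords3 (u v w : 'rV[C^o]_n -> C^o) e f g :
  smooth u -> smooth v -> smooth w ->
  (forall z t r s, u (z + t *: e + r *: f + s *: g) = u z + t) ->
  (forall z t r s, v (z + t *: e + r *: f + s *: g) = v z + r) ->
  (forall z t r s, w (z + t *: e + r *: f + s *: g) = w z + s) ->
  submersive (fun p : X => (u p.1, v p.1, w p.1, last_coord p)
    : C^o * C^o * C^o * C^o).
Proof.
move=> su sv sw uE vE wE; split.
  apply: smooth_cont; apply: smooth_pair => //; apply: smooth_pair.
    apply: smooth_pair.
      exact: (smooth_comp (@smooth_fst _ _) su).
    exact: (smooth_comp (@smooth_fst _ _) sv).
  exact: (smooth_comp (@smooth_fst _ _) sw).
case=> z xi; exists (fun y : C^o * C^o * C^o * C^o =>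
  (z + ((y.1.1.1 - u z) : C) *: e + ((y.1.1.2 - v z) : C) *: f
   + ((y.1.2 - w z) : C) *: g, (y.2 - c) / a) : X).
have s11 : smooth (fun y : C^o * C^o * C^o * C^o => y.1.1).
  exact: (smooth_comp (@smooth_fst _ _) (@smooth_fst _ _)).
split.
- apply: smooth_cont; apply: smooth_pair.
    apply: smoothD; first (apply: smoothD; first (apply: smoothD; first exact: smooth_cst)).
    + by apply: smooth_line; exact: (smooth_comp s11 (@smooth_fst _ _)).
    + by apply: smooth_line; exact: (smooth_comp s11 (@smooth_snd _ _)).
    + by apply: smooth_line; exact: (smooth_comp (@smooth_fst _ _) (@smooth_snd _ _)).
  by apply: smooth_affine; apply: smooth_snd.
- rewrite /last_coord /= !subrr !scale0r !addr0 addrK mulrAC divff //.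
  by rewrite mul1r.
- case=> [[[y1 y2] y3] eta] /=.
  rewrite /last_coord /= uE vE wE ![_ + (_ - _)]addrC !subrK.
  by rewrite mulrCA divff // mulr1 subrK.
Qed.

End Coordinates.
End Submersions.

(** * Functions up to generic equality and their operators *)

Section Functions.
Variables (RR : realType) (d n : nat).
Notation C := RR[i].
Notation X := ('rV[C^o]_n * C^o)%type.
Notation tend := (tend RR d).
Notation fn := (X -> tvec RR d n).
Notation op_family := (op_family RR d n).

Definition gen_eq (F G : fn) : Prop := generically (fun x => F x = G x).

Lemma gen_eq_refl F : gen_eq F F.
Proof. exact: generically_all. Qed.

Lemma gen_eq_sym F G : gen_eq F G -> gen_eq G F.
Proof. exact: generically_mono. Qed.

Lemma gen_eq_trans F G H : gen_eq F G -> gen_eq G H -> gen_eq F H.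
Proof. by move=> a b; apply: generically_mono (genericallyI a b) => x [-> ->]. Qed.

(** The quotient of all functions by generic equality, as a type of equivalence
    classes. On it, identities of operators are equalities that can be used for
    rewriting. *)
Definition genfun : Type := {A : set fn | exists F, A = gen_eq F}.

Definition to_genfun (F : fn) : genfun := exist _ (gen_eq F) (ex_intro _ F erefl).

Definition repr (q : genfun) : fn := sval (cid (svalP q)).

Lemma reprK q : to_genfun (repr q) = q.
Proof.
rewrite /repr /to_genfun; case: cid => /= F FE; case: q FE => A pA /= AE.
by subst A; congr exist; apply: Prop_irrelevance.
Qed.

Lemma to_genfunP F G : to_genfun F = to_genfun G <-> gen_eq F G.
Proof.
split=> [[E]|E].
  by rewrite -/(gen_eq F G) E; apply: gen_eq_refl.
have S : gen_eq F = gen_eq G.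
  apply/funext => H; apply/propext; split.
    exact/gen_eq_trans/gen_eq_sym.
  exact: gen_eq_trans.
rewrite /to_genfun; move: (ex_intro _ F _) (ex_intro _ G _); rewrite S => p q.
by congr exist; apply: Prop_irrelevance.
Qed.

Definition compatible (P : fn -> fn) : Prop :=
  forall F G, gen_eq F G -> gen_eq (P F) (P G).

Definition descend (P : fn -> fn) (q : genfun) : genfun := to_genfun (P (repr q)).

Lemma descendE P F : compatible P -> descend P (to_genfun F) = to_genfun (P F).
Proof. by move=> cP; apply/to_genfunP/cP/to_genfunP/reprK. Qed.

Lemma compatible_comp P P' : compatible P -> compatible P' -> compatible (P \o P').
Proof. by move=> cP cP' F G FG; apply/cP/cP'. Qed.

Lemma descend_comp P P' q : compatible P ->
  descend P (descend P' q) = descend (P \o P') q.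
Proof. by move=> cP; rewrite [descend P' q]/descend descendE. Qed.

Lemma eq_descend P P' q : (forall F, gen_eq (P F) (P' F)) ->
  descend P q = descend P' q.
Proof. by move=> E; apply/to_genfunP/E. Qed.

Lemma descend_eqP P P' : compatible P -> compatible P' ->
  (forall q, descend P q = descend P' q) -> forall F, gen_eq (P F) (P' F).
Proof. by move=> cP cP' E F; apply/to_genfunP; rewrite -!descendE. Qed.

Lemma descend_id q : descend id q = q.
Proof. exact: reprK. Qed.

Definition mulX (A : X -> tend n) (F : fn) : fn := fun x => A x *m F x.

Lemma mulX_compatible A : compatible (mulX A).
Proof. by move=> F G; apply: generically_mono => x; rewrite /mulX => ->. Qed.

(** Here and below, an operator on the quotient is accessible only through its
    defining equation, so that comparing two of them never compares the underlying
    matrices. *)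
Fact mulQ_sealed : {P : (X -> tend n) -> genfun -> genfun |
  forall (A : X -> tend n),
    P A = descend (mulX A)}.
Proof. by eexists; intros; reflexivity. Qed.

Definition mulQ := sval mulQ_sealed.

Lemma mulQE (A : X -> tend n) : mulQ A = descend (mulX A).
Proof. by rewrite /mulQ; case: mulQ_sealed. Qed.

Lemma mulQM A B q : mulQ A (mulQ B q) = mulQ (fun x => A x *m B x) q.
Proof.
rewrite !mulQE descend_comp; last exact: mulX_compatible.
by congr (descend _ q); apply/funext => F; apply/funext => x; apply: mulmxA.
Qed.

Lemma mulQ1 q : mulQ (fun=> 1%:M) q = q.
Proof.
rewrite mulQE -[RHS]descend_id; apply: eq_descend => F; apply: generically_all => x.
exact: mul1mx.
Qed.

(** Constant functions with values in a basis detect all entries. *)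
Lemma mulQ_eqP A B : generically (fun x => A x = B x) <-> mulQ A =1 mulQ B.
Proof.
rewrite !mulQE; split=> [E q|E].
  apply: eq_descend => F; apply: generically_mono E => x AB.
  by rewrite /mulX AB.
have E' := descend_eqP (@mulX_compatible A) (@mulX_compatible B) E.
have : generically (fun x => forall b, A x *m delta_mx b 0 = B x *m delta_mx b (0 : 'I_1)).
  by apply: generically_forall => b; apply: (E' (fun=> delta_mx b 0)).
apply: generically_mono => x ABx; apply/matrixP => i j.
have := congr1 (fun M : 'cV[C]_ _ => M i 0) (ABx j).
by rewrite -!colE !mxE.
Qed.

Lemma eq_mulQ A B q : A =1 B -> mulQ A q = mulQ B q.
Proof. by move=> E; congr (mulQ _ q); apply/funext. Qed.

Definition transX (w : affW n) (c : C) (F : fn) : fn :=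
  fun x => F (affW_act w x.1, x.2 + c).

Lemma transX_compatible w c : compatible (transX w c).
Proof.
move=> F G FG; rewrite /gen_eq /transX.
exact/(@generically_submersive _ _ (fun x : X => (affW_act w x.1, x.2 + c) : X)
  (fun x => F x = G x) 0 (submersive_affW w c)).
Qed.

Lemma generically_trans (P : X -> Prop) w c : generically P ->
  generically (fun x : X => P (affW_act w x.1, x.2 + c)).
Proof.
exact: (proj1 (@generically_submersive _ _
  (fun x : X => (affW_act w x.1, x.2 + c) : X) P 0 (submersive_affW w c))).
Qed.

Lemma generically_shift (P : X -> Prop) c : generically P ->
  generically (fun x : X => P (x.1, x.2 + c)).
Proof.
by move=> /(@generically_trans _ 1%g c); apply: generically_mono => x;
  rewrite affW_act1.
Qed.

Fact pullQ_sealed : {P : affW n -> genfun -> genfun |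
  forall (w : affW n),
    P w = descend (transX w^-1%g 0)}.
Proof. by eexists; intros; reflexivity. Qed.

Definition pullQ := sval pullQ_sealed.

Lemma pullQE (w : affW n) : pullQ w = descend (transX w^-1%g 0).
Proof. by rewrite /pullQ; case: pullQ_sealed. Qed.

Lemma pullQM u v q : pullQ u (pullQ v q) = pullQ (u * v)%g q.
Proof.
rewrite !pullQE descend_comp; last exact: transX_compatible.
apply: eq_descend => F; apply: generically_all => x; rewrite /transX /= !addr0.
by rewrite invMg affW_actM.
Qed.

Lemma pullQ1 q : pullQ 1%g q = q.
Proof.
rewrite pullQE -[RHS]descend_id; apply: eq_descend => F.
apply: generically_all => -[z xi].
by rewrite /transX invg1 affW_act1 addr0.
Qed.

Lemma pullQ_mulQ w A q :
  pullQ w (mulQ A q) = mulQ (fun x => A (affW_act w^-1%g x.1, x.2)) (pullQ w q).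
Proof.
rewrite !pullQE !mulQE !descend_comp; try exact: transX_compatible;
  try exact: mulX_compatible.
by apply: eq_descend => F; apply: generically_all => x; rewrite /transX /mulX /= addr0.
Qed.

(** The operators M(z) applied fibrewise to a function of (z, xi). *)
Definition familyX (M : op_family) (F : fn) : fn :=
  fun x => M x.1 (fun xi => F (x.1, xi)) x.2.

Definition difference_op (M : op_family) : Prop :=
  exists (m : nat) (beta : 'I_m -> C) (A : 'I_m -> 'rV[C]_n -> C -> tend n),
    forall z f xi, M z f xi = \sum_(j < m) A j z xi *m f (xi + beta j).

Lemma mero_difference_op M : meromorphic_difference_op M -> difference_op M.
Proof. by case=> m [beta [A [_ ME]]]; exists m, beta, A. Qed.

Lemma familyX_compatible M : difference_op M -> compatible (familyX M).
Proof.
move=> [m [beta [A ME]]] F G FG.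
have : generically (fun x : X => forall j, F (x.1, x.2 + beta j) = G (x.1, x.2 + beta j)).
  by apply: generically_forall => j; exact: generically_shift FG.
by apply: generically_mono => x E; rewrite /familyX !ME; apply: eq_bigr => j _; rewrite E.
Qed.

Fact familyQ_sealed : {P : op_family -> genfun -> genfun |
  forall (M : op_family),
    P M = descend (familyX M)}.
Proof. by eexists; intros; reflexivity. Qed.

Definition familyQ := sval familyQ_sealed.

Lemma familyQE (M : op_family) : familyQ M = descend (familyX M).
Proof. by rewrite /familyQ; case: familyQ_sealed. Qed.

(** The right-hand side of the cocycle condition is the composition of the
    actions M u after translation by u, followed by translation back. *)
Lemma familyQ_comp M M' u q : difference_op M -> difference_op M' ->
  familyQ (fun z f => M z (M' (affW_act u^-1%g z) f)) q =
  familyQ M (pullQ u (familyQ M' (pullQ u^-1%g q))).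
Proof.
move=> dM dM'; have [cM cM'] := (familyX_compatible dM, familyX_compatible dM').
have ct := transX_compatible.
rewrite !familyQE !pullQE !descend_comp //; try by do ?apply: compatible_comp.
apply: eq_descend => F; apply: generically_all => x.
rewrite /familyX /transX /= invgK; congr (M _ _ _); apply/funext => xi.
rewrite addr0; congr (M' _ _ _); apply/funext => eta.
by rewrite -affW_actM mulgV affW_act1 addr0.
Qed.

(** Repetitions in xs are harmless, because g is a function. *)
Lemma interpolation (K : fieldType) (xs : seq K) (g : K -> K) :
  exists p : {poly K}, (size p <= size xs)%N /\ {in xs, forall x, p.[x] = g x}.
Proof.
elim: xs => [|x xs [p [sp pE]]]; first by exists 0; rewrite size_poly0.
have [xin|xnin] := boolP (x \in xs).
  exists p; split; first exact: ltnW.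
  by move=> y; rewrite inE => /orP[/eqP ->|]; exact: pE.
pose w : {poly K} := \prod_(y <- xs) ('X - y%:P).
have wx : w.[x] != 0 by rewrite -[_ == 0]/(root w x) root_prod_XsubC.
exists (p + ((g x - p.[x]) / w.[x]) *: w); split.
  apply: leq_trans (size_polyD _ _) _; rewrite geq_max (ltnW _) //=.
  by apply: leq_trans (size_scale_leq _ _) _; rewrite size_prod_XsubC.
move=> y; rewrite inE hornerD hornerZ => /orP[/eqP ->|yin].
  by rewrite divfK // addrC subrK.
have /eqP -> : w.[y] == 0 by rewrite -[_ == 0]/(root w y) root_prod_XsubC.
by rewrite mulr0 addr0 pE.
Qed.

Definition monomial (k : nat) (b : 'I_#|tidx d n|) : C -> tvec RR d n :=
  fun xi => xi ^+ k *: delta_mx b 0.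

Lemma monomial_mero k b : meromorphic_mx (monomial k b : C^o -> tvec RR d n).
Proof.
move=> i j; apply: meromorphic_holomorphic => x _.
have sX : smooth (fun y : C^o => (y : C) ^+ k : C^o).
  elim: k => [|k IH].
    have -> : (fun y : C^o => (y : C) ^+ 0 : C^o) = fun=> 1 by [].
    exact: smooth_cst.
  have -> : (fun y : C^o => (y : C) ^+ k.+1 : C^o) = fun y => y * (y : C) ^+ k : C^o.
    by apply/funext => y; rewrite exprS.
  by apply: smoothM => //; exact: smooth_id.
have -> : (fun y : C^o => monomial k b y i j : C^o) =
    fun y => ((y : C) ^+ k : C^o) * (delta_mx b 0 i j : C^o) :> C^o.
  by apply/funext => y; rewrite /monomial [LHS]mxE.
by apply: smoothM => //; exact: smooth_cst.
Qed.

Lemma difference_op_monomials M m beta (A : 'I_m -> 'rV[C]_n -> C -> tend n) N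
    (co : 'I_N -> 'I_#|tidx d n| -> C) z f xi :
  (forall z f xi, M z f xi = \sum_(j < m) A j z xi *m f (xi + beta j)) ->
  (forall j, f (xi + beta j) = \sum_k \sum_b co k b *: monomial k b (xi + beta j)) ->
  M z f xi = \sum_k \sum_b co k b *: M z (monomial k b) xi.
Proof.
move=> ME fE; rewrite ME; under eq_bigr => j _ do rewrite fE mulmx_sumr.
rewrite exchange_big /=; apply: eq_bigr => k _.
under eq_bigr => j _ do rewrite mulmx_sumr.
rewrite exchange_big /=; apply: eq_bigr => b _; rewrite ME scaler_sumr.
by apply: eq_bigr => j _; rewrite scalemxAr.
Qed.

(** At a given point a difference operator sees only finitely many values of its
    argument, and these are interpolated by a polynomial. So two difference
    operators that agree on polynomials in xi agree on all functions of (z, xi). *)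
Lemma op_family_eqP M M' : difference_op M -> difference_op M' ->
  op_family_eq M M' <-> familyQ M =1 familyQ M'.
Proof.
move=> dM dM'; rewrite !familyQE; split=> [E q|E]; last first.
  move=> f _; exact: (descend_eqP (familyX_compatible dM)
    (familyX_compatible dM') E (fun x => f x.2)).
apply: eq_descend => F.
have [m [beta [A ME]]] := dM; have [m' [beta' [A' ME']]] := dM'.
(* The arguments at which M and M' evaluate a function at the point xi. *)
pose pts xi := codom (fun j => xi + beta j) ++ codom (fun j => xi + beta' j).
have : generically (fun x : X => forall kb : 'I_(m + m') * 'I_#|tidx d n|,
    M x.1 (monomial kb.1 kb.2) x.2 = M' x.1 (monomial kb.1 kb.2) x.2).
  by apply: generically_forall => kb; apply: E; apply: monomial_mero.
apply: generically_mono => -[z xi] Hx /=; rewrite /familyX /=.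
have ex b : exists q : {poly C}, (size q <= m + m')%N /\
    {in pts xi, forall y, q.[y] = F (z, y) b 0}.
  have [r [sr rE]] := interpolation (pts xi) (fun y => F (z, y) b 0).
  exists r; split=> //; apply: leq_trans sr _.
  by rewrite size_cat !size_codom !card_ord.
have [p pP] := boolp.choice ex.
have FE y : y \in pts xi ->
    F (z, y) = \sum_(k < m + m') \sum_b (p b)`_k *: monomial k b y.
  move=> yin; apply/matrixP => b o; rewrite ord1 exchange_big /= summxE.
  have [sp /(_ y yin) <-] := pP b; rewrite (horner_coef_wide _ sp).
  rewrite (bigD1 b) //= summxE [X in _ + X]big1 ?addr0 => [|b' bb'].
    by apply: eq_bigr => k _; rewrite !mxE !eqxx mulr1.
  rewrite summxE big1 // => k _; rewrite !mxE eq_sym (negPf bb') !mulr0 //.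
rewrite (difference_op_monomials (co := fun (k : 'I_(m + m')) b => (p b)`_k) _ ME).
  rewrite (difference_op_monomials (co := fun (k : 'I_(m + m')) b => (p b)`_k) _ ME').
    by apply: eq_bigr => k _; apply: eq_bigr => b _; rewrite (Hx (k, b)).
  by move=> j; apply: FE; rewrite mem_cat (codom_f (fun j => xi + beta' j)) orbT.
by move=> j; apply: FE; rewrite mem_cat (codom_f (fun j => xi + beta j)).
Qed.

End Functions.

(** * Shift and flip operators *)

Section Operators.
Variables (RR : realType) (d : nat) (h : 'M[RR[i]]_d).
Hypothesis hss : diagonalizable h.
Notation C := RR[i].
Variable n : nat.
Notation X := ('rV[C^o]_n * C^o)%type.
Notation tend := (tend RR d).
Notation fn := (X -> tvec RR d n).
Notation genfun := (genfun RR d n).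
Notation weight := (weight h).
Notation wp := (weight_proj).

Definition shiftX (c : 'I_n -> C) (F : fn) : fn :=
  fun x => \sum_(mu : weight n) wp mu *m F (x.1, x.2 + wt c mu).

Lemma shiftX_compatible c : compatible (shiftX c).
Proof.
move=> F G FG.
have : generically (fun x : X => forall mu : weight n,
    F (x.1, x.2 + wt c mu) = G (x.1, x.2 + wt c mu)).
  by apply: generically_forall => mu; exact: generically_shift FG.
by apply: generically_mono => x E; apply: eq_bigr => mu _; rewrite E.
Qed.

Fact shiftQ_sealed : {P : ('I_n -> C) -> genfun -> genfun |
  forall (c : 'I_n -> C),
    P c = descend (shiftX c)}.
Proof. by eexists; intros; reflexivity. Qed.

Definition shiftQ := sval shiftQ_sealed.

Lemma shiftQE (c : 'I_n -> C) : shiftQ c = descend (shiftX c).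
Proof. by rewrite /shiftQ; case: shiftQ_sealed. Qed.

Lemma shiftQ_ext c c' q : c =1 c' -> shiftQ c q = shiftQ c' q.
Proof. by move=> E; congr (shiftQ _ q); apply/funext. Qed.

Lemma sum_wp (F : weight n -> tvec RR d n) nu :
  wp nu *m (\sum_mu wp mu *m F mu) = wp nu *m F nu.
Proof.
rewrite mulmx_sumr (bigD1 nu) //= mulmxA weight_proj_mul // eqxx.
rewrite [X in _ + X]big1 ?addr0 // => mu ne.
by rewrite mulmxA weight_proj_mul // eq_sym (negPf ne) mul0mx.
Qed.

Lemma shiftQD c c' q : shiftQ c (shiftQ c' q) = shiftQ (fun i => c i + c' i) q.
Proof.
rewrite !shiftQE descend_comp; last exact: shiftX_compatible.
apply: eq_descend => F; apply: generically_all => x; rewrite /shiftX /=.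
apply: eq_bigr => mu _.
by rewrite (sum_wp (fun nu => F (x.1, x.2 + wt c mu + wt c' nu))) wtD addrA.
Qed.

Lemma shiftQ0 q : shiftQ (fun=> 0) q = q.
Proof.
rewrite shiftQE -[RHS]descend_id; apply: eq_descend => F.
apply: generically_all => -[z xi]; rewrite /shiftX /=; under eq_bigr => mu _ do rewrite wt0 addr0.
by rewrite -mulmx_suml weight_proj_sum // mul1mx.
Qed.

Lemma shiftQK c c' q : (forall i, c i + c' i = 0) -> shiftQ c (shiftQ c' q) = q.
Proof. by move=> E; rewrite shiftQD (shiftQ_ext q E) shiftQ0. Qed.

Lemma shiftQC c c' q : shiftQ c (shiftQ c' q) = shiftQ c' (shiftQ c q).
Proof. by rewrite !shiftQD; apply: shiftQ_ext => i; rewrite addrC. Qed.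

Lemma shiftQ_pullQ c w q : shiftQ c (pullQ w q) = pullQ w (shiftQ c q).
Proof.
rewrite !shiftQE !pullQE !descend_comp; try exact: shiftX_compatible;
  try exact: transX_compatible.
apply: eq_descend => F; apply: generically_all => x.
by rewrite /shiftX /transX /=; apply: eq_bigr => mu _; rewrite !addr0.
Qed.

Definition dynX (c : 'I_n -> C) (S : X -> tend n) (x : X) : tend n :=
  dyn_shift h (fun eta => S (x.1, eta)) c x.2.

(** Conjugation by T_c turns S(xi) into S(xi + c.h). On the weight space of mu the
    left-hand side evaluates S at xi + c.mu for the weight mu of the value of S,
    the right-hand side for the weight of its argument; the hypothesis makes the
    two agree. *)
Lemma shiftQ_mulQ c S q : generically (fun x => preserves h c (S x)) ->
  shiftQ c (mulQ S q) = mulQ (dynX c S) (shiftQ c q).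
Proof.
move=> pS; rewrite !shiftQE !mulQE !descend_comp; try exact: shiftX_compatible;
  try exact: mulX_compatible.
apply: eq_descend => F.
have : generically (fun x : X => forall mu : weight n,
    preserves h c (S (x.1, x.2 + wt c mu))).
  by apply: generically_forall => mu; exact: generically_shift pS.
apply: generically_mono => x px; rewrite /shiftX /mulX /dynX /=.
transitivity (\sum_(mu : weight n) \sum_(nu : weight n)
    wp mu *m S (x.1, x.2 + wt c nu) *m wp nu *m F (x.1, x.2 + wt c nu)).
  apply: eq_bigr => mu _.
  rewrite -[F (x.1, x.2 + wt c mu)]mul1mx -(weight_proj_sum hss).
  rewrite mulmx_suml !mulmx_sumr; apply: eq_bigr => nu _; rewrite !mulmxA.
  have [-> //|ne] := pselect (wt c mu = wt c nu).
  by rewrite !(preserves_block hss (px _) ne) !mul0mx.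
rewrite exchange_big /= mulmx_sumr; apply: eq_bigr => nu _.
rewrite [RHS]mulmxA dyn_shift_proj // -!mulmx_suml.
by rewrite weight_proj_sum // mul1mx.
Qed.

Lemma shiftQ_conj c c' S q : generically (fun x => preserves h c (S x)) ->
  (forall i, c i + c' i = 0) ->
  shiftQ c (mulQ S (shiftQ c' q)) = mulQ (dynX c S) q.
Proof. by move=> pS cc'; rewrite shiftQ_mulQ // shiftQK. Qed.

Fact flipQ_sealed : {P : 'I_n -> 'I_n -> genfun -> genfun |
  forall (i j : 'I_n),
    P i j = mulQ (fun=> leg2 (flip RR d) i j)}.
Proof. by eexists; intros; reflexivity. Qed.

Definition flipQ := sval flipQ_sealed.

Lemma flipQE (i j : 'I_n) : flipQ i j = mulQ (fun=> leg2 (flip RR d) i j).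
Proof. by rewrite /flipQ; case: flipQ_sealed. Qed.

Lemma flipQK i j q : i != j -> flipQ i j (flipQ i j q) = q.
Proof.
move=> ij; rewrite !flipQE mulQM -[RHS]mulQ1; apply: eq_mulQ => x.
exact: leg2_flipK.
Qed.

Lemma flipQ_emb m (phi : 'I_m -> 'I_n) (B : X -> tend m) i j q : i != j ->
  flipQ i j (mulQ (fun x => emb phi (B x)) q) =
  mulQ (fun x => emb (tperm i j \o phi) (B x)) (flipQ i j q).
Proof.
by move=> ij; rewrite !flipQE !mulQM; apply: eq_mulQ => x; exact: leg2_flip_conj.
Qed.

Definition tperm_weight i j (mu : weight n) : weight n :=
  restr_weight (tperm i j) mu.

Lemma tperm_weightK i j : involutive (tperm_weight i j).
Proof. by move=> mu; apply/ffunP => k; rewrite !ffunE tpermK. Qed.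

(** Conjugating with the flip is the embedding along the transposition, for which
    [emb_weight_proj] computes the image of a weight projection. *)
Lemma flip_weight_proj i j (mu : weight n) : i != j ->
  leg2 (flip RR d) i j *m wp mu = wp (tperm_weight i j mu) *m leg2 (flip RR d) i j.
Proof.
move=> ij; have emb_id : emb id (wp mu) = wp mu :> tend n.
  rewrite /wp emb_tensor //; apply: eq_tensor_op => k.
  by rewrite (extend_phi (phi := id)).
rewrite -{1}emb_id leg2_flip_conj //; congr (_ *m _).
apply: (eq_on_weights hss) => nu; rewrite emb_weight_proj //=; last exact: perm_inj.
rewrite weight_proj_mul // (inv_eq (tperm_weightK i j)).
by rewrite -/(tperm_weight i j nu); case: eqP => // ->; rewrite tperm_weightK.
Qed.

Lemma flipQ_shiftQ c i j q : i != j -> flipQ i j (shiftQ c q) = shiftQ (c \o tperm i j) (flipQ i j q).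
Proof.
move=> ij; rewrite !flipQE !shiftQE !mulQE !descend_comp; try exact: shiftX_compatible;
  try exact: mulX_compatible.
apply: eq_descend => F; apply: generically_all => x; rewrite /shiftX /mulX /=.
rewrite mulmx_sumr [RHS](reindex_inj (inv_inj (tperm_weightK i j))) /=.
apply: eq_bigr => mu _; rewrite mulmxA flip_weight_proj // -mulmxA.
congr (_ *m (_ *m F (_, _ + _))).
rewrite /wt (reindex_inj (@perm_inj _ (tperm i j))) /=.
by apply: eq_bigr => k _; rewrite ffunE.
Qed.

(** T_(x h_i). *)
Definition legT (x : C) (i : 'I_n) : genfun -> genfun := shiftQ (single_shift x i).

Lemma legTK x i q : legT x i (legT (- x) i q) = q.
Proof.
by apply: shiftQK => k; rewrite /single_shift; case: ifP; rewrite ?subrr ?addr0.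
Qed.

Lemma legTNK x i q : legT (- x) i (legT x i q) = q.
Proof. by rewrite -{2}[x]opprK legTK. Qed.

Lemma flipQ_legT x i j k q : i != j -> flipQ i j (legT x k q) = legT x (tperm i j k) (flipQ i j q).
Proof.
move=> ij; rewrite /legT flipQ_shiftQ //; apply: shiftQ_ext => l; rewrite /single_shift /=.
by rewrite -(inj_eq (@perm_inj _ (tperm i j))) tpermK.
Qed.

Section Matrices.
Variables (R : C -> C -> tend 2).

(** R with spectral parameter u(z), without dynamical shift; the variable xi enters
    as 2 xi. *)
Fact R_op_sealed : {P : 'I_n -> 'I_n -> ('rV[C]_n -> C) -> genfun -> genfun |
  forall (i j : 'I_n) (u : 'rV[C]_n -> C),
    P i j u = mulQ (fun x : X => leg2 (R (u x.1) (2 * x.2)) i j)}.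
Proof. by eexists; intros; reflexivity. Qed.

Definition R_op := sval R_op_sealed.

Lemma R_opE (i j : 'I_n) (u : 'rV[C]_n -> C) :
  R_op i j u = mulQ (fun x : X => leg2 (R (u x.1) (2 * x.2)) i j).
Proof. by rewrite /R_op; case: R_op_sealed. Qed.

Fact K_op_sealed : {P : (C -> C -> 'M[C]_d) -> 'I_n -> ('rV[C]_n -> C) -> genfun -> genfun |
  forall (K : C -> C -> 'M[C]_d) (i : 'I_n) (u : 'rV[C]_n -> C),
    P K i u = mulQ (fun x : X => leg1 (K (u x.1) x.2) i)}.
Proof. by eexists; intros; reflexivity. Qed.

Definition K_op := sval K_op_sealed.

Lemma K_opE (K : C -> C -> 'M[C]_d) (i : 'I_n) (u : 'rV[C]_n -> C) :
  K_op K i u = mulQ (fun x : X => leg1 (K (u x.1) x.2) i).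
Proof. by rewrite /K_op; case: K_op_sealed. Qed.

Lemma flipQ_R_op i j k l u q : i != j ->
  flipQ i j (R_op k l u q) = R_op (tperm i j k) (tperm i j l) u (flipQ i j q).
Proof.
move=> ij; rewrite !R_opE.
rewrite (@eq_mulQ _ _ _ _ (fun x : X => emb (pair_leg k l) (R (u x.1) (2 * x.2)))).
  rewrite flipQ_emb //; apply: eq_mulQ => x; rewrite leg2E; congr emb.
  by apply/funext => a; rewrite /pair_leg /=; case: ifP.
by move=> x; rewrite leg2E.
Qed.

Lemma flipQ_K_op K i j k u q : i != j ->
  flipQ i j (K_op K k u q) = K_op K (tperm i j k) u (flipQ i j q).
Proof.
move=> ij; rewrite !K_opE.
rewrite (@eq_mulQ _ _ _ _ (fun x : X =>
    emb (fun _ : 'I_1 => k) (leg1 (K (u x.1) x.2) ord0))).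
  by rewrite flipQ_emb //; apply: eq_mulQ => x; rewrite [RHS]leg1E.
by move=> x; rewrite [LHS]leg1E.
Qed.

Lemma pullQ_R_op w i j u q :
  pullQ w (R_op i j u q) = R_op i j (fun z => u (affW_act w^-1%g z)) (pullQ w q).
Proof. by rewrite !R_opE; exact: pullQ_mulQ. Qed.

Lemma pullQ_K_op K w i u q :
  pullQ w (K_op K i u q) = K_op K i (fun z => u (affW_act w^-1%g z)) (pullQ w q).
Proof. by rewrite !K_opE; exact: pullQ_mulQ. Qed.

Lemma pullQ_flipQ w i j q : pullQ w (flipQ i j q) = flipQ i j (pullQ w q).
Proof. by rewrite !flipQE; exact: pullQ_mulQ. Qed.

Lemma eq_R_op i j u u' q : u =1 u' -> R_op i j u q = R_op i j u' q.
Proof. by move=> E; rewrite !R_opE; apply: eq_mulQ => x; rewrite E. Qed.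

Lemma eq_K_op K i u u' q : u =1 u' -> K_op K i u q = K_op K i u' q.
Proof. by move=> E; rewrite !K_opE; apply: eq_mulQ => x; rewrite E. Qed.

End Matrices.
End Operators.

(** * The prescribed operators as conjugates of multiplications *)

Section Families.
Variables (RR : realType) (d : nat) (h : 'M[RR[i]]_d).
Hypothesis hss : diagonalizable h.
Notation C := RR[i].
Variable n : nat.
Notation X := ('rV[C^o]_n * C^o)%type.
Notation tend := (tend RR d).
Notation op_family := (op_family RR d n).
Notation genfun := (genfun RR d n).
Notation weight := (weight h).
Notation wp := (weight_proj).
Variables (kappa : C) (R : C -> C -> tend 2) (K Kl : C -> C -> 'M[C]_d).

Lemma familyQ_affine i (q : genfun) : familyQ (op_affine kappa h Kl i) q =
  legT h (- kappa) i (K_op Kl i (fun z => 2^-1 - z 0 i) (legT h kappa i q)).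
Proof.
rewrite familyQE /legT !shiftQE !K_opE !mulQE !descend_comp; try exact: mulX_compatible;
  try exact: shiftX_compatible; last first.
  by apply: compatible_comp; [exact: shiftX_compatible | exact: mulX_compatible].
have wtE x mu : wt (single_shift x i) mu = x * val (mu i) :> C.
  rewrite /wt (bigD1 i) //= /single_shift eqxx big1 ?addr0 // => k /negPf ->.
  by rewrite mul0r.
apply: eq_descend => F; apply: generically_all => x.
rewrite /familyX /op_affine /shift_op /mult_op /shiftX /mulX /=.
by apply: eq_bigr => mu _; rewrite wtE; congr (_ *m (_ *m _));
  apply: eq_bigr => nu _; rewrite wtE.
Qed.

Lemma familyQ_mult (A : 'rV[C]_n -> C -> tend n) (q : genfun) :
  familyQ (fun z => mult_op (A z)) q = mulQ (fun x => A x.1 x.2) q.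
Proof.
rewrite familyQE mulQE.
by apply: eq_descend => F; apply: generically_all => -[z xi].
Qed.

Lemma initial_shiftK (c : C) i (k : 'I_n) :
  initial_shift (- c) i k + initial_shift c i k = 0.
Proof. by rewrite /initial_shift; case: ifP; rewrite ?addNr ?addr0. Qed.

Lemma initial_shiftKr (c : C) i (k : 'I_n) :
  initial_shift c i k + initial_shift (- c) i k = 0.
Proof. by rewrite addrC initial_shiftK. Qed.

(** Since P R acts on the legs i and j, the dynamical shift by the weights of the
    earlier legs is a conjugation. *)
Lemma familyQ_swap (i j : 'I_n) (q : genfun) : (i < j)%N ->
  familyQ (op_swap kappa h R i j) q =
  shiftQ h (initial_shift (- kappa) i) (flipQ i j (R_op R i j (fun z => z 0 i - z 0 j)
    (shiftQ h (initial_shift kappa i) q))).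
Proof.
move=> ij; have ne : i != j by rewrite -val_eqE neq_ltn ij.
have ii c : initial_shift c i i = 0 :> C by rewrite /initial_shift ltnn.
have ji c : initial_shift c i j = 0 :> C by rewrite /initial_shift ltnNge ltnW.
have pR x B : preserves h (initial_shift x i) (leg2 B i j).
  by apply: preserves_leg2; rewrite ?ii ?ji //; left.
rewrite /op_swap familyQ_mult !flipQE !R_opE mulQM shiftQ_conj //; last 2 first.
- by apply: generically_all => x; apply: preserves_mul; exact: pR.
- exact: initial_shiftK.
apply: eq_mulQ => x; rewrite /dynX dyn_shift_mul // dyn_shift_const //.
congr (_ *m _); apply/esym; etransitivity.
  exact: (dyn_shift_scale hss (fun eta => leg2 (R (x.1 0 i - x.1 0 j) eta) i j)).
apply: eq_dyn_shift => // k; rewrite /initial_shift; case: ifP; rewrite ?mulr0 //.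
by rewrite mulrN.
Qed.

Lemma familyQ_sign i (q : genfun) : familyQ (op_sign kappa h K i) q =
  shiftQ h (initial_shift (- kappa) i) (K_op K i (fun z => z 0 i)
    (shiftQ h (initial_shift kappa i) q)).
Proof.
rewrite /op_sign familyQ_mult !K_opE shiftQ_conj //; last exact: initial_shiftK.
apply: generically_all => x; apply: preserves_leg1.
by rewrite /initial_shift ltnn.
Qed.

Lemma mero_difference_fin (J : finType) (beta : J -> C)
    (A : J -> 'rV[C]_n -> C -> tend n) (M : op_family) :
  (forall j, meromorphic_mx (fun p : X => A j p.1 p.2)) ->
  (forall z f xi, M z f xi = \sum_j A j z xi *m f (xi + beta j)) ->
  meromorphic_difference_op M.
Proof.
move=> mA ME; exists #|J|, (beta \o enum_val), (fun k => A (enum_val k)); split.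
  by move=> k; apply: mA.
move=> z f xi; rewrite ME (reindex (@enum_val J predT)) //.
by exists enum_rank => j _; rewrite ?enum_valK ?enum_rankK.
Qed.

Lemma mero_difference_id : meromorphic_difference_op ((fun=> id) : op_family).
Proof.
apply: (@mero_difference_fin unit (fun=> 0) (fun _ _ _ => 1%:M)).
  by move=> _; exact: meromorphic_mx_cst.
by move=> z f xi; rewrite big_const card_unit /= !addr0 mul1mx.
Qed.

Lemma mero_difference_comp (M M' : op_family) (u : affW n) :
  meromorphic_difference_op M -> meromorphic_difference_op M' ->
  meromorphic_difference_op (fun z f => M z (M' (affW_act u z) f)).
Proof.
move=> [m [beta [A [mA ME]]]] [m' [beta' [A' [mA' ME']]]].
apply: (@mero_difference_fin ('I_m * 'I_m')%type
  (fun j => beta j.1 + beta' j.2)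
  (fun j z xi => A j.1 z xi *m A' j.2 (affW_act u z) (xi + beta j.1))).
  move=> j; apply: meromorphic_mx_mul => //.
  exact: (meromorphic_mx_comp (submersive_affW u (beta j.1))
    (smooth_affW u (beta j.1)) (mA' j.2)).
move=> z f xi; rewrite ME -(pair_bigA _ (fun j k =>
  A j z xi *m A' k (affW_act u z) (xi + beta j) *m f (xi + (beta j + beta' k)))) /=.
apply: eq_bigr => j _; rewrite ME' mulmx_sumr; apply: eq_bigr => k _.
by rewrite mulmxA addrA.
Qed.

Lemma mero_difference_mult (A : 'rV[C]_n -> C -> tend n) :
  meromorphic_mx (fun p : X => A p.1 p.2) ->
  meromorphic_difference_op (fun z => mult_op (A z)).
Proof.
move=> mA; apply: (@mero_difference_fin unit (fun=> 0) (fun _ => A)) => //.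
by move=> z f xi; rewrite big_const card_unit /= !addr0.
Qed.

Lemma mero_leg2 (Y : normedModType C) (B : Y -> tend 2) (i j : 'I_n) :
  meromorphic_mx B -> meromorphic_mx (fun y => leg2 (B y) i j).
Proof.
move=> mB a b; set e := fun y => _.
have -> : e = fun y => B y (enum_rank (pair_idx (idx_of a i) (idx_of a j)))
    (enum_rank (pair_idx (idx_of b i) (idx_of b j))) *
    [forall k, (k != i) && (k != j) ==> (idx_of a k == idx_of b k)]%:R.
  by apply/funext => y; rewrite /e mxE.
by apply: meromorphicM; [exact: mB | exact: meromorphic_cst].
Qed.

Lemma mero_leg1 (Y : normedModType C) (B : Y -> 'M[C]_d) (i : 'I_n) :
  meromorphic_mx B -> meromorphic_mx (fun y => leg1 (B y) i).
Proof.
move=> mB a b; set e := fun y => _.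
have -> : e = fun y => B y (idx_of a i) (idx_of b i) *
    \prod_(k | k != i) (1%:M : 'M[C]_d) (idx_of a k) (idx_of b k).
  apply/funext => y; rewrite /e mxE (bigD1 i) //= eqxx; congr (_ * _).
  by apply: eq_bigr => k /negPf ->.
by apply: meromorphicM; [exact: mB | exact: meromorphic_cst].
Qed.

(** The spectral parameter depends on z through u and can be moved freely along
    e. *)
Lemma mero_pull1 p r (B : C -> C -> 'M[C]_(p, r)) (u : 'rV[C^o]_n -> C^o)
    (e : 'rV[C^o]_n) (a c : C) :
  meromorphic_mx (fun p : C^o * C^o => B p.1 p.2) -> a != 0 -> smooth u ->
  (forall z t, u (z + t *: e) = u z + t) ->
  meromorphic_mx (fun p : X => B (u p.1) (a * p.2 + c)).
Proof.
move=> mB a0 su uE.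
exact: (meromorphic_mx_comp (@submersive_coords1 _ _ a c a0 u e su uE)
  (@smooth_coords1 _ _ a c u su) mB).
Qed.

Lemma line_coord (z : 'rV[C]_n) (i k : 'I_n) (t : C) :
  (z + t *: delta_mx 0 i) 0 k = z 0 k + (if k == i then t else 0).
Proof. by rewrite !mxE; case: ifP; rewrite ?mulr1 ?mulr0. Qed.

Lemma mero_op_swap (i j : 'I_n) :
  meromorphic_mx (fun p : C^o * C^o => R p.1 p.2) -> i != j ->
  meromorphic_difference_op (op_swap kappa h R i j).
Proof.
move=> mR ij; apply: mero_difference_mult.
apply: meromorphic_mx_mul; first exact: meromorphic_mx_cst.
apply: meromorphic_mx_sum => mu.
apply: meromorphic_mx_mul; last exact: meromorphic_mx_cst.
apply: mero_leg2.
apply: (@mero_pull1 _ _ R (fun z => z 0 i - z 0 j) (delta_mx 0 i)) => //.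
- by rewrite pnatr_eq0.
- by apply: smoothD; [exact: smooth_coord | apply/smoothN/smooth_coord].
- move=> z t; rewrite !line_coord eqxx.
  by rewrite eq_sym (negPf ij) addr0 addrAC.
Qed.

Lemma mero_op_sign (i : 'I_n) :
  meromorphic_mx (fun p : C^o * C^o => K p.1 p.2) ->
  meromorphic_difference_op (op_sign kappa h K i).
Proof.
move=> mK; apply: mero_difference_mult; apply: meromorphic_mx_sum => mu.
apply: meromorphic_mx_mul; last exact: meromorphic_mx_cst.
apply: mero_leg1; set c := \sum_i _.
have := @mero_pull1 _ _ K (fun z => z 0 i) (delta_mx 0 i) 1 c mK (oner_neq0 _).
have -> : (fun p : X => K (p.1 0 i) (1 * p.2 + c)) =
    (fun p : X => K (p.1 0 i) (p.2 + c)).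
  by apply/funext => p; rewrite mul1r.
apply; first exact: smooth_coord.
by move=> z t; rewrite line_coord eqxx.
Qed.

Lemma mero_op_affine (i : 'I_n) :
  meromorphic_mx (fun p : C^o * C^o => Kl p.1 p.2) ->
  meromorphic_difference_op (op_affine kappa h Kl i).
Proof.
move=> mK; apply: (@mero_difference_fin (weight n * weight n)%type
  (fun mu => - kappa * val (mu.1 i) + kappa * val (mu.2 i))
  (fun mu z xi => wp mu.1 *m leg1 (Kl (2^-1 - z 0 i) (xi + - kappa * val (mu.1 i))) i
     *m wp mu.2)).
  move=> mu; apply: meromorphic_mx_mul; last exact: meromorphic_mx_cst.
  apply: meromorphic_mx_mul; first exact: meromorphic_mx_cst.
  apply: mero_leg1; set c := - kappa * _.
  have := @mero_pull1 _ _ Kl (fun z => 2^-1 - z 0 i) (- delta_mx 0 i) 1 c mK (oner_neq0 _).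
  have -> : (fun p : X => Kl (2^-1 - p.1 0 i) (1 * p.2 + c)) =
      (fun p : X => Kl (2^-1 - p.1 0 i) (p.2 + c)).
    by apply/funext => p; rewrite mul1r.
  apply.
    apply: smoothD; first exact: smooth_cst.
    by apply: smoothN; exact: smooth_coord.
  move=> z t; rewrite scalerN -scaleNr line_coord eqxx.
  by rewrite opprD opprK addrA.
move=> z f xi; rewrite /op_affine /shift_op /mult_op.
rewrite -(pair_bigA _ (fun mu nu : weight n => wp mu *m
   leg1 (Kl (2^-1 - z 0 i) (xi + - kappa * val (mu i))) i *m wp nu *m
   f (xi + (- kappa * val (mu i) + kappa * val (nu i))))) /=.
apply: eq_bigr => mu _; rewrite !mulmx_sumr; apply: eq_bigr => nu _.
by rewrite !mulmxA addrA.
Qed.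

End Families.

(** * Quadratic relations and unitarity *)

Section Relations.
Variables (RR : realType) (d : nat) (h : 'M[RR[i]]_d).
Hypothesis hss : diagonalizable h.
Notation C := RR[i].
Variable n : nat.
Notation X := ('rV[C^o]_n * C^o)%type.
Notation tend := (tend RR d).
Notation genfun := (genfun RR d n).
Variables (kappa : C) (R : C -> C -> tend 2) (K Kl : C -> C -> 'M[C]_d).
Implicit Types (q : genfun) (i j k : 'I_n).

(** An identity of operators on a few legs, read on all legs. *)
Lemma mulQ_emb_eqP m (phi : 'I_m -> 'I_n) (i0 : 'I_m) (A B : X -> tend m) :
  injective phi ->
  (forall q, mulQ (fun x => emb phi (A x)) q = mulQ (fun x => emb phi (B x)) q) <->
  generically (fun x => A x = B x).
Proof.
move=> phi_inj; split=> [/mulQ_eqP E|E].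
  by apply: generically_mono E => x; apply: emb_inj.
by apply/mulQ_eqP; apply: generically_mono E => x ->.
Qed.

Lemma mulQ_idP (A : X -> tend n) :
  (forall q, mulQ A q = q) <-> generically (fun x => A x = 1%:M).
Proof.
split=> [E|E q]; first by apply/mulQ_eqP => q; rewrite E mulQ1.
by rewrite -[RHS]mulQ1; move: q; apply/mulQ_eqP.
Qed.

Lemma single_shiftK (c : C) i k : single_shift (- c) i k + single_shift c i k = 0.
Proof. by rewrite /single_shift; case: ifP; rewrite ?addNr ?addr0. Qed.

Lemma single_shiftKr (c : C) i k : single_shift c i k + single_shift (- c) i k = 0.
Proof. by rewrite addrC single_shiftK. Qed.

Lemma conj_idP c c' (P : genfun -> genfun) : (forall i, c i + c' i = 0) ->
  (forall q, shiftQ h c (P (shiftQ h c' q)) = q) <-> (forall q, P q = q).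
Proof.
move=> cc'; have c'c i : c' i + c i = 0 by rewrite addrC cc'.
split=> E q; last by rewrite E shiftQK.
have sK p : shiftQ h c' (shiftQ h c p) = p by apply: shiftQK.
by have := congr1 (shiftQ h c') (E (shiftQ h c q)); rewrite !sK.
Qed.

Lemma pull_eqP w (P P' : genfun -> genfun) :
  (forall q, P (pullQ w q) = P' (pullQ w q)) <-> (forall q, P q = P' q).
Proof.
split=> E q //; have := E (pullQ w^-1%g q).
by rewrite !pullQM mulgV pullQ1.
Qed.

(** The actions F |-> M^s(z) F(s z, xi) of the simple reflections s. *)
Definition g_affine i q := familyQ (op_affine kappa h Kl i) (pullQ (affine_reflection i) q).
Definition g_swap i j q := familyQ (op_swap kappa h R i j) (pullQ (swap_reflection i j) q).
Definition g_sign i q := familyQ (op_sign kappa h K i) (pullQ (sign_reflection i) q).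

(** The operator P R, which satisfies braid relations rather than Yang-Baxter
    equations. *)
Definition checkR i j (u : 'rV[C]_n -> C) q := flipQ i j (R_op R i j u q).

Lemma pullQ_checkR w i j u q :
  pullQ w (checkR i j u q) = checkR i j (fun z => u (affW_act w^-1%g z)) (pullQ w q).
Proof. by rewrite /checkR pullQ_flipQ pullQ_R_op. Qed.

Lemma eq_checkR i j u u' q : u =1 u' -> checkR i j u q = checkR i j u' q.
Proof. by move=> E; rewrite /checkR (eq_R_op _ _ _ _ E). Qed.

Lemma g_swapE i j q : (i < j)%N -> g_swap i j q =
  shiftQ h (initial_shift (- kappa) i) (checkR i j (fun z => z 0 i - z 0 j)
    (shiftQ h (initial_shift kappa i) (pullQ (swap_reflection i j) q))).
Proof. by move=> ij; rewrite /g_swap familyQ_swap. Qed.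

Lemma g_affineE i q : g_affine i q =
  legT h (- kappa) i (K_op Kl i (fun z => 2^-1 - z 0 i)
    (legT h kappa i (pullQ (affine_reflection i) q))).
Proof. by rewrite /g_affine familyQ_affine. Qed.

Lemma g_signE i q : g_sign i q =
  shiftQ h (initial_shift (- kappa) i) (K_op K i (fun z => z 0 i)
    (shiftQ h (initial_shift kappa i) (pullQ (sign_reflection i) q))).
Proof. by rewrite /g_sign familyQ_sign. Qed.

Lemma smooth_diff i j : smooth (fun z : 'rV[C^o]_n => z 0 i - z 0 j : C^o).
Proof. by apply: smoothD; [exact: smooth_coord | apply/smoothN/smooth_coord]. Qed.

Lemma checkRE i j u q : i != j ->
  checkR i j u q = mulQ (fun x : X => leg2 (flip RR d *m R (u x.1) (2 * x.2)) i j) q.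
Proof.
by move=> ij; rewrite /checkR !flipQE !R_opE mulQM; apply: eq_mulQ => x; rewrite leg2_mul.
Qed.

(** The conjugations by shifts cancel in the square, which leaves
    P R(u) P R(-u) = R_21(u) R(-u). *)
Lemma swap_unitary i j : (i < j)%N ->
  (forall q, g_swap i j (g_swap i j q) = q) <-> unitary_R R.
Proof.
move=> ij; have ne : i != j by rewrite -val_eqE neq_ltn ij.
set u := fun z : 'rV[C]_n => z 0 i - z 0 j.
set u' := fun z : 'rV[C]_n => - u z.
have E q : g_swap i j (g_swap i j q) =
    shiftQ h (initial_shift (- kappa) i) (checkR i j u (checkR i j u'
      (shiftQ h (initial_shift kappa i) q))).
  rewrite !g_swapE // -shiftQ_pullQ pullQ_checkR -shiftQ_pullQ pullQM swap_reflectionK pullQ1.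
  rewrite (shiftQK hss _ (initial_shiftKr kappa i)) -/u; congr (shiftQ _ _ (checkR _ _ _ _)).
  by apply: eq_checkR => z; rewrite !swap_actV tpermL tpermR /u' /u opprB.
transitivity (forall q, checkR i j u (checkR i j u' q) = q).
  have Cj := conj_idP (fun q => checkR i j u (checkR i j u' q)) (initial_shiftK kappa i).
  by split=> [H|/(proj2 Cj) H q]; [apply: (proj1 Cj) => q; rewrite -E | rewrite E].
transitivity (generically (fun x : X =>
    leg2 (op21 (R (u x.1) (2 * x.2)) *m R (- u x.1) (2 * x.2)) i j = (1%:M : tend n))).
  have Q q : checkR i j u (checkR i j u' q) = mulQ (fun x : X =>
      leg2 (op21 (R (u x.1) (2 * x.2)) *m R (- u x.1) (2 * x.2)) i j) q.
    rewrite !checkRE // mulQM; apply: eq_mulQ => x.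
    by rewrite /op21 -leg2_mul // !mulmxA.
  by rewrite -mulQ_idP; split=> H q; [rewrite -Q | rewrite Q].
have sub : submersive (fun p : X => (u p.1, 2 * p.2 + 0) : C^o * C^o).
  apply: (@submersive_coords1 _ _ _ _ _ u (delta_mx 0 i)).
  - by rewrite pnatr_eq0.
  - exact: smooth_diff.
  - move=> z t; rewrite /u !line_coord eqxx.
    by rewrite eq_sym (negPf ne) addr0 addrAC.
rewrite /unitary_R.
rewrite (generically_submersive (fun p : C^o * C^o => op21 (R p.1 p.2) *m R (- p.1) p.2 = 1%:M)
  (0 : X) sub).
by split; apply: generically_mono => x /=; rewrite addr0 => H;
  [apply: (leg2_inj ne); rewrite leg2_1 | rewrite H leg2_1].
Qed.

Lemma sign_unitary i :
  (forall q, g_sign i (g_sign i q) = q) <-> unitary_K K.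
Proof.
set u := fun z : 'rV[C]_n => z 0 i.
set u' := fun z : 'rV[C]_n => - u z.
have E q : g_sign i (g_sign i q) =
    shiftQ h (initial_shift (- kappa) i) (K_op K i u (K_op K i u'
      (shiftQ h (initial_shift kappa i) q))).
  rewrite !g_signE // -shiftQ_pullQ pullQ_K_op -shiftQ_pullQ pullQM sign_reflectionK pullQ1.
  rewrite (shiftQK hss _ (initial_shiftKr kappa i)) -/u; congr (shiftQ _ _ (K_op _ _ _ _)).
  by apply: eq_K_op => z; rewrite !sign_actV eqxx.
transitivity (forall q, K_op K i u (K_op K i u' q) = q).
  have Cj := conj_idP (fun q => K_op K i u (K_op K i u' q)) (initial_shiftK kappa i).
  by split=> [H|/(proj2 Cj) H q]; [apply: (proj1 Cj) => q; rewrite -E | rewrite E].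
transitivity (generically (fun x : X =>
    leg1 (K (u x.1) x.2 *m K (- u x.1) x.2) i = (1%:M : tend n))).
  have Q q : K_op K i u (K_op K i u' q) = mulQ (fun x : X =>
      leg1 (K (u x.1) x.2 *m K (- u x.1) x.2) i) q.
    by rewrite !K_opE mulQM; apply: eq_mulQ => x; rewrite leg1_mul.
  by rewrite -mulQ_idP; split=> H q; [rewrite -Q | rewrite Q].
have sub : submersive (fun p : X => (u p.1, 1 * p.2 + 0) : C^o * C^o).
  apply: (@submersive_coords1 _ _ _ _ _ u (delta_mx 0 i)).
  - by rewrite oner_neq0.
  - exact: smooth_coord.
  - by move=> z t; rewrite /u !line_coord eqxx.
rewrite /unitary_K (generically_submersive
  (fun p : C^o * C^o => K p.1 p.2 *m K (- p.1) p.2 = 1%:M) (0 : X) sub).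
by split; apply: generically_mono => x /=; rewrite addr0 mul1r => H;
  [apply: (leg1_inj (i := i)); rewrite leg1_1 | rewrite H leg1_1].
Qed.

(** The reflection z |-> 1 - z changes the sign of the spectral parameter
    1/2 - z. *)
Lemma affine_unitary i :
  (forall q, g_affine i (g_affine i q) = q) <-> unitary_K Kl.
Proof.
set u := fun z : 'rV[C]_n => 2^-1 - z 0 i.
set u' := fun z : 'rV[C]_n => - u z.
have half : 2^-1 + 2^-1 = 1 :> C by rewrite -mulr2n -[LHS]mulr_natr mulVf ?pnatr_eq0.
have E q : g_affine i (g_affine i q) =
    legT h (- kappa) i (K_op Kl i u (K_op Kl i u' (legT h kappa i q))).
  rewrite !g_affineE // /legT -!shiftQ_pullQ pullQ_K_op -shiftQ_pullQ pullQM affine_reflectionK.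
  rewrite pullQ1 (shiftQK hss _ (single_shiftKr kappa i)) -/u.
  congr (shiftQ _ _ (K_op _ _ _ _)).
  apply: eq_K_op => z; rewrite !affine_actV eqxx /u' /u; move: half; generalize (2^-1 : C) => a aa.
  by rewrite -aa; ring.
transitivity (forall q, K_op Kl i u (K_op Kl i u' q) = q).
  have Cj := conj_idP (fun q => K_op Kl i u (K_op Kl i u' q)) (single_shiftK kappa i).
  split=> [H|/(proj2 Cj) H q]; last by rewrite E; exact: H.
  by apply: (proj1 Cj) => q; exact: (etrans (esym (E q)) (H q)).
transitivity (generically (fun x : X =>
    leg1 (Kl (u x.1) x.2 *m Kl (- u x.1) x.2) i = (1%:M : tend n))).
  have Q q : K_op Kl i u (K_op Kl i u' q) = mulQ (fun x : X =>
      leg1 (Kl (u x.1) x.2 *m Kl (- u x.1) x.2) i) q.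
    by rewrite !K_opE mulQM; apply: eq_mulQ => x; rewrite leg1_mul.
  by rewrite -mulQ_idP; split=> H q; [rewrite -Q | rewrite Q].
have sub : submersive (fun p : X => (u p.1, 1 * p.2 + 0) : C^o * C^o).
  apply: (@submersive_coords1 _ _ _ _ _ u (- delta_mx 0 i)).
  - by rewrite oner_neq0.
  - by apply: smoothD; [exact: smooth_cst | apply/smoothN/smooth_coord].
  - move=> z t; rewrite /u scalerN -scaleNr !line_coord eqxx.
    by rewrite opprD opprK addrA.
rewrite /unitary_K (generically_submersive
  (fun p : C^o * C^o => Kl p.1 p.2 *m Kl (- p.1) p.2 = 1%:M) (0 : X) sub).
by split; apply: generically_mono => x /=; rewrite addr0 mul1r => H;
  [apply: (leg1_inj (i := i)); rewrite leg1_1 | rewrite H leg1_1].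
Qed.

End Relations.

(** * Flips and embedded dynamical shifts *)

Section FlipRules.
Variables (RR : realType) (d : nat) (h : 'M[RR[i]]_d).
Hypothesis hss : diagonalizable h.
Notation C := RR[i].
Variable n : nat.
Notation X := ('rV[C^o]_n * C^o)%type.
Notation tend := (tend RR d).
Notation genfun := (genfun RR d n).
Variables (R : C -> C -> tend 2).
Implicit Types (q : genfun) (i j k l : 'I_n).

Lemma R_op_flipQ i j k l u q : i != j ->
  R_op R k l u (flipQ i j q) = flipQ i j (R_op R (tperm i j k) (tperm i j l) u q).
Proof. by move=> ij; rewrite flipQ_R_op // !tpermK. Qed.

Lemma K_op_flipQ K i j k u q : i != j ->
  K_op K k u (flipQ i j q) = flipQ i j (K_op K (tperm i j k) u q).
Proof. by move=> ij; rewrite flipQ_K_op // !tpermK. Qed.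

Lemma legT_flipQ x i j k q : i != j ->
  legT h x k (flipQ i j q) = flipQ i j (legT h x (tperm i j k) q).
Proof. by move=> ij; rewrite flipQ_legT // !tpermK. Qed.

Lemma flipQ_flipQ i j k l q : i != j ->
  flipQ i j (flipQ k l q) = flipQ (tperm i j k) (tperm i j l) (flipQ i j q).
Proof.
move=> ij; rewrite [flipQ k l]flipQE [in RHS]flipQE.
rewrite (@eq_mulQ _ _ _ _ (fun=> emb (pair_leg k l) (flip RR d))); last first.
  by move=> x; rewrite leg2E.
rewrite flipQ_emb //; apply: eq_mulQ => x; rewrite leg2E; congr emb.
by apply/funext => a; rewrite /pair_leg /=; case: ifP.
Qed.

(** Both sides are the flip of the outer legs. *)
Lemma flipQ_braid i j k q : i != j -> j != k -> i != k ->
  flipQ i j (flipQ j k (flipQ i j q)) = flipQ j k (flipQ i j (flipQ j k q)).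
Proof.
move=> ij jk ik.
rewrite [LHS]flipQ_flipQ // tpermR [tperm i j k]tpermD // flipQK //.
by rewrite [RHS]flipQ_flipQ // tpermL [tperm j k i]tpermD 1?eq_sym // flipQK.
Qed.

Lemma extend_single m (phi : 'I_m -> 'I_n) (x : C) a : injective phi ->
  extend_coef phi (single_shift x a) =1 single_shift x (phi a).
Proof.
move=> phi_inj k; rewrite /extend_coef /single_shift; case: pickP => [b /eqP <-|nk].
  by rewrite (inj_eq phi_inj).
by rewrite eq_sym nk.
Qed.

Lemma mulQ_emb_leg2 m (phi : 'I_m -> 'I_n) a b u q : injective phi ->
  mulQ (fun x : X => emb phi (leg2 (R (u x.1) (2 * x.2)) a b)) q =
  R_op R (phi a) (phi b) u q.
Proof. by move=> phi_inj; rewrite R_opE; apply: eq_mulQ => x; rewrite emb_leg2. Qed.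

(** The dynamical shift of R in the variable 2 xi by 2 c is conjugation by T_c. The
    last hypothesis is trivial when c does not involve the legs of R, and the ice
    rule otherwise. *)
Lemma mulQ_dyn_leg2 m (phi : 'I_m -> 'I_n) a b e c c' u q :
  injective phi -> a != b -> c (phi a) = c (phi b) ->
  (forall k, extend_coef phi e k = 2 * c k) ->
  (forall k, c k + c' k = 0) ->
  c (phi a) = 0 \/ generically (fun x : X =>
    R (u x.1) (2 * x.2) *m Delta_h h = Delta_h h *m R (u x.1) (2 * x.2)) ->
  mulQ (fun x : X => emb phi
    (dyn_shift h (fun eta => leg2 (R (u x.1) eta) a b) e (2 * x.2))) q =
  shiftQ h c (R_op R (phi a) (phi b) u (shiftQ h c' q)).
Proof.
move=> phi_inj ab cab ec cc' pR; rewrite R_opE shiftQ_conj //; last first.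
  have ne : phi a != phi b by rewrite (inj_eq phi_inj).
  case: pR => [ca|pR]; first by apply: generically_all => x; apply: preserves_leg2; auto.
  by apply: generically_mono pR => x pRx; apply: preserves_leg2; auto.
apply: eq_mulQ => x; rewrite emb_dyn_shift //; apply/esym; etransitivity.
  exact: (dyn_shift_scale hss (fun eta => leg2 (R (u x.1) eta) (phi a) (phi b))).
by apply: eq_dyn_shift => [eta|k]; rewrite ?emb_leg2.
Qed.

Lemma mulQ_dyn_leg1 (K : C -> C -> 'M[C]_d) m (phi : 'I_m -> 'I_n) a b x0 u q :
  injective phi -> a != b ->
  mulQ (fun x : X => emb phi
    (dyn_shift h (fun eta => leg1 (K (u x.1) eta) a) (single_shift x0 b) x.2)) q =
  legT h x0 (phi b) (K_op K (phi a) u (legT h (- x0) (phi b) q)).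
Proof.
move=> phi_inj ab; rewrite /legT K_opE shiftQ_conj //; last 2 first.
- apply: generically_all => x; apply: preserves_leg1.
  by rewrite /single_shift (inj_eq phi_inj) (negPf ab).
- exact: single_shiftKr.
apply: eq_mulQ => x; rewrite emb_dyn_shift //.
by apply: eq_dyn_shift => [eta|k]; rewrite ?emb_leg1 ?extend_single.
Qed.

Lemma flipQ_inj i j : i != j -> injective (@flipQ RR d n i j).
Proof. by move=> ij q q' E; rewrite -(flipQK q ij) E flipQK. Qed.

End FlipRules.

(** * Commutation of distant generators *)

Section FarCommutation.
Variables (RR : realType) (d : nat) (h : 'M[RR[i]]_d).
Hypothesis hss : diagonalizable h.
Notation C := RR[i].
Variable n : nat.
Notation X := ('rV[C^o]_n * C^o)%type.
Notation tend := (tend RR d).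
Notation genfun := (genfun RR d n).
Variables (kappa : C) (R : C -> C -> tend 2) (K Kl : C -> C -> 'M[C]_d).
Implicit Types (q : genfun) (i j k : 'I_n).
Notation g_affine := (g_affine h kappa Kl).
Notation g_swap := (g_swap h kappa R).
Notation g_sign := (g_sign h kappa K).
Notation checkR := (checkR R).

(** After conjugation by T_c the second operator is multiplication by B
    dynamically shifted along e = c' - c. It commutes with A, because A commutes
    both with B and with the combination of the h_i given by e. *)
Lemma far_commute c cN c' cN' (A B : X -> tend n) w w' q :
  (forall k, c k + cN k = 0) -> (forall k, c' k + cN' k = 0) ->
  (w * w' = w' * w)%g ->
  (forall x, A (affW_act w'^-1%g x.1, x.2) = A x) ->
  (forall x, B (affW_act w^-1%g x.1, x.2) = B x) ->
  generically (fun x => preserves h (fun k => c' k + cN k) (A x)) ->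
  generically (fun x => preserves h (fun k => c' k + cN k) (B x)) ->
  (forall x eta, A x *m B (x.1, eta) = B (x.1, eta) *m A x) ->
  let g p := shiftQ h c (mulQ A (shiftQ h cN (pullQ w p))) in
  let g' p := shiftQ h c' (mulQ B (shiftQ h cN' (pullQ w' p))) in
  g (g' q) = g' (g q).
Proof.
move=> cK cK' ww wA wB pA pB AB g g'; rewrite /g /g'.
have pull_m v (D : X -> tend n) p : (forall x, D (affW_act v^-1%g x.1, x.2) = D x) ->
    pullQ v (mulQ D p) = mulQ D (pullQ v p).
  by move=> vD; rewrite pullQ_mulQ; apply: eq_mulQ.
rewrite -!shiftQ_pullQ !pull_m // -!shiftQ_pullQ !pullQM ww; set p := pullQ _ q.
set e := fun k => c' k + cN k; set D := dynX h e B.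
have eD r : shiftQ h e (mulQ B r) = mulQ D (shiftQ h e r) by rewrite shiftQ_mulQ.
have E1 r : shiftQ h cN (shiftQ h c' r) = shiftQ h e r.
  by rewrite shiftQD //; apply: shiftQ_ext => k; rewrite addrC.
have E2 r : shiftQ h e (shiftQ h cN' r) = shiftQ h cN r.
  by rewrite shiftQD //; apply: shiftQ_ext => k; rewrite /e addrAC cK' add0r.
have E3 r : shiftQ h c' r = shiftQ h c (shiftQ h e r).
  by rewrite shiftQD //; apply: shiftQ_ext => k; rewrite /e addrCA cK addr0.
have E4 r : shiftQ h e (shiftQ h cN' (shiftQ h c r)) = r.
  by rewrite E2 shiftQK // => k; rewrite addrC.
rewrite E1 eD E2 [RHS]E3 eD E4; congr (shiftQ h c _).
rewrite !mulQM; move: (shiftQ h cN p); apply/mulQ_eqP.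
by apply: generically_mono pA => x pAx; apply: (dyn_shift_comm hss) => // eta; apply: AB.
Qed.

End FarCommutation.

(** * The braid relation and the dynamical Yang-Baxter equation *)

Section BraidRelations.
Variables (RR : realType) (d : nat) (h : 'M[RR[i]]_d).
Hypothesis hss : diagonalizable h.
Notation C := RR[i].
Variable n : nat.
Notation X := ('rV[C^o]_n * C^o)%type.
Notation tend := (tend RR d).
Notation genfun := (genfun RR d n).
Variables (kappa : C) (R : C -> C -> tend 2) (K Kl : C -> C -> 'M[C]_d).
Hypothesis R_ice : ice_rule h R.
Implicit Types (q : genfun) (i j k : 'I_n).
Notation g_affine := (g_affine h kappa Kl).
Notation g_swap := (g_swap h kappa R).
Notation g_sign := (g_sign h kappa K).
Notation checkR := (checkR R).

Lemma ord_neq i j : (i < j)%N -> i != j.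
Proof. by move=> ij; rewrite -val_eqE neq_ltn ij. Qed.

Lemma ice_coords (u : 'rV[C^o]_n -> C^o) e : smooth u ->
  (forall z t, u (z + t *: e) = u z + t) ->
  generically (fun x : X =>
    R (u x.1) (2 * x.2) *m Delta_h h = Delta_h h *m R (u x.1) (2 * x.2)).
Proof.
move=> su uE.
have a0 : 2 != 0 :> C by rewrite pnatr_eq0.
have sub := @submersive_coords1 _ _ 2 0 a0 u e su uE.
have := proj1 (generically_submersive (fun p : C^o * C^o =>
  R p.1 p.2 *m Delta_h h = Delta_h h *m R p.1 p.2) (0 : X) sub) R_ice.
by apply: generically_mono => x /=; rewrite addr0.
Qed.

Lemma ice_diff i j : i != j -> generically (fun x : X =>
  R (x.1 0 i - x.1 0 j) (2 * x.2) *m Delta_h h =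
  Delta_h h *m R (x.1 0 i - x.1 0 j) (2 * x.2)).
Proof.
move=> ij; apply: (@ice_coords (fun z => z 0 i - z 0 j) (delta_mx 0 i)).
  exact: smooth_diff.
by move=> z t; rewrite !line_coord eqxx eq_sym (negPf ij) addr0 addrAC.
Qed.

(** Here e is minus kappa times the sum of the h_l over the legs before j other
    than i: the shift by h_i in M^(s_0) cancels the one in R. *)
Lemma affine_swap_commute i j k q : (i < j)%N -> (j < k)%N ->
  (affine_reflection i * swap_reflection j k =
   swap_reflection j k * affine_reflection i)%g ->
  g_affine i (g_swap j k q) = g_swap j k (g_affine i q).
Proof.
move=> ij jk ww; have [[ne ne'] ne''] := (ord_neq ij, ord_neq jk, ord_neq (ltn_trans ij jk)).
rewrite !g_affineE // !g_swapE // !checkRE // !K_opE /legT.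
apply: (far_commute hss) => //.
- exact: single_shiftK.
- exact: initial_shiftK.
- by move=> x /=; rewrite swap_actV tpermD // eq_sym.
- by move=> x /=; rewrite !affine_actV ![_ == i]eq_sym (negPf ne) (negPf ne'').
- apply: generically_all => x; apply: preserves_leg1.
  by rewrite /initial_shift /single_shift ij eqxx addNr.
- apply: generically_all => x; apply: preserves_leg2 => //; last left;
  by rewrite /initial_shift /single_shift ltnn ?[(k < j)%N]ltnNge ?(ltnW jk) /=
    ![_ == i]eq_sym (negPf ne) ?(negPf ne'') !addr0.
- by move=> x eta; apply: leg1_leg2_comm.
Qed.

Lemma affine_sign_commute i j q : (i < j)%N ->
  (affine_reflection i * sign_reflection j = sign_reflection j * affine_reflection i)%g ->
  g_affine i (g_sign j q) = g_sign j (g_affine i q).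
Proof.
move=> ij ww; have ne := ord_neq ij.
rewrite !g_affineE // !g_signE // !K_opE /legT.
apply: (far_commute hss) => //.
- exact: single_shiftK.
- exact: initial_shiftK.
- by move=> x /=; rewrite sign_actV (negPf ne).
- by move=> x /=; rewrite affine_actV eq_sym (negPf ne).
- apply: generically_all => x; apply: preserves_leg1.
  by rewrite /initial_shift /single_shift ij eqxx addNr.
- apply: generically_all => x; apply: preserves_leg1.
  by rewrite /initial_shift /single_shift ltnn eq_sym (negPf ne) addr0.
- by move=> x eta; apply: leg1_leg1_comm.
Qed.

Lemma preserves_flip_R c i j (B : tend 2) : i != j -> c i = c j ->
  B *m Delta_h h = Delta_h h *m B -> preserves h c (leg2 (flip RR d *m B) i j).
Proof.
move=> ij cij pB; apply: preserves_leg2 => //; right.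
by rewrite -mulmxA pB mulmxA flip_Delta_h mulmxA.
Qed.

(** The legs i and i' both contribute to the shift of the second operator, and R
    on these legs commutes with h_i + h_i' by the ice rule. *)
Lemma swap_swap_commute i i' j k q : (i < i')%N -> (i' < j)%N -> (j < k)%N ->
  (swap_reflection i i' * swap_reflection j k =
   swap_reflection j k * swap_reflection i i')%g ->
  g_swap i i' (g_swap j k q) = g_swap j k (g_swap i i' q).
Proof.
move=> ii' i'j jk ww; have ij := ltn_trans ii' i'j.
have [[n1 n2] n3] := (ord_neq ii', ord_neq i'j, ord_neq jk).
have [[n4 n5] n6] := (ord_neq ij, ord_neq (ltn_trans ij jk), ord_neq (ltn_trans i'j jk)).
rewrite !g_swapE // !checkRE //.
apply: (far_commute hss) => //.
- exact: initial_shiftK.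
- exact: initial_shiftK.
- by move=> x /=; rewrite !swap_actV !tpermD // eq_sym.
- by move=> x /=; rewrite !swap_actV !tpermD // eq_sym.
- apply: generically_mono (ice_diff n1) => x; apply: preserves_flip_R => //.
  by rewrite /initial_shift ij i'j ltnn ltnNge (ltnW ii').
- apply: generically_all => x; apply: preserves_leg2 => //; last left;
  by rewrite /initial_shift ltnn ?[(k < _)%N]ltnNge ?(ltnW jk) ?[(j < i)%N]ltnNge
    ?(ltnW ij) ?[(k < i)%N]ltnNge ?(ltnW (ltn_trans ij jk)) /= ?addr0.
- by move=> x eta; apply: leg2_leg2_comm.
Qed.

Lemma swap_sign_commute i i' j q : (i < i')%N -> (i' < j)%N ->
  (swap_reflection i i' * sign_reflection j =
   sign_reflection j * swap_reflection i i')%g ->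
  g_swap i i' (g_sign j q) = g_sign j (g_swap i i' q).
Proof.
move=> ii' i'j ww; have ij := ltn_trans ii' i'j.
have [[n1 n2] n4] := (ord_neq ii', ord_neq i'j, ord_neq ij).
rewrite !g_swapE // !checkRE // !g_signE // K_opE.
apply: (far_commute hss) => //.
- exact: initial_shiftK.
- exact: initial_shiftK.
- by move=> x /=; rewrite !sign_actV (negPf n2) (negPf n4).
- by move=> x /=; rewrite !swap_actV !tpermD // eq_sym.
- apply: generically_mono (ice_diff n1) => x; apply: preserves_flip_R => //.
  by rewrite /initial_shift ij i'j ltnn ltnNge (ltnW ii').
- apply: generically_all => x; apply: preserves_leg1.
  by rewrite /initial_shift ltnn ltnNge (ltnW ij) /= addr0.
- by move=> x eta; rewrite leg1_leg2_comm // eq_sym.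
Qed.

(** P R with the dynamical shift by the weight of the preceding leg i. *)
Definition checkR_dyn i j k u q := legT h (- kappa) i (checkR j k u (legT h kappa i q)).

Lemma initial_shift_succ (x : C) i j l : j = i.+1 :> nat ->
  initial_shift x j l = initial_shift x i l + single_shift x i l.
Proof.
move=> ji; rewrite /initial_shift /single_shift ji ltnS -val_eqE.
by have [ ] := ltngtP l i; rewrite ?addr0 ?add0r.
Qed.

(** Up to the same conjugation as for s_(i+1), the next generator is shifted by
    the weight of leg i only. *)
Lemma g_swap_succ i j k q : j = i.+1 :> nat -> (j < k)%N -> g_swap j k q =
  shiftQ h (initial_shift (- kappa) i) (checkR_dyn i j k (fun z => z 0 j - z 0 k)
    (shiftQ h (initial_shift kappa i) (pullQ (swap_reflection j k) q))).
Proof.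
move=> ji jk; rewrite g_swapE //.
have E x r : shiftQ h (initial_shift x j) r = shiftQ h (initial_shift x i) (legT h x i r).
  by rewrite /legT shiftQD //; apply: shiftQ_ext => l; rewrite (initial_shift_succ _ _ ji).
have E' r : shiftQ h (initial_shift kappa j) r =
    legT h kappa i (shiftQ h (initial_shift kappa i) r) by rewrite E /legT shiftQC.
by rewrite E E'.
Qed.

Lemma pullQ_checkR_dyn w i j k u q : pullQ w (checkR_dyn i j k u q) =
  checkR_dyn i j k (fun z => u (affW_act w^-1%g z)) (pullQ w q).
Proof. by rewrite /checkR_dyn /legT -shiftQ_pullQ pullQ_checkR -shiftQ_pullQ. Qed.

Lemma checkR_congr i j u u' q q' : u =1 u' -> q = q' -> checkR i j u q = checkR i j u' q'.
Proof. by move=> E ->; apply: eq_checkR. Qed.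

Lemma checkR_dyn_congr i j k u u' q q' : u =1 u' -> q = q' ->
  checkR_dyn i j k u q = checkR_dyn i j k u' q'.
Proof. by move=> E ->; rewrite /checkR_dyn (eq_checkR _ _ _ _ E). Qed.

(** The common conjugation cancels, and the reflections z |-> s z turn the spectral
    parameters into the differences of three fixed coordinates. *)
Lemma braid_operators i j k : j = i.+1 :> nat -> (j < k)%N ->
  (forall v, swap_reflection i j * (swap_reflection j k * (swap_reflection i j * v)) =
   swap_reflection j k * (swap_reflection i j * (swap_reflection j k * v)))%g ->
  (forall q, g_swap i j (g_swap j k (g_swap i j q)) =
             g_swap j k (g_swap i j (g_swap j k q))) <->
  (forall q, checkR i j (fun z => z 0 i - z 0 j)
      (checkR_dyn i j k (fun z => z 0 i - z 0 k) (checkR i j (fun z => z 0 j - z 0 k) q)) =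
    checkR_dyn i j k (fun z => z 0 j - z 0 k)
      (checkR i j (fun z => z 0 i - z 0 k) (checkR_dyn i j k (fun z => z 0 i - z 0 j) q))).
Proof.
move=> ji jk ww; have ij : (i < j)%N by rewrite ji.
have [[n1 n2] n3] := (ord_neq ij, ord_neq jk, ord_neq (ltn_trans ij jk)).
set c := initial_shift (- kappa) i; set cN := initial_shift kappa i.
set w := (swap_reflection i j * (swap_reflection j k * swap_reflection i j))%g.
have wE : (w = swap_reflection j k * (swap_reflection i j * swap_reflection j k))%g.
  by have := ww 1%g; rewrite !mulg1.
have tij : (tperm i j i = j) * (tperm i j j = i) * (tperm i j k = k) *
    (tperm j k i = i) * (tperm j k j = k) * (tperm j k k = j).
  by rewrite !tpermL !tpermR !tpermD // eq_sym.
have cK r : shiftQ h cN (shiftQ h c r) = r.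
  by apply: shiftQK => // l; apply: initial_shiftKr.
have E1 q : g_swap i j (g_swap j k (g_swap i j q)) = shiftQ h c
    (checkR i j (fun z => z 0 i - z 0 j) (checkR_dyn i j k (fun z => z 0 i - z 0 k)
      (checkR i j (fun z => z 0 j - z 0 k) (shiftQ h cN (pullQ w q))))).
  rewrite g_swapE // (g_swap_succ _ ji jk) // g_swapE // -/c -/cN.
  rewrite -![pullQ _ (shiftQ h c _)]shiftQ_pullQ !cK pullQ_checkR_dyn !pullQ_checkR.
  rewrite -![pullQ _ (shiftQ h cN _)]shiftQ_pullQ !pullQM -mulgA -/w.
  congr (shiftQ h c _); apply: checkR_congr => //; apply: checkR_dyn_congr => [z|].
    by rewrite !swap_actV !tij.
  by apply: checkR_congr => // z; rewrite !swap_actV !tij.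
have E2 q : g_swap j k (g_swap i j (g_swap j k q)) = shiftQ h c
    (checkR_dyn i j k (fun z => z 0 j - z 0 k) (checkR i j (fun z => z 0 i - z 0 k)
      (checkR_dyn i j k (fun z => z 0 i - z 0 j) (shiftQ h cN (pullQ w q))))).
  rewrite !(g_swap_succ _ ji jk) // g_swapE // -/c -/cN.
  rewrite -![pullQ _ (shiftQ h c _)]shiftQ_pullQ !cK !pullQ_checkR_dyn !pullQ_checkR.
  rewrite !pullQ_checkR_dyn -![pullQ _ (shiftQ h cN _)]shiftQ_pullQ !pullQM -mulgA -wE.
  congr (shiftQ h c _); apply: checkR_dyn_congr => //; apply: checkR_congr => [z|].
    by rewrite !swap_actV !tij.
  by apply: checkR_dyn_congr => // z; rewrite !swap_actV !tij.
split=> H q.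
  have := H (pullQ w^-1%g (shiftQ h c q)); rewrite E1 E2 !pullQM mulgV !pullQ1 !cK.
  by move/(congr1 (shiftQ h cN)); rewrite !cK.
by rewrite E1 E2 H.
Qed.

Definition leg3 i j k (l : 'I_3) : 'I_n :=
  if l == 0 then i else if l == 1 then j else k.

Lemma leg3_inj i j k : i != j -> j != k -> i != k -> injective (leg3 i j k).
Proof.
move=> ij jk ik [[|[|[|//]]] ?] [[|[|[|//]]] ?]; rewrite /leg3 /= => E;
  try (by apply: val_inj);
  by move: ij jk ik; rewrite ?E ?eqxx // -?E ?eqxx.
Qed.

(** Moving the three flips to the left produces the same permutation on both sides
    and relabels the legs of the remaining factors; what remains is the dynamical
    Yang-Baxter equation, with its two sides exchanged, at the spectral points
    z_i, z_i - z_j + z_k, z_k, whose differences are z_j - z_k, z_i - z_k and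
    z_i - z_j. *)
Lemma braid_dynamical_R i j k : i != j -> j != k -> i != k ->
  (forall q, checkR i j (fun z => z 0 i - z 0 j)
      (checkR_dyn i j k (fun z => z 0 i - z 0 k) (checkR i j (fun z => z 0 j - z 0 k) q)) =
    checkR_dyn i j k (fun z => z 0 j - z 0 k)
      (checkR i j (fun z => z 0 i - z 0 k) (checkR_dyn i j k (fun z => z 0 i - z 0 j) q)))
  <-> dynamical_R_matrix kappa h R.
Proof.
move=> ij jk ik; have [[ji kj] ki] : (j != i /\ k != j) /\ k != i.
  by rewrite ![_ == i]eq_sym [k == j]eq_sym.
set a1 := fun z : 'rV[C]_n => z 0 i - z 0 j.
set a2 := fun z : 'rV[C]_n => z 0 i - z 0 k.
set a3 := fun z : 'rV[C]_n => z 0 j - z 0 k.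
have tij : (tperm i j i = j) * (tperm i j j = i) * (tperm i j k = k) *
    (tperm j k i = i) * (tperm j k j = k) * (tperm j k k = j).
  by rewrite !tpermL !tpermR !tpermD.
(* All flips are moved to the left. *)
have L q : checkR i j a1 (checkR_dyn i j k a2 (checkR i j a3 q)) =
    flipQ i j (flipQ j k (flipQ i j (R_op R j k a1 (legT h (- kappa) j (R_op R i k a2
      (legT h kappa j (R_op R i j a3 q))))))).
  rewrite /checkR_dyn /checkR.
  by do 6?[rewrite (R_op_flipQ _ _ _ _ _ jk) ?tij | rewrite (R_op_flipQ _ _ _ _ _ ij) ?tij
    | rewrite (legT_flipQ _ _ _ _ jk) ?tij | rewrite (legT_flipQ _ _ _ _ ij) ?tij].
have Rr q : checkR_dyn i j k a3 (checkR i j a2 (checkR_dyn i j k a1 q)) =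
    flipQ j k (flipQ i j (flipQ j k (legT h (- kappa) k (R_op R i j a3 (legT h kappa k
      (R_op R i k a2 (legT h (- kappa) i (R_op R j k a1 (legT h kappa i q))))))))).
  rewrite /checkR_dyn /checkR.
  by do 9?[rewrite (R_op_flipQ _ _ _ _ _ jk) ?tij | rewrite (R_op_flipQ _ _ _ _ _ ij) ?tij
    | rewrite (legT_flipQ _ _ _ _ jk) ?tij | rewrite (legT_flipQ _ _ _ _ ij) ?tij].
have phi_inj := leg3_inj ij jk ik; set phi := leg3 i j k in phi_inj.
pose S (a b l : 'I_3) (u : 'rV[C]_n -> C) (x : X) : tend 3 :=
  dyn_shift h (fun eta => leg2 (R (u x.1) eta) a b)
    (single_shift (- (2 * kappa)) l) (2 * x.2).
have SE (a b l : 'I_3) u q : a != b -> l != a -> l != b ->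
    mulQ (fun x => emb phi (S a b l u x)) q =
    legT h (- kappa) (phi l) (R_op R (phi a) (phi b) u (legT h kappa (phi l) q)).
  move=> ab la lb; have na : single_shift (- kappa) (phi l) (phi a) = 0.
    by rewrite /single_shift (inj_eq phi_inj) eq_sym (negPf la).
  rewrite /legT; apply: (mulQ_dyn_leg2 hss) => //.
  - by rewrite na /single_shift (inj_eq phi_inj) eq_sym (negPf lb).
  - move=> m; rewrite extend_single // /single_shift; case: ifP; rewrite ?mulr0 //.
    by rewrite mulrN.
  - exact: single_shiftK.
  - by left.
pose A (x : X) := S 0 1 2 a3 x *m leg2 (R (a2 x.1) (2 * x.2)) 0 2 *m S 1 2 0 a1 x.
pose B (x : X) := leg2 (R (a1 x.1) (2 * x.2)) 1 2 *m S 0 2 1 a2 x *m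
  leg2 (R (a3 x.1) (2 * x.2)) 0 1.
have AE q : mulQ (fun x => emb phi (A x)) q = legT h (- kappa) k (R_op R i j a3 (legT h kappa k
      (R_op R i k a2 (legT h (- kappa) i (R_op R j k a1 (legT h kappa i q)))))).
  rewrite -(SE 1 2 0) // -(mulQ_emb_leg2 R 0 2 a2 _ phi_inj) -(SE 0 1 2) // !mulQM.
  by apply: eq_mulQ => x; rewrite /A !emb_mul.
have BE q : mulQ (fun x => emb phi (B x)) q = R_op R j k a1 (legT h (- kappa) j (R_op R i k a2
      (legT h kappa j (R_op R i j a3 q)))).
  rewrite -(mulQ_emb_leg2 R 0 1 a3 _ phi_inj) -(SE 0 2 1) //.
  rewrite -(mulQ_emb_leg2 R 1 2 a1 _ phi_inj) !mulQM.
  by apply: eq_mulQ => x; rewrite /B !emb_mul.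
transitivity (generically (fun x => A x = B x)).
  rewrite -(mulQ_emb_eqP (0 : 'I_3) A B phi_inj); split=> H q.
    rewrite AE BE; apply/esym/(flipQ_inj ij)/(flipQ_inj jk)/(flipQ_inj ij).
    by rewrite -L H Rr flipQ_braid.
  by rewrite L Rr -AE -BE H flipQ_braid.
have a0 : 2 != 0 :> C by rewrite pnatr_eq0.
(* The three directions in which one spectral point varies and the others do
   not. *)
have sub := @submersive_coords3 _ n 2 0 a0 (fun z => z 0 i)
  (fun z => z 0 i - z 0 j + z 0 k) (fun z => z 0 k)
  (delta_mx 0 i + delta_mx 0 j) (- delta_mx 0 j) (delta_mx 0 k + delta_mx 0 j).
have {}sub : submersive (fun p : X => (p.1 0 i, p.1 0 i - p.1 0 j + p.1 0 k, p.1 0 k,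
    2 * p.2 + 0) : C^o * C^o * C^o * C^o).
  apply: sub.
  - exact: smooth_coord.
  - by apply: smoothD; [exact: smooth_diff | exact: smooth_coord].
  - exact: smooth_coord.
  - move=> z t r s; rewrite !mxE !eqxx (negPf ij) (negPf ik) /=; ring.
  - move=> z t r s; rewrite !mxE !eqxx (negPf ij) (negPf ik) (negPf ji) (negPf jk)
      (negPf kj) (negPf ki) /=; ring.
  - move=> z t r s; rewrite !mxE !eqxx (negPf ki) (negPf kj) /=; ring.
have d12 (z : 'rV[C]_n) : z 0 i - (z 0 i - z 0 j + z 0 k) = a3 z by rewrite /a3; ring.
have d23 (z : 'rV[C]_n) : z 0 i - z 0 j + z 0 k - z 0 k = a1 z by rewrite /a1; ring.
rewrite /dynamical_R_matrix; apply: iff_sym.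
apply: iff_trans (generically_submersive _ (0 : X) sub) _.
by split; apply: generically_mono => x /=; rewrite addr0 d12 d23.
Qed.

End BraidRelations.

(** * Relations of length four and reflection equations *)

Section ReflectionRelations.
Variables (RR : realType) (d : nat) (h : 'M[RR[i]]_d).
Hypothesis hss : diagonalizable h.
Notation C := RR[i].
Variable n : nat.
Notation X := ('rV[C^o]_n * C^o)%type.
Notation tend := (tend RR d).
Notation genfun := (genfun RR d n).
Variables (kappa : C) (R : C -> C -> tend 2) (K Kl : C -> C -> 'M[C]_d).
Hypothesis R_ice : ice_rule h R.
Implicit Types (q : genfun) (i j k : 'I_n).
Notation g_affine := (g_affine h kappa Kl).
Notation g_swap := (g_swap h kappa R).
Notation g_sign := (g_sign h kappa K).
Notation checkR := (checkR R).

Lemma legTC x y i j q : legT h x i (legT h y j q) = legT h y j (legT h x i q).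
Proof. exact: shiftQC. Qed.

(** A reflection operator on leg l, dynamically shifted by - kappa h_i. For the
    left boundary l = i, and the conjugate is not a multiplication operator. *)
Definition K_op_dyn (K' : C -> C -> 'M[C]_d) i l u q :=
  legT h (- kappa) i (K_op K' l u (legT h kappa i q)).

Lemma pullQ_K_op_dyn K' w i l u q : pullQ w (K_op_dyn K' i l u q) =
  K_op_dyn K' i l (fun z => u (affW_act w^-1%g z)) (pullQ w q).
Proof. by rewrite /K_op_dyn /legT -shiftQ_pullQ pullQ_K_op -shiftQ_pullQ. Qed.

Lemma K_op_dyn_congr K' i l u u' q q' : u =1 u' -> q = q' ->
  K_op_dyn K' i l u q = K_op_dyn K' i l u' q'.
Proof. by move=> E ->; rewrite /K_op_dyn (eq_K_op _ _ _ E). Qed.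

(** ** The end of the chain: right reflection equation *)

(** The conjugation by the weights of the legs before i is common to both
    generators and cancels. *)
Lemma right_operators i j : j = i.+1 :> nat ->
  (forall v, swap_reflection i j * (sign_reflection j * (swap_reflection i j *
     (sign_reflection j * v))) =
   sign_reflection j * (swap_reflection i j * (sign_reflection j *
     (swap_reflection i j * v))))%g ->
  (forall q, g_swap i j (g_sign j (g_swap i j (g_sign j q))) =
             g_sign j (g_swap i j (g_sign j (g_swap i j q)))) <->
  (forall q, checkR i j (fun z => z 0 i - z 0 j) (K_op_dyn K i j (fun z => z 0 i)
      (checkR i j (fun z => z 0 i + z 0 j) (K_op_dyn K i j (fun z => z 0 j) q))) =
    K_op_dyn K i j (fun z => z 0 j) (checkR i j (fun z => z 0 i + z 0 j)
      (K_op_dyn K i j (fun z => z 0 i) (checkR i j (fun z => z 0 i - z 0 j) q)))).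
Proof.
move=> ji ww; have ij : (i < j)%N by rewrite ji.
have ne := ord_neq ij; have ne' : j != i by rewrite eq_sym.
set c := initial_shift (- kappa) i; set cN := initial_shift kappa i.
set w := (swap_reflection i j * (sign_reflection j *
  (swap_reflection i j * sign_reflection j)))%g.
have wE : (w = sign_reflection j * (swap_reflection i j *
    (sign_reflection j * swap_reflection i j)))%g.
  by have := ww 1%g; rewrite !mulg1.
have cK r : shiftQ h cN (shiftQ h c r) = r.
  by apply: shiftQK => // l; apply: initial_shiftKr.
have sE q : g_sign j q = shiftQ h c (K_op_dyn K i j (fun z => z 0 j)
    (shiftQ h cN (pullQ (sign_reflection j) q))).
  rewrite g_signE //.
  have E x r : shiftQ h (initial_shift x j) r = shiftQ h (initial_shift x i) (legT h x i r).
    by rewrite /legT shiftQD //; apply: shiftQ_ext => l; rewrite (initial_shift_succ _ _ ji).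
  have E' r : shiftQ h (initial_shift kappa j) r =
      legT h kappa i (shiftQ h (initial_shift kappa i) r) by rewrite E /legT shiftQC.
  by rewrite E E'.
have coords := (tpermL, tpermR, eqxx, negPf ne, negPf ne').
have E1 q : g_swap i j (g_sign j (g_swap i j (g_sign j q))) = shiftQ h c
    (checkR i j (fun z => z 0 i - z 0 j) (K_op_dyn K i j (fun z => z 0 i)
      (checkR i j (fun z => z 0 i + z 0 j) (K_op_dyn K i j (fun z => z 0 j)
        (shiftQ h cN (pullQ w q)))))).
  rewrite !g_swapE // !sE -/c -/cN.
  rewrite -![pullQ _ (shiftQ h c _)]shiftQ_pullQ !cK pullQ_K_op_dyn !pullQ_checkR !pullQ_K_op_dyn.
  rewrite -![pullQ _ (shiftQ h cN _)]shiftQ_pullQ !pullQM -!mulgA -/w.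
  congr (shiftQ h c _); apply: checkR_congr => //; apply: K_op_dyn_congr => [z|].
    by rewrite !(swap_actV, sign_actV) !coords.
  apply: checkR_congr => [z|]; first by rewrite !(swap_actV, sign_actV) !coords opprK addrC.
  by apply: K_op_dyn_congr => // z; rewrite !(swap_actV, sign_actV) !coords
    ?(swap_actV, sign_actV) ?coords ?(swap_actV, sign_actV) ?coords.
have E2 q : g_sign j (g_swap i j (g_sign j (g_swap i j q))) = shiftQ h c
    (K_op_dyn K i j (fun z => z 0 j) (checkR i j (fun z => z 0 i + z 0 j)
      (K_op_dyn K i j (fun z => z 0 i) (checkR i j (fun z => z 0 i - z 0 j)
        (shiftQ h cN (pullQ w q)))))).
  rewrite !g_swapE // !sE -/c -/cN.
  rewrite -![pullQ _ (shiftQ h c _)]shiftQ_pullQ !cK !pullQ_checkR !pullQ_K_op_dyn !pullQ_checkR.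
  rewrite -![pullQ _ (shiftQ h cN _)]shiftQ_pullQ !pullQM -!mulgA -wE.
  congr (shiftQ h c _); apply: K_op_dyn_congr => //; apply: checkR_congr => [z|].
    by rewrite !(swap_actV, sign_actV) !coords opprK.
  apply: K_op_dyn_congr => [z|]; first by rewrite !(swap_actV, sign_actV) !coords
    ?(swap_actV, sign_actV) ?coords ?(swap_actV, sign_actV) ?coords.
  apply: checkR_congr => // z; rewrite !(swap_actV, sign_actV) !coords
    ?(swap_actV, sign_actV) ?coords ?(swap_actV, sign_actV) ?coords.
  by rewrite opprK addrC.
split=> H q.
  have := H (pullQ w^-1%g (shiftQ h c q)); rewrite E1 E2 !pullQM mulgV !pullQ1 !cK.
  by move/(congr1 (shiftQ h cN)); rewrite !cK.
by rewrite E1 E2 H.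
Qed.

Lemma R_op_flip i j u q : i != j -> R_op R j i u (flipQ i j q) = checkR i j u q.
Proof. by move=> ij; rewrite R_op_flipQ // tpermL tpermR. Qed.

Lemma flipQ_checkR i j u q : i != j -> flipQ i j (checkR i j u q) = R_op R i j u q.
Proof. by move=> ij; rewrite flipQK. Qed.

Lemma mulQ_emb4 m (phi : 'I_m -> 'I_n) (A B A' B' : X -> tend m) q :
  injective phi ->
  mulQ (fun p => emb phi (A p *m B p *m A' p *m B' p)) q =
  mulQ (fun p => emb phi (A p)) (mulQ (fun p => emb phi (B p))
    (mulQ (fun p => emb phi (A' p)) (mulQ (fun p => emb phi (B' p)) q))).
Proof.
by move=> phi_inj; rewrite !mulQM; apply: eq_mulQ => p; rewrite !emb_mul // !mulmxA.
Qed.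

(** With R_12 = P (P R), R_21 = (P R) P and K_1 = P K_2 P all flips cancel in
    pairs. *)
Lemma right_dynamical_K i j : i != j ->
  (forall q, checkR i j (fun z => z 0 i - z 0 j) (K_op_dyn K i j (fun z => z 0 i)
      (checkR i j (fun z => z 0 i + z 0 j) (K_op_dyn K i j (fun z => z 0 j) q))) =
    K_op_dyn K i j (fun z => z 0 j) (checkR i j (fun z => z 0 i + z 0 j)
      (K_op_dyn K i j (fun z => z 0 i) (checkR i j (fun z => z 0 i - z 0 j) q)))) <->
  right_dynamical_K_matrix kappa h R K.
Proof.
move=> ij; have phi_inj := pair_leg_inj ij; set phi := pair_leg i j in phi_inj.
set u := fun z : 'rV[C]_n => z 0 i - z 0 j.
set v := fun z : 'rV[C]_n => z 0 i + z 0 j.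
set x := fun z : 'rV[C]_n => z 0 i.
set y := fun z : 'rV[C]_n => z 0 j.
pose K1 (p : X) := dyn_shift h (fun eta => leg1 (K (x p.1) eta) (0 : 'I_2))
  (single_shift (- kappa) 1) p.2.
pose K2 (p : X) := dyn_shift h (fun eta => leg1 (K (y p.1) eta) (1 : 'I_2))
  (single_shift (- kappa) 0) p.2.
pose R12 (f : 'rV[C]_n -> C) (p : X) := R (f p.1) (2 * p.2).
have R12E f q : mulQ (fun p => emb phi (R12 f p)) q = R_op R i j f q.
  by rewrite R_opE; apply: eq_mulQ => p; rewrite leg2E.
have R21E f q : mulQ (fun p => emb phi (op21 (R12 f p))) q = R_op R j i f q.
  by rewrite R_opE; apply: eq_mulQ => p; rewrite -op21E // leg2E.
have K2E q : mulQ (fun p => emb phi (K2 p)) q = K_op_dyn K i j y q.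
  by rewrite (mulQ_dyn_leg1 hss) // opprK.
have K1E q : mulQ (fun p => emb phi (K1 p)) q = flipQ i j (K_op_dyn K i j x (flipQ i j q)).
  rewrite (mulQ_dyn_leg1 hss) // opprK /K_op_dyn !legT_flipQ // K_op_flipQ // tpermL tpermR.
  by rewrite legT_flipQ // tpermL flipQK.
pose A (p : X) := op21 (R12 u p) *m K1 p *m R12 v p *m K2 p.
pose B (p : X) := K2 p *m op21 (R12 v p) *m K1 p *m R12 u p.
have AE q : mulQ (fun p => emb phi (A p)) q =
    checkR i j u (K_op_dyn K i j x (checkR i j v (K_op_dyn K i j y q))).
  by rewrite mulQ_emb4 // R21E K1E R12E K2E R_op_flip.
have BE q : mulQ (fun p => emb phi (B p)) q =
    K_op_dyn K i j y (checkR i j v (K_op_dyn K i j x (checkR i j u q))).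
  by rewrite mulQ_emb4 // R21E K1E R12E K2E R_op_flip.
transitivity (generically (fun p => A p = B p)).
  rewrite -(mulQ_emb_eqP (0 : 'I_2) A B phi_inj).
  by split=> H q; have := H q; rewrite AE BE.
have sub : submersive (fun p : X => (x p.1, y p.1, 1 * p.2 + 0) : C^o * C^o * C^o).
  apply: (@submersive_coords2 _ _ _ _ _ x y (delta_mx 0 i) (delta_mx 0 j)).
  - exact: oner_neq0.
  - exact: smooth_coord.
  - exact: smooth_coord.
  - by move=> z t r; rewrite /x !line_coord eqxx (negPf ij) addr0.
  - by move=> z t r; rewrite /y !line_coord eqxx eq_sym (negPf ij) addr0.
rewrite /right_dynamical_K_matrix; apply: iff_sym.
apply: iff_trans (generically_submersive _ (0 : X) sub) _.
by split; apply: generically_mono => p /=; rewrite mul1r addr0.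
Qed.

(** ** The start of the chain: left reflection equation *)

(** On the first two legs P R is not shifted, whereas the reflections z |-> s z
    produce the spectral parameters 1/2 - z_i and 1/2 - z_j of K and their sum and
    difference as those of R. *)
Lemma left_operators i j : i = 0%N :> nat -> (i < j)%N ->
  (forall v, affine_reflection i * (swap_reflection i j * (affine_reflection i *
     (swap_reflection i j * v))) =
   swap_reflection i j * (affine_reflection i * (swap_reflection i j *
     (affine_reflection i * v))))%g ->
  (forall q, g_affine i (g_swap i j (g_affine i (g_swap i j q))) =
             g_swap i j (g_affine i (g_swap i j (g_affine i q)))) <->
  (forall q, K_op_dyn Kl i i (fun z => 2^-1 - z 0 i) (checkR i j (fun z => 1 - z 0 i - z 0 j)
      (K_op_dyn Kl i i (fun z => 2^-1 - z 0 j) (checkR i j (fun z => z 0 i - z 0 j) q))) =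
    checkR i j (fun z => z 0 i - z 0 j) (K_op_dyn Kl i i (fun z => 2^-1 - z 0 j)
      (checkR i j (fun z => 1 - z 0 i - z 0 j) (K_op_dyn Kl i i (fun z => 2^-1 - z 0 i) q)))).
Proof.
move=> i0 ij ww; have ne := ord_neq ij; have ne' : j != i by rewrite eq_sym.
set w := (affine_reflection i * (swap_reflection i j *
  (affine_reflection i * swap_reflection i j)))%g.
have wE : (w = swap_reflection i j * (affine_reflection i *
    (swap_reflection i j * affine_reflection i)))%g.
  by have := ww 1%g; rewrite !mulg1.
have swE q : g_swap i j q = checkR i j (fun z => z 0 i - z 0 j)
    (pullQ (swap_reflection i j) q).
  rewrite g_swapE //.
  have E x r : shiftQ h (initial_shift x i) r = r.
    by rewrite -[RHS](shiftQ0 hss); apply: shiftQ_ext => l; rewrite /initial_shift i0 ltn0.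
  by rewrite !E.
have afE q : g_affine i q = K_op_dyn Kl i i (fun z => 2^-1 - z 0 i)
    (pullQ (affine_reflection i) q) by rewrite g_affineE.
have coords := (tpermL, tpermR, eqxx, negPf ne, negPf ne').
have E1 q : g_affine i (g_swap i j (g_affine i (g_swap i j q))) =
    K_op_dyn Kl i i (fun z => 2^-1 - z 0 i) (checkR i j (fun z => 1 - z 0 i - z 0 j)
      (K_op_dyn Kl i i (fun z => 2^-1 - z 0 j) (checkR i j (fun z => z 0 i - z 0 j)
        (pullQ w q)))).
  rewrite !swE !afE !(pullQ_K_op_dyn, pullQ_checkR) !pullQM -!mulgA -/w.
  apply: K_op_dyn_congr => //; apply: checkR_congr => [z|].
    by rewrite !(swap_actV, affine_actV) !coords.
  apply: K_op_dyn_congr => [z|]; first by rewrite !(swap_actV, affine_actV) !coords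
    ?(swap_actV, affine_actV) ?coords ?(swap_actV, affine_actV) ?coords.
  apply: checkR_congr => // z; rewrite !(swap_actV, affine_actV) !coords
    ?(swap_actV, affine_actV) ?coords ?(swap_actV, affine_actV) ?coords.
  ring.
have E2 q : g_swap i j (g_affine i (g_swap i j (g_affine i q))) =
    checkR i j (fun z => z 0 i - z 0 j) (K_op_dyn Kl i i (fun z => 2^-1 - z 0 j)
      (checkR i j (fun z => 1 - z 0 i - z 0 j) (K_op_dyn Kl i i (fun z => 2^-1 - z 0 i)
        (pullQ w q)))).
  rewrite !swE !afE !(pullQ_K_op_dyn, pullQ_checkR) !pullQM -!mulgA -wE.
  apply: checkR_congr => //; apply: K_op_dyn_congr => [z|].
    by rewrite !(swap_actV, affine_actV) !coords.
  apply: checkR_congr => [z|].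
    rewrite !(swap_actV, affine_actV) !coords
      ?(swap_actV, affine_actV) ?coords ?(swap_actV, affine_actV) ?coords.
    by rewrite addrAC.
  by apply: K_op_dyn_congr => // z; rewrite !(swap_actV, affine_actV) !coords
    ?(swap_actV, affine_actV) ?coords ?(swap_actV, affine_actV) ?coords.
split=> H q; last by rewrite E1 E2.
by have := H (pullQ w^-1%g q); rewrite E1 E2 !pullQM mulgV !pullQ1.
Qed.

(** By the ice rule, shifting R by kappa (h_1 + h_2) is conjugation by
    T_(kappa h_1) T_(kappa h_2). These conjugations telescope with those of the
    left K-matrices, up to an overall one, and leave
    T_(- kappa h_i) K T_(kappa h_i) in place of K; the flips cancel in pairs. *)
Lemma left_dynamical_K i j : i != j ->
  (forall q, K_op_dyn Kl i i (fun z => 2^-1 - z 0 i) (checkR i j (fun z => 1 - z 0 i - z 0 j)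
      (K_op_dyn Kl i i (fun z => 2^-1 - z 0 j) (checkR i j (fun z => z 0 i - z 0 j) q))) =
    checkR i j (fun z => z 0 i - z 0 j) (K_op_dyn Kl i i (fun z => 2^-1 - z 0 j)
      (checkR i j (fun z => 1 - z 0 i - z 0 j) (K_op_dyn Kl i i (fun z => 2^-1 - z 0 i) q)))) <->
  left_dynamical_K_matrix kappa h R Kl.
Proof.
move=> ij; have phi_inj := pair_leg_inj ij; set phi := pair_leg i j in phi_inj.
set u := fun z : 'rV[C]_n => z 0 i - z 0 j.
set v := fun z : 'rV[C]_n => 1 - z 0 i - z 0 j.
set x := fun z : 'rV[C]_n => 2^-1 - z 0 j.
set y := fun z : 'rV[C]_n => 2^-1 - z 0 i.
pose K1 (p : X) := dyn_shift h (fun eta => leg1 (Kl (x p.1) eta) (0 : 'I_2))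
  (single_shift kappa 1) p.2.
pose K2 (p : X) := dyn_shift h (fun eta => leg1 (Kl (y p.1) eta) (1 : 'I_2))
  (single_shift kappa 0) p.2.
pose R12 (f : 'rV[C]_n -> C) (p : X) :=
  dyn_shift h (R (f p.1)) (fun=> 2 * kappa) (2 * p.2).
pose R21 (f : 'rV[C]_n -> C) (p : X) :=
  dyn_shift h (fun eta => op21 (R (f p.1) eta)) (fun=> 2 * kappa) (2 * p.2).
(* The overall conjugation, by T_(kappa (h_i + h_j)). *)
pose Th q := legT h kappa i (legT h kappa j q).
pose Th' q := legT h (- kappa) i (legT h (- kappa) j q).
have ThS q : Th q = shiftQ h (fun k => single_shift kappa i k + single_shift kappa j k) q.
  by rewrite /Th /legT shiftQD.
have Th'S q : Th' q =
    shiftQ h (fun k => single_shift (- kappa) i k + single_shift (- kappa) j k) q.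
  by rewrite /Th' /legT shiftQD.
have F1 q : Th' (legT h kappa j q) = legT h (- kappa) i q by rewrite /Th' legTNK.
have F2 q : legT h (- kappa) j (Th q) = legT h kappa i q by rewrite /Th legTC legTNK.
have F3 q : Th' (legT h kappa i q) = legT h (- kappa) j q by rewrite /Th' legTC legTNK.
have F4 q : Th (legT h (- kappa) j q) = legT h kappa i q by rewrite /Th legTK.
have F5 q : legT h kappa j (Th' q) = legT h (- kappa) i q by rewrite /Th' legTC legTK.
have F6 q : legT h (- kappa) i (Th q) = legT h kappa j q by rewrite /Th legTNK.
have FK q : Th (Th' q) = q by rewrite /Th [legT h kappa j _]F5 legTK.
have FK' q : Th' (Th q) = q by rewrite /Th F3 legTNK.
have G q : legT h (- kappa) j (K_op Kl j y (legT h kappa j q)) =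
    flipQ i j (K_op_dyn Kl i i y (flipQ i j q)).
  by rewrite /K_op_dyn !legT_flipQ // K_op_flipQ // legT_flipQ // !tpermL flipQK.
have iceu : generically (fun p : X =>
    R (u p.1) (2 * p.2) *m Delta_h h = Delta_h h *m R (u p.1) (2 * p.2)).
  exact: ice_diff.
have icev : generically (fun p : X =>
    R (v p.1) (2 * p.2) *m Delta_h h = Delta_h h *m R (v p.1) (2 * p.2)).
  apply: (@ice_coords _ _ _ _ _ R_ice v (- delta_mx 0 i)).
    apply: smoothD; last exact/smoothN/smooth_coord.
    by apply: smoothD; [exact: smooth_cst | exact/smoothN/smooth_coord].
  move=> z t; rewrite /v scalerN -scaleNr !line_coord eqxx eq_sym (negPf ij); ring.
pose c k := single_shift kappa i k + single_shift kappa j k.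
have ci : c i = kappa by rewrite /c /single_shift eqxx (negPf ij) addr0.
have cj : c j = kappa by rewrite /c /single_shift eqxx eq_sym (negPf ij) add0r.
have ec k : extend_coef phi (fun=> 2 * kappa) k = 2 * c k.
  rewrite /extend_coef; case: pickP => [a /eqP <-|nk].
    by rewrite /phi /pair_leg; case: ifP; rewrite ?ci ?cj.
  rewrite /c /single_shift ![k == _]eq_sym; have := nk 0; have := nk 1.
  by rewrite /phi /pair_leg /= => -> ->; rewrite addr0 mulr0.
have cK k : c k + (single_shift (- kappa) i k + single_shift (- kappa) j k) = 0.
  by rewrite /c addrACA !single_shiftKr addr0.
have R12E f q : generically (fun p : X =>
      R (f p.1) (2 * p.2) *m Delta_h h = Delta_h h *m R (f p.1) (2 * p.2)) ->
    mulQ (fun p => emb phi (R12 f p)) q = Th (R_op R i j f (Th' q)).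
  move=> icef; rewrite ThS Th'S.
  rewrite -(@mulQ_dyn_leg2 _ _ _ hss _ R _ phi 0 1 (fun=> 2 * kappa)) //.
  - apply: eq_mulQ => p; congr (emb phi _); apply: eq_dyn_shift => // eta.
    by rewrite leg2_id.
  - by rewrite -!/(c _) ci cj.
  - by right.
have R21E f q : generically (fun p : X =>
      R (f p.1) (2 * p.2) *m Delta_h h = Delta_h h *m R (f p.1) (2 * p.2)) ->
    mulQ (fun p => emb phi (R21 f p)) q = Th (R_op R j i f (Th' q)).
  move=> icef; rewrite ThS Th'S.
  rewrite -(@mulQ_dyn_leg2 _ _ _ hss _ R _ phi 1 0 (fun=> 2 * kappa)) //.
  - apply: eq_mulQ => p; congr (emb phi _); apply: eq_dyn_shift => // eta.
    by rewrite -[LHS]leg2_id op21E.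
  - by rewrite -!/(c _) ci cj.
  - by right.
have K1E q : mulQ (fun p => emb phi (K1 p)) q =
    legT h kappa j (K_op Kl i x (legT h (- kappa) j q)).
  exact: (mulQ_dyn_leg1 hss).
have K2E q : mulQ (fun p => emb phi (K2 p)) q =
    legT h kappa i (K_op Kl j y (legT h (- kappa) i q)).
  exact: (mulQ_dyn_leg1 hss).
pose A (p : X) := R12 u p *m K1 p *m R21 v p *m K2 p.
pose B (p : X) := K2 p *m R12 v p *m K1 p *m R21 u p.
have Rb21 f q : R_op R j i f q = checkR i j f (flipQ i j q) by rewrite -R_op_flip // flipQK.
have AE q : mulQ (fun p => emb phi (A p)) q = Th (flipQ i j (checkR i j u
    (K_op_dyn Kl i i x (checkR i j v (K_op_dyn Kl i i y (flipQ i j (Th' q))))))).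
  rewrite mulQ_emb4 // R12E // K1E R21E // K2E F1 F2 F3 -(F5 q) G Rb21 flipQK //.
  by rewrite flipQ_checkR.
have BE q : mulQ (fun p => emb phi (B p)) q = Th (flipQ i j (K_op_dyn Kl i i y
    (checkR i j v (K_op_dyn Kl i i x (checkR i j u (flipQ i j (Th' q))))))).
  rewrite mulQ_emb4 // R12E // K1E R21E // K2E F1 F2 F6 -F4 G Rb21.
  by rewrite -/(K_op_dyn Kl i i x _).
transitivity (generically (fun p => A p = B p)).
  rewrite -(mulQ_emb_eqP (0 : 'I_2) A B phi_inj); split=> H q.
    by rewrite AE BE H.
  have := H (Th (flipQ i j q)); rewrite AE BE FK' flipQK // => /(congr1 Th').
  by rewrite !FK' => /(flipQ_inj ij).
have sub : submersive (fun p : X => (x p.1, y p.1, 1 * p.2 + 0) : C^o * C^o * C^o).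
  apply: (@submersive_coords2 _ _ _ _ _ x y (- delta_mx 0 j) (- delta_mx 0 i)).
  - exact: oner_neq0.
  - by apply: smoothD; [exact: smooth_cst | exact/smoothN/smooth_coord].
  - by apply: smoothD; [exact: smooth_cst | exact/smoothN/smooth_coord].
  - move=> z t r; rewrite /x !scalerN -!scaleNr !line_coord eqxx eq_sym (negPf ij).
    ring.
  - move=> z t r; rewrite /y !scalerN -!scaleNr !line_coord eqxx (negPf ij).
    ring.
have xy (z : 'rV[C]_n) : x z - y z = u z by rewrite /x /y /u; ring.
have xy' (z : 'rV[C]_n) : x z + y z = v z.
  rewrite /x /y /v; have : 2^-1 + 2^-1 = 1 :> C.
    by rewrite -mulr2n -[LHS]mulr_natr mulVf ?pnatr_eq0.
  by generalize (2^-1 : C) => a <-; ring.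
rewrite /left_dynamical_K_matrix; apply: iff_sym.
apply: iff_trans (generically_submersive _ (0 : X) sub) _.
by split; apply: generically_mono => p /=; rewrite mul1r addr0 xy xy'.
Qed.

End ReflectionRelations.

(** * Uniqueness and existence of the cocycle *)

Section Assembly.
Variables (RR : realType) (d : nat) (h : 'M[RR[i]]_d) (m : nat).
Notation C := RR[i].
Notation n := m.+2.
Hypothesis hss : diagonalizable h.
Notation tend := (tend RR d).
Notation genfun := (genfun RR d n).
Notation op_family := (op_family RR d n).
Variables (kappa : C) (R : C -> C -> tend 2) (K Kl : C -> C -> 'M[C]_d).
Hypothesis R_mero : meromorphic_mx (fun p : C^o * C^o => R p.1 p.2).
Hypothesis K_mero : meromorphic_mx (fun p : C^o * C^o => K p.1 p.2).
Hypothesis Kl_mero : meromorphic_mx (fun p : C^o * C^o => Kl p.1 p.2).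
Hypothesis R_ice : ice_rule h R.
Notation g_affine := (g_affine h kappa Kl).
Notation g_swap := (g_swap h kappa R).
Notation g_sign := (g_sign h kappa K).
Implicit Types (q : genfun).

Definition op_gen (k : nat) : op_family :=
  if k == 0%N then op_affine kappa h Kl ord0
  else if (k < n)%N then op_swap kappa h R (inord k.-1) (inord k)
  else op_sign kappa h K ord_max.

Definition g_gen (k : nat) q : genfun := familyQ (op_gen k) (pullQ (gen m k) q).

Lemma inord_neq k : (0 < k < n)%N -> (inord k.-1 : 'I_n) != inord k.
Proof. by move=> kn; rewrite -val_eqE /= !inordK; lia. Qed.

Lemma op_gen_mero k : meromorphic_difference_op (op_gen k).
Proof.
rewrite /op_gen; case: eqP => k0; first exact: mero_op_affine.
case: ltnP => kn; last exact: mero_op_sign.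
by apply: mero_op_swap => //; apply: inord_neq; lia.
Qed.

Lemma g_gen0 q : g_gen 0 q = g_affine ord0 q.
Proof. by []. Qed.

Lemma g_gen_swap k q : (0 < k < n)%N -> g_gen k q = g_swap (inord k.-1) (inord k) q.
Proof.
by move=> /andP[k0 kn]; rewrite /g_gen /op_gen /gen kn (gtn_eqF k0).
Qed.

Lemma g_gen_sign q : g_gen n q = g_sign ord_max q.
Proof. by rewrite /g_gen /op_gen /gen ltnn. Qed.

Lemma gen_swap k : (0 < k < n)%N ->
  gen m k = swap_reflection (inord k.-1) (inord k).
Proof. by move=> /andP[k0 kn]; rewrite /gen kn (gtn_eqF k0). Qed.

Lemma gen_sign : gen m n = sign_reflection ord_max.
Proof. by rewrite /gen ltnn. Qed.

Lemma difference_op_id : difference_op ((fun=> id) : op_family).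
Proof. exact/mero_difference_op/mero_difference_id. Qed.

Lemma familyQ_id q : familyQ ((fun=> id) : op_family) q = q.
Proof.
rewrite familyQE -[RHS]descend_id; apply: eq_descend => F.
by apply: generically_all => -[z xi].
Qed.

Lemma familyQ_inj (M M' : op_family) v : difference_op M -> difference_op M' ->
  (forall q, familyQ M (pullQ v q) = familyQ M' (pullQ v q)) -> op_family_eq M M'.
Proof.
by move=> dM dM' E; apply/(op_family_eqP dM dM')/(pull_eqP v).
Qed.

Section Extension.
Variable M : affW n -> op_family.
Hypothesis M_ext : cocycle_extension kappa h R K Kl M.

Let M_diff v : difference_op (M v).
Proof. by have [dM _ _] := M_ext; apply: mero_difference_op. Qed.

Let op_gen_diff k : difference_op (op_gen k).
Proof. exact/mero_difference_op/op_gen_mero. Qed.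

Lemma extension_gen k q : (k <= n)%N ->
  familyQ (M (gen m k)) (pullQ (gen m k) q) = g_gen k q.
Proof.
have [_ [Ma Ms Me] _] := M_ext.
move=> lk; rewrite /g_gen.
move: (pullQ _ q); apply/(op_family_eqP (M_diff _) (op_gen_diff _)).
rewrite /gen /op_gen; case: eqP => k0; first exact: Ma.
case: ltnP => kn; last exact: Me.
by apply: Ms; rewrite !inordK; lia.
Qed.

(** The cocycle condition says that v |-> M^v composed with the translation by v
    is an action of W. *)
Lemma extension_mul u v q : familyQ (M (u * v)%g) (pullQ (u * v)%g q) =
  familyQ (M u) (pullQ u (familyQ (M v) (pullQ v q))).
Proof.
have [_ _ [_ MM]] := M_ext.
have dc : difference_op (fun z f => M u z (M v (affW_act u^-1%g z) f)).
  have [dM _ _] := M_ext; apply: mero_difference_op.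
  exact: (mero_difference_comp u^-1%g (dM u) (dM v)).
rewrite (proj1 (op_family_eqP (M_diff _) dc) (MM u v)).
by rewrite (familyQ_comp u _ (M_diff u) (M_diff v)) pullQM mulgA mulVg mul1g.
Qed.

Lemma extension_word w q : letters m w ->
  familyQ (M (wordW m w)) (pullQ (wordW m w) q) = word_act g_gen w q.
Proof.
elim: w q => [|k w IH] q /=.
  have [_ _ [M1 _]] := M_ext.
  rewrite (proj1 (op_family_eqP (M_diff _) difference_op_id) M1).
  by rewrite familyQ_id pullQ1.
by case/andP=> lk lw; rewrite extension_mul IH // extension_gen.
Qed.

Lemma extension_relation w w' q : letters m w -> letters m w' ->
  wordW m w = wordW m w' -> word_act g_gen w q = word_act g_gen w' q.
Proof. by move=> lw lw' E; rewrite -!extension_word // E. Qed.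

End Extension.

Lemma extension_unique (M M' : affW n -> op_family) : cocycle_extension kappa h R K Kl M ->
  cocycle_extension kappa h R K Kl M' -> forall v, op_family_eq (M v) (M' v).
Proof.
move=> EM EM' v; have [w lw <-] := generation v.
apply: (@familyQ_inj _ _ (wordW m w)) => [||q]; last by rewrite !extension_word.
- by have [dM _ _] := EM; apply: mero_difference_op.
- by have [dM _ _] := EM'; apply: mero_difference_op.
Qed.

Fixpoint op_word (w : seq nat) : op_family :=
  if w is k :: w' then
    fun z f => op_gen k z (op_word w' (affW_act (gen m k)^-1%g z) f)
  else fun=> id.

Lemma op_word_mero w : meromorphic_difference_op (op_word w).
Proof.
elim: w => [|k w IH] /=; first exact: mero_difference_id.
exact: (mero_difference_comp (gen m k)^-1%g (op_gen_mero k) IH).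
Qed.

Lemma familyQ_op_word w q :
  familyQ (op_word w) (pullQ (wordW m w) q) = word_act g_gen w q.
Proof.
elim: w q => [|k w IH] q /=; first by rewrite familyQ_id pullQ1.
have dk := mero_difference_op (op_gen_mero k).
rewrite (familyQ_comp (gen m k) _ dk (mero_difference_op (op_word_mero w))).
by rewrite pullQM mulgA mulVg mul1g IH.
Qed.

Lemma wordW_cat w w' : wordW m (w ++ w') = (wordW m w * wordW m w')%g.
Proof. by elim: w => [|k w IH] /=; rewrite ?mul1g // IH mulgA. Qed.

Lemma word_act_cat w w' q :
  word_act g_gen (w ++ w') q = word_act g_gen w (word_act g_gen w' q).
Proof. exact: foldr_cat. Qed.

(** M^v is the composition of the prescribed operators along any word for v; by
    hypothesis the choice of the word does not matter. *)
Lemma extension_exists :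
  (forall w w' q, letters m w -> letters m w' -> wordW m w = wordW m w' ->
    word_act g_gen w q = word_act g_gen w' q) ->
  exists M : affW n -> op_family, cocycle_extension kappa h R K Kl M.
Proof.
move=> rel.
have ex v : exists w, letters m w /\ wordW m w = v.
  by have [w lw wE] := generation v; exists w.
have [W WP] := boolp.choice ex.
have lW v : letters m (W v) by case: (WP v).
have WE v : wordW m (W v) = v by case: (WP v).
have dW w : difference_op (op_word w) by apply/mero_difference_op/op_word_mero.
have actE v w q : letters m w -> wordW m w = v ->
    familyQ (op_word (W v)) (pullQ v q) = word_act g_gen w q.
  by move=> lw wv; rewrite -{2}(WE v) familyQ_op_word; apply: rel; rewrite ?WE.
have genE k : (k <= n)%N -> op_family_eq (op_word (W (gen m k))) (op_gen k).
  move=> lk; apply: (@familyQ_inj _ _ (gen m k)) => [||q] //.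
    exact/mero_difference_op/op_gen_mero.
  by rewrite (actE _ [:: k]) //= ?lk // mulg1.
exists (fun v => op_word (W v)); split.
- by move=> v; apply: op_word_mero.
- split=> [i i0|i j ji|i iN].
  + have -> : i = ord0 by apply: val_inj.
    exact: (genE 0%N).
  + have jn : (0 < j < n)%N by rewrite ji; have := ltn_ord j; rewrite ji.
    have := genE j (ltnW (ltn_ord j)).
    rewrite gen_swap // /op_gen (gtn_eqF (proj1 (andP jn))) (ltn_ord j) inord_val.
    by rewrite ji /= inord_val.
  + have -> : i = ord_max by apply: val_inj => /=; case: iN.
    by have := genE n (leqnn _); rewrite gen_sign /op_gen /= ltnn.
- split=> [|u v].
    apply: (@familyQ_inj _ _ 1%g) => [||q] //; first exact: difference_op_id.
    by rewrite (actE _ [::]) // familyQ_id pullQ1.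
  apply: (@familyQ_inj _ _ (u * v)%g) => [||q] //.
    apply: mero_difference_op.
    exact: (mero_difference_comp u^-1%g (op_word_mero _) (op_word_mero _)).
  rewrite (familyQ_comp u _ (dW (W u)) (dW (W v))) pullQM mulgA mulVg mul1g.
  rewrite (actE _ (W u ++ W v)).
  - by rewrite word_act_cat (actE u (W u)) // (actE v (W v)).
  - by rewrite /letters all_cat; apply/andP; split; apply: lW.
  - by rewrite wordW_cat !WE.
Qed.

Lemma gen_commute j k : (j <= n)%N -> (k <= n)%N -> j != k -> ~~ adjacent j k ->
  (gen m j * gen m k = gen m k * gen m j)%g.
Proof.
by move=> lj lk jk njk; have := gen_far 1%g lj lk jk njk; rewrite !mulg1.
Qed.

Lemma g_gen_far j k q : (j <= n)%N -> (k <= n)%N -> j != k -> ~~ adjacent j k ->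
  g_gen j (g_gen k q) = g_gen k (g_gen j q).
Proof.
wlog : j k / (j < k)%N.
  move=> W lj lk jk njk; have [ltjk|ltkj|//] := ltngtP j k; first exact: W.
  - by apply/esym/W; rewrite 1?eq_sym 1?adjacentC.
  - by move=> E; rewrite E eqxx in jk.
move=> jk lj lk ne njk; have ww := gen_commute lj lk ne njk.
have [ltkn|] := ltnP k n; last move=> gekn.
  have k0n : (0 < k < n)%N by rewrite ltkn andbT; lia.
  have lt2 : ((inord k.-1 : 'I_n) < (inord k : 'I_n))%N by rewrite !inordK; lia.
  rewrite !(g_gen_swap _ k0n); rewrite (gen_swap k0n) in ww.
  have [j0|j0] := posnP j.
    rewrite j0 !g_gen0; rewrite j0 in ww.
    apply: (affine_swap_commute hss) => //.
    by rewrite inordK /=; move: njk; rewrite /adjacent j0; lia.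
  have j0n : (0 < j < n)%N by lia.
  rewrite !(g_gen_swap _ j0n); rewrite (gen_swap j0n) in ww.
  apply: (swap_swap_commute hss) => //.
    by rewrite !inordK; lia.
  by rewrite !inordK; move: njk; rewrite /adjacent; lia.
have kn : k = n by lia.
rewrite kn !g_gen_sign; rewrite kn gen_sign in ww.
have [j0|j0] := posnP j.
  by rewrite j0 !g_gen0; rewrite j0 in ww; apply: (affine_sign_commute hss).
have j0n : (0 < j < n)%N by move: njk; rewrite /adjacent; lia.
rewrite !(g_gen_swap _ j0n); rewrite (gen_swap j0n) in ww.
apply: (swap_sign_commute hss) => //; first by rewrite !inordK; lia.
by rewrite inordK /=; move: njk; rewrite /adjacent kn; lia.
Qed.

Lemma g_gen_involutive_swap k : (0 < k < n)%N ->
  (forall q, g_gen k (g_gen k q) = q) <-> unitary_R R.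
Proof.
move=> kn; have lt2 : ((inord k.-1 : 'I_n) < (inord k : 'I_n))%N.
  by rewrite !inordK; lia.
rewrite -(swap_unitary hss kappa R lt2).
by split=> H q; have := H q; rewrite !g_gen_swap.
Qed.

Lemma g_gen_involutive_affine :
  (forall q, g_gen 0 (g_gen 0 q) = q) <-> unitary_K Kl.
Proof. by rewrite -(affine_unitary hss kappa Kl (ord0 : 'I_n)). Qed.

Lemma g_gen_involutive_sign :
  (forall q, g_gen n (g_gen n q) = q) <-> unitary_K K.
Proof.
rewrite -(sign_unitary hss kappa K (ord_max : 'I_n)).
by split=> H q; have := H q; rewrite !g_gen_sign.
Qed.

Lemma g_gen_braid3 k : (0 < k)%N -> (k.+1 < n)%N ->
  (forall q, g_gen k (g_gen k.+1 (g_gen k q)) =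
             g_gen k.+1 (g_gen k (g_gen k.+1 q))) <-> dynamical_R_matrix kappa h R.
Proof.
move=> k0 kn; have k0n : (0 < k < n)%N by lia.
set i : 'I_n := inord k.-1; set j : 'I_n := inord k; set l : 'I_n := inord k.+1.
have ji : j = i.+1 :> nat by rewrite !inordK; lia.
have jl : (j < l)%N by rewrite !inordK; lia.
have ij : (i < j)%N by rewrite ji.
rewrite -(braid_dynamical_R hss kappa R (ord_neq ij) (ord_neq jl)
  (ord_neq (ltn_trans ij jl))).
rewrite -(braid_operators hss kappa R ji jl); last first.
  by move=> v; have := gen_braid3 v k0 kn; rewrite !gen_swap.
by split=> H q; have := H q; rewrite !g_gen_swap.
Qed.

Lemma g_gen_braid4l :
  (forall q, g_gen 0 (g_gen 1 (g_gen 0 (g_gen 1 q))) =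
             g_gen 1 (g_gen 0 (g_gen 1 (g_gen 0 q)))) <->
  left_dynamical_K_matrix kappa h R Kl.
Proof.
have o0 : inord 0 = ord0 :> 'I_n by apply: val_inj; rewrite /= inordK.
have lt01 : ((ord0 : 'I_n) < (inord 1 : 'I_n))%N by rewrite inordK.
rewrite -(left_dynamical_K hss kappa Kl R_ice (ord_neq lt01)).
rewrite -(left_operators hss kappa R Kl (erefl : (ord0 : 'I_n) = 0%N :> nat) lt01).
  by split=> H q; have := H q; rewrite !g_gen0 !g_gen_swap //= o0.
by move=> v; have := gen_braid4l v; rewrite (gen_swap (k := 1)) //= o0.
Qed.

Lemma g_gen_braid4r :
  (forall q, g_gen m.+1 (g_gen n (g_gen m.+1 (g_gen n q))) =
             g_gen n (g_gen m.+1 (g_gen n (g_gen m.+1 q)))) <->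
  right_dynamical_K_matrix kappa h R K.
Proof.
have oM : inord m.+1 = ord_max :> 'I_n by apply: val_inj; rewrite /= inordK.
have ji : (ord_max : 'I_n) = (inord m : 'I_n).+1 :> nat by rewrite inordK /=.
have ij : ((inord m : 'I_n) < (ord_max : 'I_n))%N by rewrite ji.
have mn : (0 < m.+1 < n)%N by rewrite ltnS leqnn.
rewrite -(right_dynamical_K hss kappa R K (ord_neq ij)).
rewrite -(right_operators hss kappa R K ji).
  by split=> H q; have := H q; rewrite !g_gen_sign !g_gen_swap //= oM.
by move=> v; have := gen_braid4r v; rewrite (gen_swap mn) gen_sign /= oM.
Qed.

Lemma extension_iff :
  (exists M : affW n -> op_family, cocycle_extension kappa h R K Kl M) <->
  [/\ ((2 < n)%N -> dynamical_R_matrix kappa h R) /\ unitary_R R,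
      left_dynamical_K_matrix kappa h R Kl, unitary_K Kl,
      right_dynamical_K_matrix kappa h R K & unitary_K K].
Proof.
split=> [[M EM]|[[dyR uR] lK uKl rK uK]].
  have rel w w' q : letters m w -> letters m w' ->
    wordW m w = wordW m w' -> word_act g_gen w q = word_act g_gen w' q.
    exact: (extension_relation EM).
  have inv k q : (k <= n)%N -> g_gen k (g_gen k q) = q.
    move=> lk; apply: (rel [:: k; k] [::]) => //=; first by rewrite lk.
    by rewrite mulg1 -[X in (_ * X)%g]mulg1 gen_mulK.
  split; [split|..].
  - move=> n2; apply/(@g_gen_braid3 1) => // q.
    apply: (rel [:: 1; 2; 1]%N [:: 2; 1; 2]%N) => //=.
    by rewrite !mulg1; have := @gen_braid3 m 1 1%g isT n2; rewrite !mulg1.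
  - by apply/(@g_gen_involutive_swap 1) => // q; apply: inv.
  - apply/g_gen_braid4l => q; apply: (rel [:: 0; 1; 0; 1]%N [:: 1; 0; 1; 0]%N) => //=.
    by have := @gen_braid4l m 1%g.
  - by apply/g_gen_involutive_affine => q; apply: inv.
  - apply/g_gen_braid4r => q.
    apply: (rel [:: m.+1; n; m.+1; n]%N [:: n; m.+1; n; m.+1]%N) => /=.
    + by rewrite !leqnn !leqnSn.
    + by rewrite !leqnn !leqnSn.
    + by have := @gen_braid4r m 1%g.
  - by apply/g_gen_involutive_sign => q; apply: inv.
apply: extension_exists => w w' q lw lw' E.
apply: (@word_act_wordW m _ g_gen) => //.
- move=> k p lk; have [k0|k0] := posnP k.
    by rewrite k0; move: p; apply/g_gen_involutive_affine.
  have [kn|kn] := ltnP k n.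
    by have kk : (0 < k < n)%N; [rewrite k0 | move: p; apply/(g_gen_involutive_swap kk)].
  have -> : k = n by lia.
  by move: p; apply/g_gen_involutive_sign.
- by move=> j k p; apply: g_gen_far.
- move=> k p k0 kn; move: p; apply/(g_gen_braid3 k0 kn); apply: dyR; lia.
- by apply/g_gen_braid4l.
- by apply/g_gen_braid4r.
Qed.

End Assembly.

(* For n = 2 the dynamical Yang-Baxter equation, an identity on V^{⊗3}, is not a
   consequence of the cocycle conditions, which live on V^{⊗2}; it is therefore
   part of the right-hand side only for n > 2. *)
Theorem proposition2p25 (RR : realType) (kappa : RR[i]) (d : nat)
    (h : 'M[RR[i]]_d) (n : nat)
    (R : RR[i] -> RR[i] -> tend RR d 2) (K Kl : RR[i] -> RR[i] -> 'M[RR[i]]_d)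
    (hn : (2 <= n)%N) (hss : diagonalizable h)
    (R_mero : meromorphic_mx (fun p : RR[i]^o * RR[i]^o => R p.1 p.2))
    (K_mero : meromorphic_mx (fun p : RR[i]^o * RR[i]^o => K p.1 p.2))
    (Kl_mero : meromorphic_mx (fun p : RR[i]^o * RR[i]^o => Kl p.1 p.2))
    (R_ice : ice_rule h R) :
  (forall M M' : affW n -> op_family RR d n,
     cocycle_extension kappa h R K Kl M ->
     cocycle_extension kappa h R K Kl M' ->
     forall v, op_family_eq (M v) (M' v)) /\
  ((exists M : affW n -> op_family RR d n,
      cocycle_extension kappa h R K Kl M) <->
   [/\ ((2 < n)%N -> dynamical_R_matrix kappa h R) /\ unitary_R R,
       left_dynamical_K_matrix kappa h R Kl, unitary_K Kl,
       right_dynamical_K_matrix kappa h R K & unitary_K K]).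
Proof.
case: n hn => [|[|m]] // _; split.
  by move=> M M' EM EM'; apply: extension_unique EM EM'.
exact: extension_iff.
Qed.
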